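(* The projection map $\mathrm{ev}_1\colon\mathcal{TCDS}(M,\alpha)\to\mathrm{Homeo}(M,\xi)$, $(\Phi_H,H,h)\mapsto\phi_H^1$, induces the structure of a first countable topological group on the topological space $\mathrm{Homeo}(M,\xi)$ with the contact topology (the group operation being composition of homeomorphisms).
   Context: Setting. $M$ is a closed (compact, without boundary), connected smooth manifold of dimension $2n+1$ with a cooriented contact structure $\xi=\ker\alpha$, where $\alpha$ is a fixed contact form, and $\nu_\alpha=\alpha\wedge(d\alpha)^n$. $\mathrm{Diff}(M,\xi)$ is the group of diffeomorphisms $\phi$ with $\phi^*\alpha=e^{g}\alpha$ for a smooth function $g$ on $M$. A smooth contact isotopy is a smooth isotopy $\Phi=\{\phi_t\}_{0\le t\le1}$ in $\mathrm{Diff}(M,\xi)$ with $\phi_0=\mathrm{id}$; if $\frac{d}{dt}\phi_t=X_t\circ\phi_t$, its Hamiltonian is $H_t=\alpha(X_t)$; this is a bijection onto smooth functions $H\colon[0,1]\times M\to\mathbb R$, and one writes $\Phi=\Phi_H=\{\phi_H^t\}$. Its conformal factor $h$ is defined by $(\phi_H^t)^*\alpha=e^{h_t}\alpha$, and $(\Phi_H,H,h)$ is a smooth contact dynamical system. Norms and metrics. For a function $H$ on $M$, $\|H\|=\max_M H-\min_M H+\left|\frac{1}{\int_M\nu_\alpha}\int_M H\,\nu_\alpha\right|$; for $H\colon[0,1]\times M\to\mathbb R$, $\|H\|_{(1,\infty)}=\int_0^1\|H_t\|\,dt$; $|h|=\max_{t,x}|h(t,x)|$. Fix a Riemannian distance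 $d$ on $M$; $\overline d(\phi,\psi)=\max_x d(\phi(x),\psi(x))+\max_x d(\phi^{-1}(x),\psi^{-1}(x))$ for homeomorphisms and $\overline d(\Phi,\Psi)=\max_t\overline d(\phi_t,\psi_t)$ for isotopies. A triple $(\Phi,H,h)$ of a continuous isotopy of homeomorphisms and functions $H,h\colon[0,1]\times M\to\mathbb R$ is a topological contact dynamical system if there are smooth contact dynamical systems $(\Phi_{H_i},H_i,h_i)$ with $\Phi_{H_i}\to\Phi$ uniformly, $h_i\to h$ uniformly, and $\|H-H_i\|_{(1,\infty)}\to0$ ($H\in L^1([0,1],C^0(M))$); one writes $\Phi=\Phi_H$. The set of these is $\mathcal{TCDS}(M,\alpha)$, with metric $d_\alpha((\Phi_H,H,h),(\Phi_F,F,f))=\overline d(\Phi_H,\Phi_F)+|h-f|+\|H-F\|_{(1,\infty)}$; its topology is called the contact topology on $\mathcal{TCDS}(M,\alpha)$. $\mathrm{Homeo}(M,\xi)$ is the group of time-one maps $\phi_H^1$ of topological contact dynamical systems (contact homeomorphisms). The contact topology on $\mathrm{Homeo}(M,\xi)$ is the quotient topology induced by the surjection $\mathrm{ev}_1$. Topological groups are assumed to be Hausdorff. *)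

(* Defs.v *)
From HB Require Import structures.
From mathcomp Require Import all_boot all_order all_algebra perm.
From mathcomp Require Import all_classical all_reals all_analysis.
Set Implicit Arguments.
Unset Strict Implicit.
Unset Printing Implicit Defensive.
Import Order.TTheory GRing.Theory Num.Theory.
Import numFieldNormedType.Exports.
Local Open Scope classical_set_scope.
Local Open Scope ring_scope.

Section Smooth.
Variables (R : realType) (V W : normedModType R).

(* Meant for U open: f has continuous iterated directional derivatives up to
   order k at the points of U. *)
Fixpoint Ck (k : nat) (U : set V) (f : V -> W) : Prop :=
  (forall x, U x -> {for x, continuous f}) /\
  if k is k'.+1 then
    forall v, (forall x, U x -> derivable f x v) /\
              Ck k' U (fun x => 'D_v f x)
  else True.

(* On an arbitrary set A, smoothness means local extendability to a smooth map
   on an open set; this covers closed time intervals. *)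
Definition smooth_on (A : set V) (f : V -> W) : Prop :=
  forall x, A x -> exists (U : set V) (g : V -> W),
    [/\ open U, U x, forall k, Ck k U g
      & forall y, U y -> A y -> f y = g y].

End Smooth.

Section Time.
Variable R : realType.

(* Derivative relative to [0,1]: one-sided at the end points. *)
Definition deriv01 (W : normedModType R) (f : R -> W) (t : R) : W :=
  lim ((fun s => (s - t)^-1 *: (f s - f t)) @ within `[0, 1] (t^')).

End Time.

Record chart (R : realType) (m : nat) (M : Type) := Chart {
  dom : set M;
  coord : M -> 'rV[R]_m;
  param : 'rV[R]_m -> M }.

Definition cimg (R : realType) (m : nat) (M : Type) (c : chart R m M) :
  set 'rV[R]_m := coord c @` dom c.

(* coord and param are only meaningful on dom and cimg, where they are mutually
   inverse homeomorphisms between open sets. *)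
Definition is_chart (R : realType) (m : nat) (M : topologicalType)
    (c : chart R m M) : Prop :=
  [/\ open (dom c), open (cimg c),
      forall x, dom c x -> param c (coord c x) = x,
      forall x, dom c x -> {for x, continuous (coord c)}
    & forall x, cimg c x -> {for x, continuous (param c)}].

(* The coordinate expression of phi in the charts c and c', and the set of
   coordinates where it makes sense. *)
Definition in_charts (R : realType) (m : nat) (M : Type) (c c' : chart R m M)
    (phi : M -> M) : 'rV[R]_m -> 'rV[R]_m :=
  fun x => coord c' (phi (param c x)).

Definition in_charts_dom (R : realType) (m : nat) (M : Type)
    (c c' : chart R m M) (phi : M -> M) : set 'rV[R]_m :=
  [set x | cimg c x /\ dom c' (phi (param c x))].

(* The carrier is pointed only to record that the manifold is nonempty. *)
Record closed_manifold (R : realType) (m : nat) := ClosedManifold {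
  mcarrier :> ptopologicalType;
  atlas : set (chart R m mcarrier);
  atlas_chart : forall c, atlas c -> is_chart c;
  atlas_cover : forall x : mcarrier, exists2 c, atlas c & dom c x;
  atlas_compat : forall c c', atlas c -> atlas c' ->
    smooth_on (in_charts_dom c c' id) (in_charts c c' id);
  closed_manifold_hausdorff : hausdorff_space mcarrier;
  closed_manifold_compact : compact [set: mcarrier];
  closed_manifold_connected : connected [set: mcarrier] }.

Section Maps.
Variables (R : realType) (m : nat) (M : closed_manifold R m).

Definition smooth_map (phi : M -> M) : Prop :=
  continuous phi /\
  forall c c', atlas c -> atlas c' ->
    smooth_on (in_charts_dom c c' phi) (in_charts c c' phi).

Definition smooth_function (g : M -> R) : Prop :=
  forall c, atlas c -> smooth_on (cimg c) (fun x => g (param c x) : R^o).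

Definition diffeomorphism (phi : M -> M) : Prop :=
  exists psi : M -> M,
    [/\ cancel phi psi, cancel psi phi, smooth_map phi & smooth_map psi].

Definition homeomorphism (phi : M -> M) : Prop :=
  exists psi : M -> M,
    [/\ cancel phi psi, cancel psi phi, continuous phi & continuous psi].

Definition continuous_family (Phi : R -> M -> M) : Prop :=
  {within `[0, 1] `*` [set: M], continuous (fun p : R * M => Phi p.1 p.2)}.

Definition smooth_family (Phi : R -> M -> M) : Prop :=
  continuous_family Phi /\
  forall c c', atlas c -> atlas c' ->
    smooth_on [set p : R^o * 'rV[R]_m |
                 0 <= (p.1 : R) <= 1 /\ in_charts_dom c c' (Phi p.1) p.2]
              (fun p : R^o * 'rV[R]_m => in_charts c c' (Phi p.1) p.2).

(* Starting at the identity; (t, x) |-> (t, Phi t x) is a diffeomorphism of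
   [0,1] x M. *)
Definition smooth_isotopy (Phi : R -> M -> M) : Prop :=
  Phi 0 = id /\
  exists Psi : R -> M -> M,
    [/\ forall t, 0 <= t <= 1 ->
          cancel (Phi t) (Psi t) /\ cancel (Psi t) (Phi t),
        smooth_family Phi & smooth_family Psi].

Definition continuous_isotopy (Phi : R -> M -> M) : Prop :=
  continuous_family Phi /\ forall t, 0 <= t <= 1 -> homeomorphism (Phi t).

End Maps.

(* A covector is the row of its values on the standard basis. *)
Definition pairing (R : realType) (m : nat) (a v : 'rV[R]_m) : R :=
  \sum_i a 0 i * v 0 i.

(* Coordinate expressions in the charts of the atlas, related by pull-back. *)
Record one_form (R : realType) (m : nat) (M : closed_manifold R m) := OneForm {
  form_in :> chart R m M -> 'rV[R]_m -> 'rV[R]_m;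
  form_smooth : forall c, atlas c -> smooth_on (cimg c) (form_in c);
  form_compat : forall c c', atlas c -> atlas c' ->
    forall x, in_charts_dom c c' id x -> forall v,
      pairing (form_in c' (in_charts c c' id x)) ('D_v (in_charts c c' id) x)
      = pairing (form_in c x) v }.

(* (d a)_x (e_i, e_j) *)
Definition ext_deriv (R : realType) (m : nat) (a : 'rV[R]_m -> 'rV[R]_m)
    (x : 'rV[R]_m) (i j : 'I_m) : R :=
  'D_(delta_mx 0 i) (fun y => a y 0 j : R^o) x
  - 'D_(delta_mx 0 j) (fun y => a y 0 i : R^o) x.

(* (a /\ (d a)^n)_x (e_0, ..., e_2n) *)
Definition contact_density (R : realType) (n : nat)
    (a : 'rV[R]_(n.*2.+1) -> 'rV[R]_(n.*2.+1)) (x : 'rV[R]_(n.*2.+1)) : R :=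
  (2 ^+ n)^-1 * \sum_(s : 'S_(n.*2.+1)) (-1) ^+ s *
    (a x 0 (s ord0) *
     \prod_(k < n) ext_deriv a x (s (inord k.*2.+1)) (s (inord k.*2.+2))).

Record contact_form (R : realType) (n : nat)
    (M : closed_manifold R n.*2.+1) := ContactForm {
  contact_one_form :> one_form M;
  contact_nondeg : forall c, atlas c -> forall x, cimg c x ->
    contact_density (contact_one_form c) x != 0 }.

(* Iterated integral over the box with opposite corners a and b *)
Fixpoint box_integral (R : realType) (m : nat) :
    ('rV[R]_m -> R) -> 'rV[R]_m -> 'rV[R]_m -> R :=
  match m with
  | 0 => fun f _ _ => f 0
  | m'.+1 => fun f a b =>
      \int[lebesgue_measure]_(t in `[a 0 ord0, b 0 ord0])
        box_integral (fun y : 'rV[R]_m' => f (row_mx (t%:M : 'rV[R]_1) y))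
          (rsubmx (a : 'rV[R]_(1 + m'))) (rsubmx (b : 'rV[R]_(1 + m')))
  end.

Definition box (R : realType) (m : nat) (a b : 'rV[R]_m) : set 'rV[R]_m :=
  [set x | forall i, a 0 i <= x 0 i <= b 0 i].

Definition borel (M : ptopologicalType) := g_sigma_algebraType (@open M).

(* mu is the Borel measure defined by the volume form alpha /\ (d alpha)^n, M
   being oriented by it. Boxes inside the images of charts determine mu. *)
Definition is_contact_volume (R : realType) (n : nat)
    (M : closed_manifold R n.*2.+1) (alpha : contact_form M)
    (mu : {measure set (borel M) -> \bar R}) : Prop :=
  forall c, atlas c -> forall a b, box a b `<=` cimg c ->
    mu (param c @` box a b) =
    (box_integral (fun x => `|contact_density (alpha c) x|) a b)%:E.

Definition gram (R : realType) (m : nat) (G : 'M[R]_m) (u v : 'rV[R]_m) : R :=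
  (u *m G *m v^T) 0 0.

Record riemannian_metric (R : realType) (m : nat) (M : closed_manifold R m) :=
  RiemannianMetric {
  metric_in :> chart R m M -> 'rV[R]_m -> 'M[R]_m;
  metric_smooth : forall c, atlas c -> smooth_on (cimg c) (metric_in c);
  metric_sym : forall c, atlas c -> forall x, cimg c x ->
    (metric_in c x)^T = metric_in c x;
  metric_pos : forall c, atlas c -> forall x, cimg c x ->
    forall v, v != 0 -> 0 < gram (metric_in c x) v v;
  metric_compat : forall c c', atlas c -> atlas c' ->
    forall x, in_charts_dom c c' id x -> forall u v,
      gram (metric_in c' (in_charts c c' id x))
        ('D_u (in_charts c c' id) x) ('D_v (in_charts c c' id) x)
      = gram (metric_in c x) u v }.

Section Distance.
Variables (R : realType) (m : nat) (M : closed_manifold R m).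
Variable G : riemannian_metric M.

Definition smooth_curve (gamma : R -> M) : Prop :=
  {within `[0, 1], continuous gamma} /\
  forall c, atlas c ->
    smooth_on [set t : R^o | 0 <= (t : R) <= 1 /\ dom c (gamma t)]
              (fun t : R^o => coord c (gamma t)).

(* The set is a singleton for a smooth curve and 0 <= t <= 1, as the value does
   not depend on the chart. *)
Definition speed (gamma : R -> M) (t : R) : R :=
  xget 0 [set s | exists c, [/\ atlas c, dom c (gamma t)
    & let v := deriv01 (fun r => coord c (gamma r)) t in
      s = Num.sqrt (gram (G c (coord c (gamma t))) v v)]].

Definition curve_length (gamma : R -> M) : R :=
  \int[lebesgue_measure]_(t in `[0, 1]) speed gamma t.

(* x and y are joined by a piecewise smooth curve of length l, given as a
   concatenation of smooth curves. *)
Inductive joined : M -> M -> R -> Prop :=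
| joined_refl x : joined x x 0
| joined_step gamma y l : smooth_curve gamma -> joined (gamma 1) y l ->
    joined (gamma 0) y (curve_length gamma + l).

Definition riem_dist (x y : M) : R := inf [set l | joined x y l].

End Distance.

Section Uniform.
Local Open Scope ereal_scope.
Variables (R : realType) (m : nat) (M : closed_manifold R m).
Variable G : riemannian_metric M.

Definition inv_map (phi : M -> M) (y : M) : M := xget y [set x | phi x = y].

Definition dbar_map (phi psi : M -> M) : \bar R :=
  ereal_sup [set (riem_dist G (phi x) (psi x))%:E | x in [set: M]] +
  ereal_sup [set (riem_dist G (inv_map phi x) (inv_map psi x))%:E
            | x in [set: M]].

Definition dbar (Phi Psi : R -> M -> M) : \bar R :=
  ereal_sup [set dbar_map (Phi t) (Psi t) | t in `[0%R, 1%R]].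

Definition unif_dist (h f : R -> M -> R) : \bar R :=
  ereal_sup [set (`|h p.1 p.2 - f p.1 p.2|%R)%:E
            | p in `[0%R, 1%R] `*` [set: M]].

End Uniform.

Section Hamiltonians.
Variables (R : realType) (m : nat) (M : closed_manifold R m).
Variable mu : {measure set (borel M) -> \bar R}.

Definition ham_norm (H : M -> R) : R :=
  sup (range H) - inf (range H) +
  `| (fine (mu setT))^-1 * \int[mu]_(x in setT) H x |.

Definition norm1oo (H : R -> M -> R) : \bar R :=
  (\int[lebesgue_measure]_(t in `[0%R, 1%R]) (ham_norm (H t))%:E)%E.

Definition simple_path (s : R -> M -> R) : Prop :=
  [/\ finite_set (s @` `[0, 1]),
      forall u : M -> R, measurable [set t : R | 0 <= t <= 1 /\ s t = u]
    & forall t, 0 <= t <= 1 -> continuous (s t)].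

(* Bochner integrable maps [0,1] -> C^0(M); a class in L^1 always has a
   representative which is a pointwise limit of simple maps everywhere. *)
Definition L1C0 (H : R -> M -> R) : Prop :=
  [/\ forall t, 0 <= t <= 1 -> continuous (H t),
      exists s : nat -> R -> M -> R,
        (forall k, simple_path (s k)) /\
        forall t, 0 <= t <= 1 ->
          {uniform, (fun k => s k t) @ \oo --> H t}
    & (norm1oo H < +oo)%E].

End Hamiltonians.

Record system (R : realType) (M : Type) := System {
  flow : R -> M -> M;
  ham : R -> M -> R;
  conf : R -> M -> R }.

Section Contact.
Variables (R : realType) (n : nat) (M : closed_manifold R n.*2.+1).
Variable alpha : contact_form M.

(* phi^* alpha = e^g alpha *)
Definition pullback_scales (phi : M -> M) (g : M -> R) : Prop :=
  forall c c', atlas c -> atlas c' ->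
  forall x, in_charts_dom c c' phi x -> forall v,
    pairing (alpha c' (in_charts c c' phi x)) ('D_v (in_charts c c' phi) x)
    = expR (g (param c x)) * pairing (alpha c x) v.

Definition contact_diffeo (phi : M -> M) (g : M -> R) : Prop :=
  [/\ diffeomorphism phi, smooth_function g & pullback_scales phi g].

(* H_t (Phi_t x) = alpha (d/dt Phi_t x) *)
Definition generates (Phi : R -> M -> M) (H : R -> M -> R) : Prop :=
  forall t, 0 <= t <= 1 -> forall x c, atlas c -> dom c (Phi t x) ->
    H t (Phi t x) = pairing (alpha c (coord c (Phi t x)))
                      (deriv01 (fun s => coord c (Phi s x)) t).

Definition smooth_cds (s : system R M) : Prop :=
  [/\ smooth_isotopy (flow s),
      forall t, 0 <= t <= 1 -> contact_diffeo (flow s t) (conf s t)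
    & generates (flow s) (ham s)].

Variables (G : riemannian_metric M) (mu : {measure set (borel M) -> \bar R}).

Definition contact_dist (s s' : system R M) : \bar R :=
  (dbar G (flow s) (flow s') + unif_dist (conf s) (conf s')
   + norm1oo mu (fun t x => (ham s t x - ham s' t x)%R))%E.

Definition is_tcds (s : system R M) : Prop :=
  [/\ continuous_isotopy (flow s), L1C0 mu (ham s)
    & exists si : nat -> system R M,
      [/\ forall i, smooth_cds (si i),
          dbar G (flow (si i)) (flow s) @[i --> \oo] --> 0%E,
          unif_dist (conf (si i)) (conf s) @[i --> \oo] --> 0%E
        & norm1oo mu (fun t x => ham s t x - ham (si i) t x)
            @[i --> \oo] --> 0%E]].

(* Hamiltonians are not identified almost everywhere and values outside [0,1]
   are kept, so contact_dist is a pseudometric here; this does not affect the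
   quotient topology on time-one maps. *)
Definition TCDS : Type := {s : system R M | is_tcds s}.

HB.instance Definition _ := gen_eqMixin TCDS.
HB.instance Definition _ := gen_choiceMixin TCDS.

Definition TCDS_open : set (set TCDS) :=
  [set O | forall s, O s -> exists2 e : R, 0 < e &
    forall s', (contact_dist (sval s) (sval s') < e%:E)%E -> O s'].

Lemma TCDS_openT : TCDS_open setT.
Proof. by move=> s _; exists 1. Qed.

Lemma TCDS_openI : setI_closed TCDS_open.
Proof.
move=> A B oA oB s [/oA [e e0 eA] /oB [d d0 dB]].
exists (Num.min e d); first by rewrite lt_min e0 d0.
move=> s' ss'; split; [apply: eA | apply: dB];
  by apply: (lt_le_trans ss'); rewrite lee_fin ge_min lexx ?orbT.
Qed.

Lemma TCDS_openU (I : Type) (f : I -> set TCDS) :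
  (forall i, TCDS_open (f i)) -> TCDS_open (\bigcup_i f i).
Proof.
move=> of_ s [i _ /of_ [e e0 ef]]; exists e => // s' /ef ?; by exists i.
Qed.

HB.instance Definition _ :=
  isOpenTopological.Build TCDS TCDS_openT TCDS_openI TCDS_openU.

Definition contact_homeo : Type :=
  {phi : M -> M | exists s : TCDS, flow (sval s) 1 = phi}.

Definition ev1 (s : TCDS) : contact_homeo :=
  exist _ (flow (sval s) 1) (ex_intro _ s erefl).

HB.instance Definition _ := gen_eqMixin contact_homeo.
HB.instance Definition _ := gen_choiceMixin contact_homeo.

Definition homeo_open : set (set contact_homeo) :=
  [set O | open (ev1 @^-1` O)].

Lemma homeo_openT : homeo_open setT.
Proof. exact: (@openT TCDS). Qed.

Lemma homeo_openI : setI_closed homeo_open.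
Proof. by move=> A B oA oB; exact: (@openI TCDS). Qed.

Lemma homeo_openU (I : Type) (f : I -> set contact_homeo) :
  (forall i, homeo_open (f i)) -> homeo_open (\bigcup_i f i).
Proof.
move=> of_; rewrite /homeo_open /= preimage_bigcup.
by apply: (@bigcup_open TCDS) => i _; exact: of_.
Qed.

HB.instance Definition _ :=
  isOpenTopological.Build contact_homeo homeo_openT homeo_openI homeo_openU.

End Contact.

Definition topological_group (T : topologicalType) (mul : T -> T -> T)
    (one : T) (inv : T -> T) : Prop :=
  [/\ [/\ associative mul, left_id one mul, right_id one mul,
          left_inverse one inv mul & right_inverse one inv mul],
      continuous (fun p : T * T => mul p.1 p.2), continuous inv
    & hausdorff_space T].

Definition first_countable (T : topologicalType) : Prop :=
  forall x : T, exists2 B : set (set T), countable B &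
    (forall U, B U -> nbhs x U) /\
    forall U, nbhs x U -> exists2 V, B V & V `<=` U.

(* Main.v *)
(* Topological systems multiply by
   (Phi, H, h) (Psi, F, f) = (Phi o Psi, H + (e^h F) o Phi^-1, h o Psi + f), with
   inverse (Phi^-1, - e^-h (H o Phi), - h o Phi^-1), up to a pseudometric. These
   operations preserve smooth systems and are continuous: for fixed F, if Psi_k tends to
   Psi then F o Psi_k tends to F o Psi in L^1([0,1], C^0) by dominated convergence, and
   the other variations are estimated uniformly in time. So
   they extend to the limits.
   Right translation by s^-1 s' maps s to s' and preserves time-one maps when s and
   s' have the same one; hence ev1 is open, and the operations and the countable
   bases of balls descend to the quotient. It is Hausdorff, since evaluation at a
   point of M is continuous for the topology of M, which the Riemannian distance
   controls uniformly. *)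
Require Import Defs.
From HB Require Import structures.
From mathcomp Require Import all_boot all_order all_algebra perm.
From mathcomp Require Import all_classical all_reals all_analysis.
From mathcomp Require Import measurable_realfun.
From mathcomp Require Import ring lra.
(* Repeated, as the libraries shadow [dom] and [coord]. *)
Require Import Defs.
Set Implicit Arguments.
Unset Strict Implicit.
Unset Printing Implicit Defensive.
Import Order.TTheory GRing.Theory Num.Theory.
Import numFieldNormedType.Exports.
Local Open Scope classical_set_scope.
Local Open Scope ring_scope.

(** * Calculus on finite-dimensional normed spaces *)

Section FiniteDimension.
Variable R : realType.
Implicit Types V W : normedModType R.

Definition findim V := exists k (e : 'I_k -> V) (l : 'I_k -> {linear V -> R^o}),
  (forall i, continuous (l i)) /\ (forall x, x = \sum_i l i x *: e i).

Lemma sum_cvg (T : Type) (F : set_system T) V (I : finType) (P : pred I)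
    (f : I -> T -> V) (a : I -> V) : Filter F ->
  (forall i, P i -> f i x @[x --> F] --> a i) ->
  \sum_(i | P i) f i x @[x --> F] --> \sum_(i | P i) a i.
Proof.
by move=> FF H; apply: cvg_big => //; exact: add_continuous.
Qed.

Lemma line_quotient V W (g : V -> W) (x v : V) (s : R) :
  (fun h : R => h^-1 *: (g ((h *: (1 : R^o) + s) *: v + x) - g (s *: v + x)))
  = (fun h : R => h^-1 *: (g (h *: v + (s *: v + x)) - g (s *: v + x))).
Proof.
apply/funext => h; congr (_ *: (g _ - _)).
by rewrite addrA -scalerDl /GRing.scale /= mulr1.
Qed.

Lemma derivable_line V W (g : V -> W) (x v : V) (s : R) :
  derivable (fun s : R^o => g (s *: v + x)) s 1 <-> derivable g (s *: v + x) v.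
Proof. by rewrite /derivable /= line_quotient. Qed.

Lemma derive_line V W (g : V -> W) (x v : V) (s : R) :
  'D_(1 : R^o) (fun s : R^o => g (s *: v + x)) s = 'D_v g (s *: v + x).
Proof. by rewrite /derive /= line_quotient. Qed.

Lemma mean_value_bound (f : R -> R) (b D e : R) :
  (forall s, `|s| <= `|b| -> derivable f s 1 /\ `|'D_1 f s - D| <= e) ->
  `|f b - f 0 - b * D| <= e * `|b|.
Proof.
move=> H.
have cf s : `|s| <= `|b| -> {for s, continuous f}.
  by case/H => /derivable1_diffP /differentiable_continuous.
have E c : `|c| <= `|b| -> `|'D_1 f c * b - b * D| <= e * `|b|.
  move=> /H [_ cD]; rewrite [b * D]mulrC -mulrBl normrM.
  exact: ler_wpM2r.
case: (ltrgtP b 0) => b0.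
- have B s : s \in `[b, 0] -> `|s| <= `|b|.
    rewrite in_itv /= => /andP [bs s0].
    by rewrite (ler0_norm s0) (ltr0_norm b0) lerN2.
  have [c /B cb Hc] := @MVT_segment R f ('D_1 f) b 0 (ltW b0)
    (fun x xb => derivableP (H x (B x (subset_itv_oo_cc xb))).1)
    (@continuous_in_subspaceT _ _ _ _
       (fun x xb => cf x (B x (set_mem xb)))).
  have -> : f b - f 0 = 'D_1 f c * b.
    by rewrite -opprB Hc sub0r mulrN opprK.
  exact: E.
- have B s : s \in `[0, b] -> `|s| <= `|b|.
    rewrite in_itv /= => /andP [s0 sb].
    by rewrite (ger0_norm s0) (gtr0_norm b0).
  have [c /B cb ->] := @MVT_segment R f ('D_1 f) 0 b (ltW b0)
    (fun x xb => derivableP (H x (B x (subset_itv_oo_cc xb))).1)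
    (@continuous_in_subspaceT _ _ _ _
       (fun x xb => cf x (B x (set_mem xb)))).
  by rewrite subr0; exact: E.
- by rewrite b0 subrr mul0r subr0 normr0 mulr0.
Qed.

Lemma Ck_continuous V W k (U : set V) (f : V -> W) x :
  Ck k U f -> U x -> {for x, continuous f}.
Proof. by case: k => [|k] [H _]; exact: H. Qed.

Lemma Ck_derivable V W k (U : set V) (f : V -> W) x v :
  Ck k.+1 U f -> U x -> derivable f x v.
Proof. by case=> _ H; case: (H v) => D _; exact: D. Qed.

Lemma Ck_derive V W k (U : set V) (f : V -> W) v :
  Ck k.+1 U f -> Ck k U (fun x => 'D_v f x).
Proof. by case=> _ H; case: (H v). Qed.

Lemma C1_differentiable_scalar V (U : set V) (g : V -> R^o) (y : V) :
  findim V -> open U -> Ck 1 U g -> U y -> differentiable g y.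
Proof.
move=> [k [e [l [cl bl]]]] oU CU Uy.
pose D i := 'D_(e i) g y.
pose P (J : nat) (h : V) := \sum_(i < k | (i < J)%N) l i h *: e i.
pose L (J : nat) (h : V) : R := \sum_(i < k | (i < J)%N) l i h * D i.
have cP J : continuous (P J).
  move=> h; apply: sum_cvg => i _; apply: cvgZr_tmp; exact: cl.
have P0 J : P J 0 = 0.
  by rewrite /P big1 // => i _; rewrite linear0 scale0r.
have claim J : forall eps : R, 0 < eps ->
    \forall h \near (0 : V), `|g (P J h + y) - g y - L J h| <= eps * `|h|.
  elim: J => [|J IH] eps e0.
    near=> h; rewrite /P /L !big_pred0 // add0r !subrr normr0.
    by rewrite mulr_ge0 // ltW.
  have [kJ|Jk] := leqP k J.
    have E (i : 'I_k) : (i < J.+1)%N = (i < J)%N.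
      by rewrite !(leq_trans (ltn_ord i)) // leqW.
    apply: filterS (IH _ e0) => h.
    suff [-> ->] : P J.+1 h = P J h /\ L J.+1 h = L J h by [].
    by split; apply: eq_bigl => i; rewrite E.
  pose i := Ordinal Jk.
  have PS h : P J.+1 h = l i h *: e i + P J h.
    rewrite /P (bigD1 i) //=; congr (_ + _); apply: eq_bigl => j.
    by rewrite ltnS (leq_eqVlt j) -(inj_eq val_inj) /=; case: ltngtP.
  have LS h : L J.+1 h = l i h * D i + L J h.
    rewrite /L (bigD1 i) //=; congr (_ + _); apply: eq_bigl => j.
    by rewrite ltnS (leq_eqVlt j) -(inj_eq val_inj) /=; case: ltngtP.
  have [C C0 lC] := linear_lipschitz (cl i).
  pose eps' := eps / 2 / C.
  have e'0 : 0 < eps' by rewrite !divr_gt0.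
  have [d /= d0 dU] : exists2 d : R, 0 < d & ball y d `<=`
      [set z | U z /\ `|'D_(e i) g z - D i| <= eps'].
    apply/nbhs_ballP; apply: filterI; first exact: open_nbhs_nbhs.
    have := Ck_continuous (Ck_derive (e i) CU) Uy.
    move/cvgrPdist_le => /(_ _ e'0); apply: filterS => z.
    by rewrite distrC.
  near=> h.
  have hd : `|P J h| + `|l i h| * `|e i| < d.
    near: h.
    have : (fun h => `|P J h| + `|l i h| * `|e i|) @ (0:V) -->
        `|P J 0| + `|l i 0| * `|e i|.
      apply: cvgD; first by apply: cvg_norm; exact: cP.
      by apply: cvgMr_tmp; apply: cvg_norm; exact: cl.
    rewrite P0 linear0 !normr0 mul0r addr0 => /cvgrPdist_lt /(_ _ d0).
    by apply: filterS => h; rewrite sub0r normrN ger0_norm.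
  have IHh : `|g (P J h + y) - g y - L J h| <= eps / 2 * `|h|.
    by near: h; apply: IH; rewrite divr_gt0.
  pose phi (s : R^o) := g (s *: e i + (P J h + y)).
  have := @mean_value_bound phi (l i h) (D i) eps' _.
  rewrite /phi scale0r add0r => MV.
  have {}MV : `|g (l i h *: e i + (P J h + y)) - g (P J h + y) - l i h * D i|
      <= eps' * `|l i h|.
    apply: MV => s sl.
    have [] : [set z | U z /\ `|'D_(e i) g z - D i| <= eps']
        (s *: e i + (P J h + y)).
      apply: dU; rewrite -ball_normE /ball_ /= distrC addrA addrK.
      apply: le_lt_trans hd; rewrite addrC; apply: le_trans (ler_normD _ _) _.
      by rewrite lerD2l normrZ ler_wpM2r.
    move=> Uz Dz; split; last by rewrite derive_line.
    by apply/derivable_line; exact: Ck_derivable CU Uz.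
  have T (a b c u v : R) : a - c - (u + v) = (a - b - u) + (b - c - v) by ring.
  rewrite PS LS -(addrA (_ *: _)) (T _ (g (P J h + y))).
  apply: le_trans (ler_normD _ _) _.
  rewrite [eps]splitr mulrDl lerD //.
  apply: le_trans MV _; rewrite /eps' -mulrA ler_wpM2l ?divr_ge0 ?(ltW e0) //.
  by rewrite ler_pdivrMl.
pose df (h : V) : R^o := \sum_i l i h * D i.
have dflin : linear df.
  move=> a u v; rewrite /df scaler_sumr -big_split; apply: eq_bigr => i _ /=.
  by rewrite linearP mulrDl /GRing.scale /= mulrA.
pose dfM := GRing.isLinear.Build _ _ _ _ _ dflin.
pose dfL : {linear V -> R^o} := HB.pack df dfM.
have cdf : continuous dfL.
  move=> h; apply: sum_cvg => i _; apply: cvgMr_tmp; exact: cl.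
have ex : g \o shift y = cst (g y) + dfL +o_ (0 : V) id.
  apply/eqaddoP => eps e0.
  apply: filterS (claim k eps e0) => h /=.
  suff [-> ->] : P k h = h /\ L k h = dfL h by rewrite opprD addrA.
  split; rewrite /P /L /df; first by rewrite [RHS]bl; apply: eq_bigl => i; rewrite ltn_ord.
  by apply: eq_bigl => i; rewrite ltn_ord.
apply/diff_locallyP; rewrite (diff_unique cdf ex); split => //.
Unshelve. all: by end_near. Qed.

Lemma findim_differentiable V W (g : V -> W) (y : V) : findim W ->
  (forall l : {linear W -> R^o}, continuous l -> differentiable (l \o g) y) ->
  differentiable g y.
Proof.
move=> [k [e [l [cl bl]]]] H.
rewrite (_ : g = \sum_i (fun x => (l i (g x)) *: e i)); last first.
  by apply/funext => x; rewrite fct_sumE [LHS]bl.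
apply: differentiable_sum => i; apply: differentiableZl.
exact: (H (l i) (cl i)).
Qed.

End FiniteDimension.

Section CkCalculus.
Variable R : realType.
Implicit Types V W : normedModType R.

Lemma derive_linear_comp V W W' (L : {linear W -> W'}) (f : V -> W) (x v : V) :
  continuous L -> derivable f x v -> is_derive x v (L \o f) (L ('D_v f x)).
Proof.
move=> cL df.
have E : (fun h : R => h^-1 *: (L (f (h *: v + x)) - L (f x))) @ 0^' -->
    L ('D_v f x).
  under eq_fun do rewrite -linearB -linearZ_LR.
  apply: continuous_cvg; [exact: cL | exact: df].
by apply: DeriveDef; [apply/cvg_ex; eexists; exact: E | exact/cvg_lim].
Qed.

Lemma is_derive_comp V V' W (f : V -> V') (g : V' -> W) (x v : V) :
  derivable f x v -> differentiable g (f x) ->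
  is_derive x v (g \o f) ('D_('D_v f x) g (f x)).
Proof.
move=> df dg; pose phi (h : R^o) := f (h *: v + x).
have phi0 : phi 0 = f x by rewrite /phi scale0r add0r.
have dphi : differentiable phi 0.
  by apply/derivable1_diffP/derivable_line; rewrite scale0r add0r.
have Dphi : 'D_v f x = 'd phi 0 1.
  by rewrite -deriveE // derive_line scale0r add0r.
have dgphi : differentiable (g \o phi) 0.
  by apply: differentiable_comp => //; rewrite phi0.
apply: DeriveDef.
  apply/derivable1P; exact/derivable1_diffP.
rewrite -[x in LHS]add0r -(scale0r v) -derive_line.
rewrite -[fun s : R^o => _]/(g \o phi) deriveE // diff_comp //; last first.
  by rewrite phi0.
by rewrite -[LHS]/('d g (phi 0) ('d phi 0 1)) -Dphi phi0 -deriveE.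
Qed.

Lemma derive_lincomb V W (g : V -> W) (y : V) k (c : 'I_k -> R) (e : 'I_k -> V) :
  differentiable g y ->
  'D_(\sum_i c i *: e i) g y = \sum_i c i *: 'D_(e i) g y.
Proof.
move=> dg; rewrite deriveE // linear_sum; apply: eq_bigr => i _.
by rewrite linearZ /= deriveE.
Qed.

Lemma deriveDv V W (g : V -> W) (y u v : V) :
  differentiable g y -> 'D_(u + v) g y = 'D_u g y + 'D_v g y.
Proof. by move=> dg; rewrite !deriveE // linearD. Qed.

Lemma deriveZv V W (g : V -> W) (y u : V) (a : R) :
  differentiable g y -> 'D_(a *: u) g y = a *: 'D_u g y.
Proof. by move=> dg; rewrite !deriveE // linearZ. Qed.

Lemma Ck_subset V W k (U U' : set V) (f : V -> W) :
  U' `<=` U -> Ck k U f -> Ck k U' f.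
Proof.
elim: k f => [|k IH] f UU' [cf Df]; split => //; try by move=> x /UU' /cf.
move=> v; have [dv Cv] := Df v; split; first by move=> x /UU' /dv.
exact: IH.
Qed.

Lemma CkW V W k (U : set V) (f : V -> W) : Ck k.+1 U f -> Ck k U f.
Proof.
elim: k f => [|k IH] f [cf Df]; split => //.
by move=> v; have [dv Cv] := Df v; split => //; exact: IH.
Qed.

Lemma Ck_eq V W k (U : set V) (f g : V -> W) : open U ->
  (forall x, U x -> f x = g x) -> Ck k U f -> Ck k U g.
Proof.
move=> oU; elim: k f g => [|k IH] f g fg.
  move=> [cf _]; split => // x Ux.
  have nfg : \near x, f x = g x by apply: filterS (open_nbhs_nbhs (conj oU Ux)).
  rewrite /prop_for /continuous_at -(fg _ Ux).
  exact: cvg_trans (near_eq_cvg nfg) (cf x Ux).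
move=> CU; split.
  move=> x Ux; have [cf _] := CU.
  have nfg : \near x, f x = g x by apply: filterS (open_nbhs_nbhs (conj oU Ux)).
  rewrite /prop_for /continuous_at -(fg _ Ux).
  exact: cvg_trans (near_eq_cvg nfg) (cf x Ux).
move=> v; split.
  move=> x Ux; apply: (@near_eq_derivable _ _ _ f).
    by apply: filterS (open_nbhs_nbhs (conj oU Ux)).
  exact: Ck_derivable CU Ux.
apply: (IH (fun x => 'D_v f x)); last exact: Ck_derive.
move=> x Ux; apply: near_eq_derive.
by apply: filterS (open_nbhs_nbhs (conj oU Ux)).
Qed.

Lemma Ck_cst V W k (U : set V) (a : W) : Ck k U (fun=> a : W).
Proof.
elim: k a => [|k IH] a; split => //; try by move=> x _; exact: cst_continuous.
move=> v; split; first by move=> x _; exact: derivable_cst.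
by under eq_fun do rewrite derive_cst; exact: IH.
Qed.

Lemma Ck_linear V W k (U : set V) (L : {linear V -> W}) :
  continuous L -> Ck k U L.
Proof.
move=> cL; case: k => [|k]; split => //; try by move=> x _; exact: cL.
move=> v; split=> [x _|]; first exact/diff_derivable/linear_differentiable.
rewrite (_ : 'D_v L = fun=> L v); last first.
  apply/funext => x; rewrite /= deriveE ?diff_lin //.
  exact: linear_differentiable.
exact: Ck_cst.
Qed.

Lemma Ck_add V W k (U : set V) (f g : V -> W) : open U ->
  Ck k U f -> Ck k U g -> Ck k U (fun x => f x + g x).
Proof.
move=> oU; elim: k f g => [|k IH] f g Cf Cg.
  split => // x Ux; apply: cvgD.
    exact: (Ck_continuous Cf Ux).
  exact: (Ck_continuous Cg Ux).
split.
  move=> x Ux; apply: cvgD.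
    exact: (Ck_continuous Cf Ux).
  exact: (Ck_continuous Cg Ux).
move=> v; split.
  move=> x Ux; apply: derivableD.
    exact: (Ck_derivable Cf Ux).
  exact: (Ck_derivable Cg Ux).
apply: (@Ck_eq _ _ _ _ (fun x => 'D_v f x + 'D_v g x)) => //.
  move=> x Ux; rewrite -deriveD //.
    exact: (Ck_derivable Cf Ux).
  exact: (Ck_derivable Cg Ux).
by apply: IH; exact: Ck_derive.
Qed.

Lemma Ck_sum V W (I : finType) k (U : set V) (f : I -> V -> W) : open U ->
  (forall i, Ck k U (f i)) -> Ck k U (fun x => \sum_i f i x).
Proof.
move=> oU Cf.
elim: (index_enum I) => [|i r IH].
  by under eq_fun do rewrite big_nil; exact: Ck_cst.
by under eq_fun do rewrite big_cons; exact: Ck_add.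
Qed.

Lemma Ck_linear_comp V W W' k (U : set V) (L : {linear W -> W'}) (f : V -> W) :
  open U -> continuous L -> Ck k U f -> Ck k U (L \o f).
Proof.
move=> oU cL; elim: k f => [|k IH] f Cf.
  split => // x Ux; apply: continuous_comp; last exact: cL.
  exact: Ck_continuous Cf Ux.
split.
  move=> x Ux; apply: continuous_comp; last exact: cL.
  exact: Ck_continuous Cf Ux.
have D v x : U x -> is_derive x v (L \o f) (L ('D_v f x)).
  by move=> Ux; apply: derive_linear_comp => //; exact: Ck_derivable Cf Ux.
move=> v; split; first by move=> x /(D v) [].
apply: (@Ck_eq _ _ _ _ (L \o (fun x => 'D_v f x))) => //.
  by move=> x /(D v) [_ ->].
by apply: IH; exact: Ck_derive.
Qed.

Lemma Ck_opp V W k (U : set V) (f : V -> W) : open U ->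
  Ck k U f -> Ck k U (fun x => - f x).
Proof.
move=> oU Cf; apply: (@Ck_linear_comp _ _ _ _ _ (-%R : {linear W -> W}) f) => //.
exact: opp_continuous.
Qed.

Lemma Ck_mul V k (U : set V) (f g : V -> R^o) : open U ->
  Ck k U f -> Ck k U g -> Ck k U (fun x => f x * g x : R^o).
Proof.
move=> oU; elim: k f g => [|k IH] f g Cf Cg.
  split => // x Ux; apply: cvgM.
    exact: (Ck_continuous Cf Ux).
  exact: (Ck_continuous Cg Ux).
split.
  move=> x Ux; apply: cvgM.
    exact: (Ck_continuous Cf Ux).
  exact: (Ck_continuous Cg Ux).
move=> v; split.
  move=> x Ux; apply: derivableM.
    exact: (Ck_derivable Cf Ux).
  exact: (Ck_derivable Cg Ux).
apply: (@Ck_eq _ _ _ _ (fun x => f x * 'D_v g x + g x * 'D_v f x : R^o)) => //.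
  move=> x Ux; rewrite -[RHS]/('D_v (f * g) x) deriveM //.
    exact: (Ck_derivable Cf Ux).
  exact: (Ck_derivable Cg Ux).
apply: Ck_add => //; apply: IH => //; try exact: Ck_derive; exact: CkW.
Qed.

Lemma Ck_coords V W n k (e : 'I_n -> W) (l : 'I_n -> {linear W -> R^o})
    (U : set V) (f : V -> W) : open U ->
  (forall x, x = \sum_i l i x *: e i) ->
  (forall i, Ck k U (l i \o f)) -> Ck k U f.
Proof.
move=> oU bl H.
rewrite (_ : f = fun x => \sum_i (l i (f x)) *: e i); last first.
  by apply/funext => x; exact: bl.
apply: Ck_sum => // i.
have slin : linear (fun a : R^o => a *: e i).
  by move=> a u v; rewrite scalerDl scalerA.
pose sM := GRing.isLinear.Build _ _ _ _ _ slin.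
pose sL : {linear R^o -> W} := HB.pack (fun a : R^o => a *: e i) sM.
apply: (@Ck_linear_comp _ _ _ _ _ sL (l i \o f)) => //.
exact: scalel_continuous.
Qed.

Lemma C1_differentiable V W k (U : set V) (g : V -> W) (y : V) :
  findim V -> findim W -> open U -> Ck k.+1 U g -> U y -> differentiable g y.
Proof.
move=> fV fW oU Cg Uy; apply: findim_differentiable => // l cl.
apply: (C1_differentiable_scalar fV oU _ Uy).
apply: Ck_linear_comp oU cl _.
by elim: k Cg => // k IH /CkW.
Qed.

Lemma Ck_comp V V' W k (U : set V) (U' : set V') (f : V -> V') (g : V' -> W) :
  findim V' -> findim W -> open U -> open U' ->
  (forall x, U x -> U' (f x)) ->
  Ck k U f -> Ck k U' g -> Ck k U (g \o f).
Proof.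
move=> fV' fW oU oU' UU' Cf Cg.
have [n [w [m [cm bm]]]] := fW.
apply: (Ck_coords oU bm) => j.
have {}Cg : Ck k U' (m j \o g) by exact: Ck_linear_comp.
rewrite -[_ \o _]/((m j \o g : V' -> R^o) \o f).
move: (m j \o g : V' -> R^o) Cg => {fW bm cm m w}{}g Cg.
have fR : @findim R R^o.
  exists 1%N, (fun=> 1), (fun=> idfun); split => [_ x|x]; first exact: cvg_id.
  by rewrite big_ord1 /GRing.scale /= mulr1.
have [q [e [l [cl bl]]]] := fV'.
elim: k f g UU' Cf Cg => [|k IH] f g UU' Cf Cg.
  split => // x Ux; apply: continuous_comp; first exact: Ck_continuous Cf Ux.
  exact: Ck_continuous Cg (UU' _ Ux).
split.
  move=> x Ux; apply: continuous_comp; first exact: Ck_continuous Cf Ux.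
  exact: Ck_continuous Cg (UU' _ Ux).
have dg x : U x -> differentiable g (f x).
  by move=> /UU' Ux; exact: C1_differentiable Cg Ux.
have D v x : U x -> is_derive x v (g \o f) ('D_('D_v f x) g (f x)).
  move=> Ux; apply: is_derive_comp; last exact: dg.
  exact: Ck_derivable Cf Ux.
move=> v; split; first by move=> x /(D v) [].
apply: (@Ck_eq _ _ _ _ (fun x => \sum_i
   (l i ('D_v f x) * 'D_(e i) g (f x)) : R^o)) => //.
  move=> x Ux; have [_ ->] := D v x Ux.
  by rewrite [X in 'D_X g _]bl derive_lincomb //; exact: dg.
apply: Ck_sum => // i; apply: Ck_mul => //.
  by apply: (Ck_linear_comp (L := l i)) => //; exact: Ck_derive.
apply: (IH f (fun y => 'D_(e i) g y)) => //; first exact: CkW.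
exact: Ck_derive.
Qed.

End CkCalculus.

Section FindimInstances.
Variable R : realType.
Implicit Types V W : normedModType R.

Lemma findim_R : @findim R R^o.
Proof.
exists 1%N, (fun=> 1), (fun=> idfun); split => [_ x|x]; first exact: cvg_id.
by rewrite big_ord1 /GRing.scale /= mulr1.
Qed.

Lemma findim_fin V (I : finType) (e : I -> V) (l : I -> {linear V -> R^o}) :
  (forall i, continuous (l i)) -> (forall x, x = \sum_i l i x *: e i) ->
  findim V.
Proof.
move=> cl bl; exists #|I|, (fun i => e (enum_val i)), (fun i => l (enum_val i)).
split=> // x; rewrite [LHS]bl (reindex (@enum_val I predT)) //=.
exact: onW_bij (enum_val_bij I).
Qed.

Definition entry m n (ij : 'I_m * 'I_n) (A : 'M[R]_(m, n)) : R^o := A ij.1 ij.2.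

Lemma entry_linear m n (ij : 'I_m * 'I_n) : linear (@entry m n ij).
Proof. by move=> a u v; rewrite /entry !mxE. Qed.

HB.instance Definition _ m n ij :=
  GRing.isLinear.Build R 'M[R]_(m, n) R^o _ _ (@entry_linear m n ij).

Lemma entry_continuous m n ij : continuous (@entry m n ij).
Proof. by move=> A; exact: coord_continuous. Qed.

Lemma findim_mx m n : findim 'M[R]_(m, n).
Proof.
apply: (@findim_fin _ ('I_m * 'I_n)%type (fun ij => delta_mx ij.1 ij.2)
  (fun ij => @entry m n ij : {linear 'M[R]_(m, n) -> R^o})).
  by move=> ij; exact: entry_continuous.
by move=> A; rewrite [LHS]matrix_sum_delta pair_bigA.
Qed.

Definition pfst V W (p : V * W) : V := p.1.
Definition psnd V W (p : V * W) : W := p.2.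

Lemma pfst_linear V W : linear (@pfst V W). Proof. by []. Qed.
Lemma psnd_linear V W : linear (@psnd V W). Proof. by []. Qed.

HB.instance Definition _ V W :=
  GRing.isLinear.Build R (V * W)%type V _ _ (@pfst_linear V W).
HB.instance Definition _ V W :=
  GRing.isLinear.Build R (V * W)%type W _ _ (@psnd_linear V W).

Lemma pfst_continuous V W : continuous (@pfst V W).
Proof. by move=> p; exact: cvg_fst. Qed.

Lemma psnd_continuous V W : continuous (@psnd V W).
Proof. by move=> p; exact: cvg_snd. Qed.

Definition pinl V W (v : V) : V * W := (v, 0).
Definition pinr V W (w : W) : V * W := (0, w).

Lemma pinl_linear V W : linear (@pinl V W).
Proof. by move=> a u v; congr (_, _); rewrite /= scaler0 addr0. Qed.
Lemma pinr_linear V W : linear (@pinr V W).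
Proof. by move=> a u v; congr (_, _); rewrite /= scaler0 addr0. Qed.

HB.instance Definition _ V W :=
  GRing.isLinear.Build R V (V * W)%type _ _ (@pinl_linear V W).
HB.instance Definition _ V W :=
  GRing.isLinear.Build R W (V * W)%type _ _ (@pinr_linear V W).

Lemma pinl_continuous V W : continuous (@pinl V W).
Proof. by move=> v; apply: cvg_pair; [exact: cvg_id|exact: cvg_cst]. Qed.

Lemma pinr_continuous V W : continuous (@pinr V W).
Proof. by move=> v; apply: cvg_pair; [exact: cvg_cst|exact: cvg_id]. Qed.

Lemma pair_split V W (v : V) (w : W) : (v, w) = pinl W v + pinr V w.
Proof. by congr (_, _); rewrite /= ?addr0 ?add0r. Qed.

Lemma findim_prod V W : findim V -> findim W -> findim (V * W)%type.
Proof.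
move=> [k [e [l [cl bl]]]] [k' [e' [l' [cl' bl']]]].
pose L (i : 'I_k + 'I_k') : {linear (V * W)%type -> R^o} :=
  match i with inl i => l i \o @pfst V W | inr i => l' i \o @psnd V W end.
apply: (@findim_fin _ ('I_k + 'I_k')%type
  (fun i => match i with inl i => pinl W (e i) | inr i => pinr V (e' i) end) L).
  case=> i x; apply: continuous_comp; try exact: cl; try exact: cl'.
    exact: pfst_continuous.
  exact: psnd_continuous.
case=> v w; rewrite big_sumType /= [LHS]pair_split {1}[v]bl {1}[w]bl'.
by rewrite !linear_sum; congr (_ + _); apply: eq_bigr => i _; rewrite linearZ.
Qed.

Lemma Ck_pair (U : normedModType R) V W k (A : set U) (f : U -> V) (g : U -> W) : open A ->
  Ck k A f -> Ck k A g -> Ck k A (fun x => (f x, g x)).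
Proof.
move=> oA Cf Cg; under eq_fun do rewrite pair_split.
apply: Ck_add => //.
  by apply: (Ck_linear_comp (L := @pinl V W)) => //; exact: pinl_continuous.
by apply: (Ck_linear_comp (L := @pinr V W)) => //; exact: pinr_continuous.
Qed.

End FindimInstances.

Section SmoothOn.
Variable R : realType.
Implicit Types V W : normedModType R.

Lemma smooth_on_eq V W (A : set V) (f g : V -> W) :
  (forall x, A x -> f x = g x) -> smooth_on A f -> smooth_on A g.
Proof.
move=> fg sf x Ax; have [U [h [oU Ux Ch fh]]] := sf x Ax.
by exists U, h; split => // y Uy Ay; rewrite -fg ?fh.
Qed.

Lemma smooth_on_subset V W (A B : set V) (f : V -> W) :
  B `<=` A -> smooth_on A f -> smooth_on B f.
Proof.
move=> BA sf x Bx; have [U [h [oU Ux Ch fh]]] := sf x (BA _ Bx).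
by exists U, h; split => // y Uy By; apply: fh => //; exact: BA.
Qed.

Lemma smooth_on_local V W (A : set V) (f : V -> W) :
  (forall x, A x -> exists2 U : set V, nbhs x U & smooth_on (A `&` U) f) ->
  smooth_on A f.
Proof.
move=> H x Ax; have [B nB sf] := H x Ax.
have [U [h [oU Ux Ch fh]]] := sf x (conj Ax (nbhs_singleton nB)).
exists (U `&` B^°), h; split.
- by apply: openI => //; exact: open_interior.
- by split.
- by move=> k; apply: Ck_subset (Ch k) => y [].
- by move=> y [Uy /interior_subset By] Ay; exact: fh.
Qed.

Lemma smooth_on_comp V V' W (A : set V) (B : set V') (f : V -> V')
    (g : V' -> W) : findim V' -> findim W ->
  (forall x, A x -> B (f x)) -> smooth_on A f -> smooth_on B g ->
  smooth_on A (g \o f).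
Proof.
move=> fV' fW AB sf sg x Ax.
have [U [f' [oU Ux Cf ff]]] := sf x Ax.
have [U' [g' [oU' Ux' Cg gg]]] := sg _ (AB x Ax).
exists (U `&` f' @^-1` U'), (g' \o f'); split.
- rewrite openE => y [Uy U'y]; apply: filterI; first exact: open_nbhs_nbhs.
  by apply: (Ck_continuous (Cf 0%N) Uy); exact: open_nbhs_nbhs.
- by split => //=; rewrite -ff.
- move=> k; apply: (@Ck_comp _ _ _ _ _ _ U') => //.
  + rewrite openE => y [Uy U'y]; apply: filterI; first exact: open_nbhs_nbhs.
    by apply: (Ck_continuous (Cf 0%N) Uy); exact: open_nbhs_nbhs.
  + by move=> y [].
  + by apply: Ck_subset (Cf k) => y [].
- move=> y [Uy U'y] Ay /=; rewrite (ff y Uy Ay) gg // -?ff //; exact: AB.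
Qed.

Lemma smooth_on_pair (U : normedModType R) V W (A : set U) (f : U -> V) (g : U -> W) :
  smooth_on A f -> smooth_on A g -> smooth_on A (fun x => (f x, g x)).
Proof.
move=> sf sg x Ax.
have [B [f' [oB Bx Cf ff]]] := sf x Ax.
have [B' [g' [oB' Bx' Cg gg]]] := sg x Ax.
exists (B `&` B'), (fun x => (f' x, g' x)); split => //; first exact: openI.
  move=> k; apply: Ck_pair; first exact: openI.
    by apply: Ck_subset (Cf k) => y [].
  by apply: Ck_subset (Cg k) => y [].
by move=> y [By B'y] Ay; rewrite ff // gg.
Qed.

Lemma smooth_on_Ck V W (A : set V) (f : V -> W) :
  (forall k, Ck k setT f) -> smooth_on A f.
Proof. by move=> Cf x Ax; exists setT, f; split => //; exact: openT. Qed.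

Lemma smooth_on_linear V W (A : set V) (L : {linear V -> W}) :
  continuous L -> smooth_on A L.
Proof. by move=> cL; apply: smooth_on_Ck => k; exact: Ck_linear. Qed.

Lemma smooth_on_cst V W (A : set V) (a : W) : smooth_on A (fun=> a : W).
Proof. by apply: smooth_on_Ck => k; exact: Ck_cst. Qed.

Lemma smooth_on_add V W (A : set V) (f g : V -> W) :
  smooth_on A f -> smooth_on A g -> smooth_on A (fun x => f x + g x).
Proof.
move=> sf sg x Ax.
have [B [f' [oB Bx Cf ff]]] := sf x Ax.
have [B' [g' [oB' Bx' Cg gg]]] := sg x Ax.
exists (B `&` B'), (fun x => f' x + g' x); split => //; first exact: openI.
  move=> k; apply: Ck_add; first exact: openI.
    by apply: Ck_subset (Cf k) => y [].
  by apply: Ck_subset (Cg k) => y [].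
by move=> y [By B'y] Ay; rewrite ff // gg.
Qed.

Lemma smooth_on_opp V W (A : set V) (f : V -> W) :
  smooth_on A f -> smooth_on A (fun x => - f x).
Proof.
move=> sf x Ax; have [B [f' [oB Bx Cf ff]]] := sf x Ax.
exists B, (fun x => - f' x); split => //.
  by move=> k; exact: Ck_opp.
by move=> y By Ay; rewrite ff.
Qed.

Lemma smooth_on_within V W (A : set V) (f : V -> W) x : smooth_on A f ->
  A x -> f @ within A (nbhs x) --> f x.
Proof.
move=> sf Ax; have [U [g [oU Ux Cg fg]]] := sf x Ax.
rewrite (fg x Ux Ax).
have gx : g @ within A (nbhs x) --> g x.
  by apply: cvg_trans (Ck_continuous (Cg 0%N) Ux); apply: cvg_app; exact: cvg_within.
apply: cvg_trans gx; apply: near_eq_cvg; rewrite near_withinE.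
by apply: filterS (open_nbhs_nbhs (conj oU Ux)) => y Uy Ay; rewrite fg.
Qed.

Lemma smooth_on_continuous V W (A : set V) (f : V -> W) x : smooth_on A f ->
  nbhs x A -> {for x, continuous f}.
Proof.
move=> sf nA; have := smooth_on_within sf (nbhs_singleton nA).
by rewrite /prop_for /continuous_at => H; apply: cvg_trans H;
  apply: cvg_app => B /= AB; apply: filterS2 nA AB => y Ay; apply.
Qed.

Lemma smooth_on_differentiable V W (A : set V) (f : V -> W) x :
  findim V -> findim W -> smooth_on A f -> nbhs x A -> differentiable f x.
Proof.
move=> fV fW sf nA.
have [U [g [oU Ux Cg fg]]] := sf x (nbhs_singleton nA).
have dg : differentiable g x := C1_differentiable fV fW oU (Cg 1%N) Ux.
have nfg : {near x, g =1 f}.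
  by apply: filterS2 nA (open_nbhs_nbhs (conj oU Ux)) => y Ay Uy; rewrite fg.
have gfx : g x = f x := nbhs_singleton nfg.
have ex : f \o shift x = cst (f x) + 'd g x +o_ (0 : V) id.
  apply/eqaddoP => eps e0.
  have /eqaddoP/(_ eps e0) := diff_locally dg.
  have cs : h + x @[h --> (0 : V)] --> x.
    by rewrite -[X in _ --> X]add0r; apply: cvgD; [exact: cvg_id|exact: cvg_cst].
  have {cs} : \forall h \near (0 : V), g (h + x) = f (h + x) := cs _ nfg.
  apply: filterS2 => h Eh.
  by rewrite -[(f \o _ - _) h]/(f (h + x) - (f x + 'd g x h)) -Eh -gfx.
have cg : continuous ('d g x) := diff_continuous dg.
by apply/diff_locallyP; rewrite (diff_unique cg ex).
Qed.

End SmoothOn.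

Section Deriv01.
Variable R : realType.
Implicit Types V W : normedModType R.

Lemma within01_proper (t : R) : 0 <= t <= 1 ->
  ProperFilter (within `[0, 1] (t^')).
Proof.
move=> /andP[t0 t1].
apply: Build_ProperFilter_ex => A; rewrite /within /= => /nbhs_ballP[d /= d0 dA].
have [t12|t12] := lerP t 2^-1.
  exists (t + Num.min (d / 2) 2^-1).
  have m0 : 0 < Num.min (d / 2) 2^-1 by rewrite lt_min; lra.
  have md : Num.min (d / 2) 2^-1 <= d / 2 by rewrite ge_min lexx.
  have m2 : Num.min (d / 2) 2^-1 <= 2^-1 :> R by rewrite ge_min lexx orbT.
  apply: dA; [|by rewrite gt_eqF // ltrDl|by rewrite /= in_itv /=; lra].
  by rewrite /ball /= opprD addrA subrr sub0r normrN gtr0_norm //; lra.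
exists (t - Num.min (d / 2) 2^-1).
have m0 : 0 < Num.min (d / 2) 2^-1 by rewrite lt_min; lra.
have md : Num.min (d / 2) 2^-1 <= d / 2 by rewrite ge_min lexx.
have m2 : Num.min (d / 2) 2^-1 <= 2^-1 :> R by rewrite ge_min lexx orbT.
apply: dA; [|by rewrite lt_eqF // gtrBl|by rewrite /= in_itv /=; lra].
by rewrite /ball /= opprB addrC subrK gtr0_norm //; lra.
Qed.

Lemma deriv01_derive W (f : R -> W) (t : R) : 0 <= t <= 1 ->
  derivable (f : R^o -> W) t 1 -> deriv01 f t = 'D_1 (f : R^o -> W) t.
Proof.
move=> t01 df; rewrite /deriv01; have PF := within01_proper t01.
apply: cvg_lim => //.
have H : (fun s : R => (s - t)^-1 *: (f s - f t)) @ t^' --> 'D_1 (f : R^o -> W) t.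
  apply/cvgrPdist_lt => e e0.
  have /cvgrPdist_lt/(_ e e0) := df.
  rewrite /dnbhs !near_withinE => /nbhs_ballP[d /= d0 H].
  apply/nbhs_ballP; exists d => //= s ts sNt.
  have := H (s - t); rewrite /ball /= sub0r normrN subr_eq0.
  by rewrite /GRing.scale /= mulr1 subrK; apply => //; rewrite distrC.
by apply: cvg_trans H; apply: cvg_app; exact: cvg_within.
Qed.

Lemma deriv01_eq W (f g : R -> W) (t : R) : 0 <= t <= 1 ->
  (\forall s \near t, 0 <= s <= 1 -> f s = g s) -> deriv01 f t = deriv01 g t.
Proof.
move=> t01 fg; rewrite /deriv01; congr (lim _).
have ft : f t = g t by exact: (nbhs_singleton fg).
have E : \forall s \near within `[0, 1] (t^'),
    (s - t)^-1 *: (f s - f t) = (s - t)^-1 *: (g s - g t).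
  rewrite near_withinE /dnbhs near_withinE.
  by apply: filterS fg => s fgs _ s01; rewrite ft fgs //; move: s01; rewrite /= in_itv.
have E' : \forall s \near within `[0, 1] (t^'),
    (s - t)^-1 *: (g s - g t) = (s - t)^-1 *: (f s - f t).
  by apply: filterS E => s.
by apply/seteqP; split; exact: near_eq_cvg.
Qed.

Lemma deriv01_ext W (f g : R -> W) (t : R) : 0 <= t <= 1 ->
  (\forall s \near t, 0 <= s <= 1 -> f s = g s) ->
  derivable (g : R^o -> W) t 1 ->
  deriv01 f t = 'D_1 (g : R^o -> W) t.
Proof. by move=> t01 fg dg; rewrite (deriv01_eq t01 fg) deriv01_derive. Qed.

End Deriv01.

(** * Smooth families of maps *)

Section JointContinuity.
Variable R : realType.
Implicit Types X Y Z : topologicalType.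

Definition near01 X (t : R) (x : X) : set_system (R * X) :=
  within [set p | 0 <= p.1 <= 1] (nbhs (t, x)).

Definition jcont X Y (f : R -> X -> Y) : Prop :=
  forall t x, 0 <= t <= 1 -> f p.1 p.2 @[p --> near01 t x] --> f t x.

Global Instance near01_filter X (t : R) (x : X) : Filter (near01 t x).
Proof. exact: within_filter. Qed.

Lemma jcontP X Y (f : R -> X -> Y) :
  {within `[0, 1] `*` [set: X], continuous (fun p : R * X => f p.1 p.2)} <->
  jcont f.
Proof.
rewrite subspace_continuousP.
have -> : `[(0 : R), 1]%classic `*` [set: X] = [set p | 0 <= p.1 <= 1].
  by apply/seteqP; split => [[t x] [/=]|[t x] /=]; rewrite in_itv.
split=> [H t x t01|H [t x] t01]; first exact: (H (t, x) t01).
exact: H.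
Qed.

Lemma near01_fst X (t : R) (x : X) : p.1 @[p --> near01 t x] --> t.
Proof. by apply: cvg_within_filter; exact: cvg_fst. Qed.

Lemma near01_snd X (t : R) (x : X) : p.2 @[p --> near01 t x] --> x.
Proof. by apply: cvg_within_filter; exact: cvg_snd. Qed.

Lemma near01_cvg T X (F : set_system T) (a : T -> R) (b : T -> X) t x :
  Filter F -> a @ F --> t -> b @ F --> x -> (\forall z \near F, 0 <= a z <= 1) ->
  (a z, b z) @[z --> F] --> near01 t x.
Proof.
move=> FF at_ bx a01 B; rewrite /near01 /within /= => nB.
have : \forall z \near F, 0 <= (a z, b z).1 <= 1 -> B (a z, b z).
  exact: (cvg_pair at_ bx nB).
by apply: filterS2 a01 => z z01; apply.
Qed.

Lemma near01_01 X (t : R) (x : X) : \forall p \near near01 t x, 0 <= p.1 <= 1.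
Proof. by rewrite /near01 near_withinE; exact: filterE. Qed.

Lemma jcont_comp X Y Z (f : R -> Y -> Z) (g : R -> X -> Y) :
  jcont f -> jcont g -> jcont (fun t x => f t (g t x)).
Proof.
move=> jf jg t x t01.
apply: (@cvg_comp _ _ _ (fun p => (p.1, g p.1 p.2)) (fun p => f p.1 p.2) _
  (near01 t (g t x))); last exact: jf.
apply: near01_cvg; [exact: near01_fst|exact: jg|exact: near01_01].
Qed.

Lemma jcont_slice X Y (f : R -> X -> Y) (t : R) : jcont f -> 0 <= t <= 1 ->
  continuous (f t).
Proof.
move=> jf t01 x.
apply: (@cvg_comp _ _ _ (fun y => (t, y)) (fun p => f p.1 p.2) _ (near01 t x)).
  by apply: near01_cvg; [exact: cvg_cst|exact: cvg_id|exact: filterE].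
exact: jf.
Qed.

Lemma jcont_eq X Y (f g : R -> X -> Y) :
  (forall t x, 0 <= t <= 1 -> f t x = g t x) -> jcont f -> jcont g.
Proof.
move=> fg jf t x t01; rewrite -fg //.
apply: cvg_trans (jf t x t01); apply: near_eq_cvg.
by rewrite near_withinE; apply: filterE => p /fg.
Qed.

Lemma jcont_cst X Y (f : X -> Y) : continuous f -> jcont (fun=> f).
Proof.
move=> cf t x t01; apply: (@cvg_comp _ _ _ snd f); last exact: cf.
exact: near01_snd.
Qed.

End JointContinuity.

Section Charts.
Variables (R : realType) (m : nat) (M : closed_manifold R m).
Implicit Types (c : chart R m M) (phi psi : M -> M) (Phi Psi : R -> M -> M).

Lemma dom_nbhs c x : atlas c -> dom c x -> nbhs x (dom c).
Proof. by move=> /atlas_chart [oc _ _ _ _] dx; exact: open_nbhs_nbhs. Qed.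

Lemma cimg_nbhs c y : atlas c -> cimg c y -> nbhs y (cimg c).
Proof. by move=> /atlas_chart [_ oc _ _ _] dx; exact: open_nbhs_nbhs. Qed.

Lemma coordK c x : atlas c -> dom c x -> param c (coord c x) = x.
Proof. by move=> /atlas_chart [_ _ H _ _]; exact: H. Qed.

Lemma cimg_coord c x : dom c x -> cimg c (coord c x).
Proof. by exists x. Qed.

Lemma paramK c y : atlas c -> cimg c y -> coord c (param c y) = y.
Proof. by move=> ac [x dx <-]; rewrite coordK. Qed.

Lemma dom_param c y : atlas c -> cimg c y -> dom c (param c y).
Proof. by move=> ac [x dx <-]; rewrite coordK. Qed.

Lemma coord_cvg c x : atlas c -> dom c x -> coord c z @[z --> x] --> coord c x.
Proof. by move=> /atlas_chart [_ _ _ H _]; exact: H. Qed.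

Lemma param_cvg c y : atlas c -> cimg c y -> param c z @[z --> y] --> param c y.
Proof. by move=> /atlas_chart [_ _ _ _ H]; exact: H. Qed.

Lemma in_charts_dom_coord c c' phi x : atlas c -> dom c x -> dom c' (phi x) ->
  in_charts_dom c c' phi (coord c x).
Proof. by move=> ac dx d'; split; [exact: cimg_coord|rewrite coordK]. Qed.

Lemma in_charts_coord c c' phi x : atlas c -> dom c x ->
  in_charts c c' phi (coord c x) = coord c' (phi x).
Proof. by move=> ac dx; rewrite /in_charts coordK. Qed.

Lemma in_charts_dom_nbhs c c' phi x : atlas c -> atlas c' -> continuous phi ->
  in_charts_dom c c' phi x -> nbhs x (in_charts_dom c c' phi).
Proof.
move=> ac ac' cphi [cx dx]; apply: filterI; first exact: cimg_nbhs.
have pc : phi (param c z) @[z --> x] --> phi (param c x).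
  by apply: continuous_comp; [exact: param_cvg|exact: cphi].
exact/pc/dom_nbhs.
Qed.

Lemma in_charts_comp c c'' c' phi psi x : atlas c'' ->
  dom c'' (psi (param c x)) ->
  in_charts c c' (phi \o psi) x =
  in_charts c'' c' phi (in_charts c c'' psi x).
Proof. by move=> ac dx; rewrite /in_charts /= coordK. Qed.

Lemma in_charts_near c c'' psi x : atlas c -> atlas c'' -> continuous psi ->
  cimg c x -> dom c'' (psi (param c x)) ->
  \forall y \near x, dom c'' (psi (param c y)).
Proof.
move=> ac ac' cpsi cx dx.
by apply: filterS (in_charts_dom_nbhs ac ac' cpsi (conj cx dx)) => y [].
Qed.

Lemma smooth_map_comp phi psi :
  smooth_map phi -> smooth_map psi -> smooth_map (phi \o psi).
Proof.
move=> [cphi sphi] [cpsi spsi]; split.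
  by move=> x; apply: continuous_comp; [exact: cpsi|exact: cphi].
move=> c c' ac ac'; apply: smooth_on_local => x [cx dx].
have [c'' ac'' d''] := @atlas_cover _ _ M (psi (param c x)).
exists [set y | dom c'' (psi (param c y))].
  exact: (in_charts_near ac ac'').
apply: (@smooth_on_eq _ _ _ _ (in_charts c'' c' phi \o in_charts c c'' psi)).
  by move=> y [_ dy]; rewrite (in_charts_comp _ _ ac'').
apply: (@smooth_on_comp _ _ _ _ _ (in_charts_dom c'' c' phi)).
- exact: findim_mx.
- exact: findim_mx.
- move=> y [[cy dy] d''y]; split; first exact: cimg_coord.
  by rewrite /in_charts coordK.
- by apply: smooth_on_subset (spsi c c'' ac ac'') => y [[cy dy] d''y].
- exact: sphi.
Qed.

Lemma smooth_function_comp (h : M -> R) psi :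
  smooth_function h -> smooth_map psi -> smooth_function (h \o psi).
Proof.
move=> sh [cpsi spsi] c ac; apply: smooth_on_local => x cx.
have [c'' ac'' d''] := @atlas_cover _ _ M (psi (param c x)).
exists [set y | dom c'' (psi (param c y))].
  exact: (in_charts_near ac ac'').
apply: (@smooth_on_eq _ _ _ _
  ((fun y => h (param c'' y) : R^o) \o in_charts c c'' psi)).
  by move=> y [_ dy]; rewrite /= /in_charts coordK.
apply: (@smooth_on_comp _ _ _ _ _ (cimg c'')).
- exact: findim_mx.
- exact: findim_R.
- by move=> y [cy dy]; exact: cimg_coord.
- by apply: smooth_on_subset (spsi c c'' ac ac'') => y [cy dy].
- exact: sh.
Qed.

Lemma smooth_map_id : smooth_map (id : M -> M).
Proof. by split; [move=> x; exact: cvg_id|move=> c c'; exact: atlas_compat]. Qed.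

Definition fam_dom c c' Phi : set (R^o * 'rV[R]_m) :=
  [set p : R^o * 'rV[R]_m | 0 <= (p.1 : R) <= 1 /\ in_charts_dom c c' (Phi p.1) p.2].

Definition fam_expr c c' Phi : R^o * 'rV[R]_m -> 'rV[R]_m :=
  fun p => in_charts c c' (Phi p.1) p.2.

Lemma jcont_param c Phi (t : R) y : atlas c -> jcont Phi -> 0 <= t <= 1 ->
  cimg c y ->
  Phi p.1 (param c p.2) @[p --> near01 t y] --> Phi t (param c y).
Proof.
move=> ac jP t01 cy.
apply: (@cvg_comp _ _ _ (fun p : R * 'rV[R]_m => (p.1, param c p.2))
   (fun p => Phi p.1 p.2) _ (near01 t (param c y))); last exact: jP.
apply: near01_cvg; [exact: near01_fst| |exact: near01_01].
apply: (@cvg_comp _ _ _ snd (param c)); first exact: near01_snd.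
exact: param_cvg.
Qed.

Lemma fam_near c c' Phi (t : R) y : atlas c -> atlas c' -> jcont Phi ->
  0 <= t <= 1 -> cimg c y -> dom c' (Phi t (param c y)) ->
  \forall p \near ((t, y) : R^o * 'rV[R]_m),
    0 <= (p.1 : R) <= 1 -> fam_dom c c' Phi p.
Proof.
move=> ac ac' jP t01 cy dy.
have : \forall p \near near01 t y, dom c' (Phi p.1 (param c p.2)).
  exact: (jcont_param ac jP t01 cy (dom_nbhs ac' dy)).
have : \forall p \near near01 t y, cimg c p.2.
  exact: (near01_snd t (cimg_nbhs ac cy)).
rewrite /near01 !near_withinE => H1 H2.
apply: filterS2 H1 H2 => p H1 H2 p01; split => //; split; first exact: H1.
exact: H2.
Qed.

Lemma smooth_family_eq Phi Psi : (forall t, 0 <= t <= 1 -> Phi t = Psi t) ->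
  smooth_family Phi -> smooth_family Psi.
Proof.
move=> E [cP sP]; split.
  by apply/jcontP; move/jcontP: cP; apply: jcont_eq => t x /E ->.
move=> c c' ac ac'; have := sP c c' ac ac'.
have S : fam_dom c c' Psi `<=` fam_dom c c' Phi.
  by move=> p [p01]; split => //; rewrite E.
move/(smooth_on_subset S); apply: smooth_on_eq => p [p01 _].
by rewrite /in_charts E.
Qed.

Lemma smooth_family_comp Phi Psi : smooth_family Phi -> smooth_family Psi ->
  smooth_family (fun t => Phi t \o Psi t).
Proof.
move=> [/jcontP jP sP] [/jcontP jQ sQ]; split.
  by apply/jcontP; exact: jcont_comp.
move=> c c' ac ac'; apply: smooth_on_local => -[t x] [/= t01 [cx dx]].
have [c'' ac'' d''] := @atlas_cover _ _ M (Psi t (param c x)).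
exists [set p | 0 <= (p.1 : R) <= 1 -> fam_dom c c'' Psi p].
  exact: fam_near.
apply: (@smooth_on_eq _ _ _ _ (fam_expr c'' c' Phi \o
   (fun p => (p.1, fam_expr c c'' Psi p)))).
  move=> p [[p01 _] /(_ p01) [_ [_ dp]]].
  by rewrite /fam_expr /= (in_charts_comp _ _ ac'').
apply: (@smooth_on_comp _ _ _ _ _ (fam_dom c'' c' Phi)).
- by apply: findim_prod; [exact: findim_R|exact: findim_mx].
- exact: findim_mx.
- move=> p [[p01 [cp dp]] /(_ p01) [_ [_ d''p]]]; split => //=; split.
    exact: cimg_coord.
  by rewrite /fam_expr /in_charts coordK.
- apply: smooth_on_pair; first by apply: (smooth_on_linear (L := @pfst _ _ _));
    exact: pfst_continuous.
  by apply: smooth_on_subset (sQ c c'' ac ac'') => p [[p01 _] /(_ p01)].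
- exact: sP.
Qed.

Lemma smooth_family_cst phi : smooth_map phi -> smooth_family (fun=> phi).
Proof.
move=> [cphi sphi]; split; first by apply/jcontP; exact: jcont_cst.
move=> c c' ac ac'.
apply: (@smooth_on_comp _ _ _ _ _ (in_charts_dom c c' phi) (@psnd _ _ _)).
- exact: findim_mx.
- exact: findim_mx.
- by move=> p [].
- by apply: smooth_on_linear; exact: psnd_continuous.
- exact: sphi.
Qed.

Lemma open_slice_snd (V W : topologicalType) (A : set (V * W)) s z :
  open A -> A (s, z) -> \forall z' \near z, A (s, z').
Proof.
move=> oA As; have c : ((s, z') : V * W) @[z' --> z] --> ((s, z) : V * W).
  by apply: cvg_pair; [exact: cvg_cst|exact: cvg_id].
exact: (c _ (open_nbhs_nbhs (conj oA As))).
Qed.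

Lemma open_slice_fst (V W : topologicalType) (A : set (V * W)) s z :
  open A -> A (s, z) -> \forall r \near s, A (r, z).
Proof.
move=> oA As; have c : ((r, z) : V * W) @[r --> s] --> ((s, z) : V * W).
  by apply: cvg_pair; [exact: cvg_id|exact: cvg_cst].
exact: (c _ (open_nbhs_nbhs (conj oA As))).
Qed.

(* Also at the end points of [0,1], where the time derivative is one-sided, the
   derivatives of a smooth family are partial derivatives of one smooth map. *)
Lemma fam_extension c c' Phi (t : R) y : atlas c -> atlas c' ->
  smooth_family Phi -> 0 <= t <= 1 -> in_charts_dom c c' (Phi t) y ->
  exists (g : R^o * 'rV[R]_m -> 'rV[R]_m) (U : set (R^o * 'rV[R]_m)),
  [/\ open U, U (t, y), forall k, Ck k U g,
      forall p, U p -> 0 <= (p.1 : R) <= 1 ->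
         fam_dom c c' Phi p /\ fam_expr c c' Phi p = g p &
      forall s z, U (s, z) -> 0 <= s <= 1 ->
      (forall v, 'D_v (in_charts c c' (Phi s)) z = 'D_(0, v) g (s, z)) /\
      deriv01 (fun r => coord c' (Phi r (param c z))) s = 'D_(1, 0) g (s, z)].
Proof.
move=> ac ac' [/jcontP jP sP] t01 dy.
have [U [g [oU Ut Cg fg]]] := sP c c' ac ac' (t, y) (conj t01 dy).
pose N := [set p | 0 <= (p.1 : R) <= 1 -> fam_dom c c' Phi p].
have nN : nbhs ((t, y) : R^o * 'rV[R]_m) N.
  by case: dy => cy dy; exact: fam_near.
pose U' := U `&` N^°.
have oU' : open U' by apply: openI => //; exact: open_interior.
have EU' p : U' p -> 0 <= (p.1 : R) <= 1 ->
    fam_dom c c' Phi p /\ fam_expr c c' Phi p = g p.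
  move=> [Up /interior_subset Np] p01; split; first exact: Np.
  by apply: fg => //; exact: Np.
have CU' k : Ck k U' g by apply: Ck_subset (Cg k) => p [].
exists g, U'; split => //.
move=> s z Usz s01.
have dg : differentiable g (s, z).
  apply: (C1_differentiable _ _ oU' (CU' 1%N) Usz); last exact: findim_mx.
  by apply: findim_prod; [exact: findim_R|exact: findim_mx].
split=> [v|].
  have -> : 'D_(0, v) g (s, z) = 'D_v (fun z' => g (s, z')) z.
    have E h : h *: ((0, v) : R^o * 'rV[R]_m) + (s, z) = (s, h *: v + z).
      by congr (_, _); rewrite /= scaler0 add0r.
    rewrite /derive (_ : (fun h : R => _) = (fun h : R =>
      h^-1 *: (g (s, h *: v + z) - g (s, z)))) //.
    by apply/funext => h /=; rewrite E.
  apply: near_eq_derive.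
  have := @open_slice_snd R^o 'rV[R]_m U' s z oU' Usz.
  by apply: filterS => z' Uz'; have [_ <-] := EU' _ Uz' s01.
have E h : h *: ((1, 0) : R^o * 'rV[R]_m) + (s, z) = (h *: (1 : R^o) + s, z).
  by congr (_, _); rewrite /= scaler0 add0r.
have dgs : derivable (fun r : R^o => g (r, z)) s 1.
  have : derivable g (s, z) (1, 0) by exact: diff_derivable.
  rewrite /derivable (_ : (fun h : R => _) = (fun h : R =>
    h^-1 *: (g (h *: (1 : R^o) + s, z) - g (s, z)))) //.
  by apply/funext => h /=; rewrite E.
have -> : 'D_(1, 0) g (s, z) = 'D_1 (fun r : R^o => g (r, z)) s.
  rewrite /derive (_ : (fun h : R => _) = (fun h : R =>
    h^-1 *: (g (h *: (1 : R^o) + s, z) - g (s, z)))) //.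
  by apply/funext => h /=; rewrite E.
apply: deriv01_ext => //.
have := @open_slice_fst R^o 'rV[R]_m U' s z oU' Usz.
by apply: filterS => r Ur r01; have [_ <-] := EU' _ Ur r01.
Qed.

End Charts.

Section InverseMap.
Variable (R : realType) (m : nat) (M : closed_manifold R m).
Implicit Types phi psi : M -> M.

Lemma inv_mapE phi psi : cancel phi psi -> cancel psi phi -> inv_map phi = psi.
Proof.
move=> K K'; apply/funext => y; rewrite /inv_map.
have := @xgetPex _ y [set x | phi x = y] (ex_intro _ (psi y) (K' y)) => /= E.
by rewrite -[LHS]K E.
Qed.

Lemma inv_mapK phi : bijective phi ->
  cancel phi (inv_map phi) /\ cancel (inv_map phi) phi.
Proof. by case=> psi K K'; rewrite (inv_mapE K K'). Qed.

Lemma inv_map_id : inv_map (id : M -> M) = id.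
Proof. exact: (@inv_mapE id id). Qed.

Lemma inv_map_comp phi psi : bijective phi -> bijective psi ->
  inv_map (phi \o psi) = inv_map psi \o inv_map phi.
Proof.
move=> /inv_mapK[K1 K2] /inv_mapK[K3 K4].
by apply: inv_mapE => x /=; rewrite ?K1 ?K3 // K4 K2.
Qed.

Lemma inv_mapV phi : bijective phi -> inv_map (inv_map phi) = phi.
Proof. by move=> /inv_mapK[K1 K2]; exact: inv_mapE. Qed.

Lemma inv_map_bij phi : bijective phi -> bijective (inv_map phi).
Proof. by move=> /inv_mapK[K1 K2]; exists phi. Qed.

End InverseMap.

Section Pairing.
Variables (R : realType) (m : nat).
Implicit Types a v w : 'rV[R]_m.

Lemma pairingD a v w : pairing a (v + w) = pairing a v + pairing a w.
Proof. by rewrite /pairing -big_split; apply: eq_bigr => i _ /=; rewrite mxE mulrDr. Qed.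

Lemma pairing0 a : pairing a 0 = 0.
Proof. by rewrite /pairing big1 // => i _; rewrite mxE mulr0. Qed.

Lemma pairing_delta a i : pairing a (delta_mx 0 i) = a 0 i.
Proof.
rewrite /pairing (bigD1 i) //= mxE !eqxx mulr1 big1 ?addr0 // => j ji.
by rewrite mxE eqxx (negbTE ji) mulr0.
Qed.

Lemma pairing_cvg T (F : set_system T) (a v : T -> 'rV[R]_m) a0 v0 : Filter F ->
  a @ F --> a0 -> v @ F --> v0 ->
  pairing (a x) (v x) @[x --> F] --> pairing a0 v0.
Proof.
move=> FF aa vv; apply: (@sum_cvg R T F R^o) => i _.
have cc (b : T -> 'rV[R]_m) (b0 : 'rV[R]_m) : b @ F --> b0 -> b x 0 i @[x --> F] --> b0 0 i.
  move=> bb; apply: (@cvg_comp T 'rV[R]_m R b (fun A => A 0 i) F (nbhs b0)) => //.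
  exact: coord_continuous.
by apply: cvgM; exact: cc.
Qed.

End Pairing.

Lemma is_derive_pair (R : realType) (U V W : normedModType R) (f : U -> V)
    (g : U -> W) (x v : U) df dg :
  is_derive x v f df -> is_derive x v g dg ->
  is_derive x v (fun y => (f y, g y)) (df, dg).
Proof.
move=> [ff <-] [gg <-].
have E : (fun h : R => h^-1 *: ((f (h *: v + x), g (h *: v + x)) - (f x, g x)))
    @ 0^' --> ('D_v f x, 'D_v g x).
  by apply: cvg_pair; [exact: ff|exact: gg].
by apply: DeriveDef; [apply/cvg_ex; eexists; exact: E|exact/cvg_lim].
Qed.

Section SmoothSystems.
Variables (R : realType) (m : nat) (M : closed_manifold R m).
Implicit Types (c : chart R m M) (phi psi : M -> M) (Phi Psi : R -> M -> M).

Lemma in_charts_derive_comp c c'' c' phi psi x v :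
  atlas c -> atlas c'' -> atlas c' -> smooth_map phi -> smooth_map psi ->
  cimg c x -> dom c'' (psi (param c x)) -> dom c' (phi (psi (param c x))) ->
  'D_v (in_charts c c' (phi \o psi)) x =
  'D_('D_v (in_charts c c'' psi) x) (in_charts c'' c' phi)
     (in_charts c c'' psi x).
Proof.
move=> ac ac'' ac' [cphi sphi] [cpsi spsi] cx d'' d'.
have fx := @findim_mx R 1 m.
have xd : in_charts_dom c c'' psi x by [].
have yd : in_charts_dom c'' c' phi (in_charts c c'' psi x).
  by split; [exact: cimg_coord|rewrite /in_charts coordK].
have df : differentiable (in_charts c c'' psi) x.
  apply: (smooth_on_differentiable fx fx (spsi c c'' ac ac'')).
  exact: in_charts_dom_nbhs.
have dg : differentiable (in_charts c'' c' phi) (in_charts c c'' psi x).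
  apply: (smooth_on_differentiable fx fx (sphi c'' c' ac'' ac')).
  exact: in_charts_dom_nbhs.
have [_ <-] := is_derive_comp (diff_derivable (v := v) df) dg.
apply: near_eq_derive.
apply: filterS (in_charts_near ac ac'' cpsi cx d'') => y dy.
by rewrite (in_charts_comp _ _ ac'').
Qed.

Lemma deriv01_comp c'' c' Phi Psi (t : R) x :
  atlas c'' -> atlas c' -> smooth_family Phi -> smooth_family Psi ->
  0 <= t <= 1 -> dom c'' (Psi t x) -> dom c' (Phi t (Psi t x)) ->
  deriv01 (fun s => coord c' (Phi s (Psi s x))) t =
  deriv01 (fun s => coord c' (Phi s (Psi t x))) t +
  'D_(deriv01 (fun s => coord c'' (Psi s x)) t) (in_charts c'' c' (Phi t))
    (coord c'' (Psi t x)).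
Proof.
move=> ac'' ac' sP sQ t01 d'' d'.
have [c ac dx] := @atlas_cover _ _ M x.
pose y := coord c x; have cy : cimg c y by exact: cimg_coord.
have py : param c y = x by exact: coordK.
pose z := coord c'' (Psi t x); have cz : cimg c'' z by exact: cimg_coord.
have pz : param c'' z = Psi t x by exact: coordK.
have yd : in_charts_dom c c'' (Psi t) y by split => //; rewrite py.
have zd : in_charts_dom c'' c' (Phi t) z by split => //; rewrite pz.
have [g [U [oU Uy Cg Eg Dg]]] := fam_extension ac ac'' sQ t01 yd.
have [k [V [oV Vz Ck_ Ek Dk]]] := fam_extension ac'' ac' sP t01 zd.
have [_ gt] := Dg _ _ Uy t01; rewrite py in gt.
have [kv kt] := Dk _ _ Vz t01; rewrite pz in kt.
rewrite gt kt -/z kv.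
have fR : @findim R (R^o * 'rV[R]_m)%type.
  by apply: findim_prod; [exact: findim_R|exact: findim_mx].
have fM := @findim_mx R 1 m.
have gz : g (t, y) = z by have [_ <-] := Eg _ Uy t01; rewrite /fam_expr /= /in_charts py.
pose f (s : R^o) : R^o * 'rV[R]_m := (s, g (s, y)).
have dg : differentiable g (t, y) := C1_differentiable fR fM oU (Cg 1%N) Uy.
have dk : differentiable k (f t).
  by rewrite /f gz; exact: (C1_differentiable fR fM oV (Ck_ 1%N)).
have df1 : is_derive (t : R^o) 1 (fun s : R^o => ((s, y) : R^o * 'rV[R]_m)) (1, 0).
  exact: is_derive_pair (is_derive_id _ _) (is_derive_cst _ _ _).
have dgy : is_derive (t : R^o) 1 (fun s : R^o => g (s, y)) ('D_(1, 0) g (t, y)).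
  have [d1 E1] := df1.
  by have := is_derive_comp d1 dg; rewrite E1.
have df : is_derive (t : R^o) 1 f (1, 'D_(1, 0) g (t, y)).
  exact: is_derive_pair (is_derive_id _ _) dgy.
have [ddf Edf] := df.
have [dkf Ekf] := is_derive_comp ddf dk.
have -> : 'D_(1, 0) k (t, z) + 'D_(0, 'D_(1, 0) g (t, y)) k (t, z) =
    'D_1 (k \o f) t.
  rewrite Ekf Edf /f gz -deriveDv; last by move: dk; rewrite /f gz.
  by congr ('D__ k _); congr (_, _); rewrite /= ?addr0 ?add0r.
apply: deriv01_ext => //.
have cf : {for (t : R^o), continuous f}.
  by apply: differentiable_continuous; exact/derivable1_diffP.
have Vft : V (f t) by rewrite /f gz.
have H1 : \forall s \near t, V (f s) := cf _ (open_nbhs_nbhs (conj oV Vft)).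
have H2 : \forall s \near t, U (s, y) := @open_slice_fst R^o 'rV[R]_m U t y oU Uy.
apply: filterS2 H1 H2 => s Vs Us s01.
have [[_ [_ ds]] Es] := Eg _ Us s01.
have [_ Eks] := Ek _ Vs s01.
rewrite -[RHS]Eks /f -Es /fam_expr /= /in_charts py coordK //.
by move: ds; rewrite /= py.
Qed.

End SmoothSystems.

(** * Products and inverses of smooth contact systems *)

Lemma cvg_to_pair T (V W : topologicalType) (F : set_system T) (f : T -> V)
    (g : T -> W) (a : V) (b : W) : Filter F ->
  f @ F --> a -> g @ F --> b -> (f x, g x) @[x --> F] --> (a, b).
Proof. by move=> FF fa gb; exact: cvg_pair. Qed.

Section SmoothContactSystems.
Variables (R : realType) (n : nat) (M : closed_manifold R n.*2.+1).
Variable alpha : contact_form M.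
Implicit Types (c : chart R n.*2.+1 M) (phi psi : M -> M) (s : system R M).

Definition sys_one : system R M := System (fun=> id) (fun=> fun=> 0) (fun=> fun=> 0).

Definition sys_mul s s' : system R M := System
  (fun t => flow s t \o flow s' t)
  (fun t z => ham s t z + expR (conf s t (inv_map (flow s t) z)) *
                          ham s' t (inv_map (flow s t) z))
  (fun t x => conf s t (flow s' t x) + conf s' t x).

Definition sys_inv s : system R M := System
  (fun t => inv_map (flow s t))
  (fun t z => - (expR (- conf s t z) * ham s t (flow s t z)))
  (fun t z => - conf s t (inv_map (flow s t) z)).

Lemma pullback_comp phi psi (g h : M -> R) : smooth_map phi -> smooth_map psi ->
  pullback_scales alpha phi g -> pullback_scales alpha psi h ->
  pullback_scales alpha (phi \o psi) (fun x => g (psi x) + h x).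
Proof.
move=> sphi spsi Pg Ph c c' ac ac' x [cx dx] v.
have [c'' ac'' d''] := @atlas_cover _ _ M (psi (param c x)).
rewrite (in_charts_derive_comp v ac ac'' ac') // (in_charts_comp _ _ ac'') //.
rewrite (Pg c'' c' ac'' ac'); last first.
  by split; [exact: cimg_coord|rewrite /in_charts coordK].
rewrite (Ph c c'' ac ac'') // expRD mulrA; congr (expR (g _) * _ * _).
by rewrite /in_charts coordK.
Qed.

Lemma pullback_inv phi psi (g : M -> R) : smooth_map phi -> smooth_map psi ->
  cancel phi psi -> cancel psi phi ->
  pullback_scales alpha phi g ->
  pullback_scales alpha psi (fun x => - g (psi x)).
Proof.
move=> sphi spsi K K' Pg c c' ac ac' x [cx dx] v.
have d : dom c (phi (psi (param c x))) by rewrite K'; exact: dom_param.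
have E := in_charts_derive_comp v ac ac' ac sphi spsi cx dx d.
have := Pg c' c ac' ac (in_charts c c' psi x) _ ('D_v (in_charts c c' psi) x).
rewrite -E -(in_charts_comp _ _ ac') // => {}E.
have px : param c' (in_charts c c' psi x) = psi (param c x).
  by rewrite /in_charts coordK.
rewrite px in E.
have I y : cimg c y -> in_charts c c (phi \o psi) y = y.
  by move=> cy; rewrite /in_charts /= K' paramK.
have ID : 'D_v (in_charts c c (phi \o psi)) x = v.
  rewrite -[RHS](derive_id x v); apply: near_eq_derive.
  by apply: filterS (cimg_nbhs ac cx) => y cy; rewrite I.
rewrite ID I // in E; rewrite E; last first.
  by split; [exact: cimg_coord|rewrite px].
by rewrite mulrA -expRD addNr expR0 mul1r.
Qed.

Lemma diffeo_bij phi : diffeomorphism phi -> bijective phi.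
Proof. by case=> psi [K K' _ _]; exists psi. Qed.

Lemma diffeo_smooth phi : diffeomorphism phi -> smooth_map phi.
Proof. by case=> psi []. Qed.

Lemma diffeo_smooth_inv phi : diffeomorphism phi -> smooth_map (inv_map phi).
Proof. by case=> psi [K K' _ s]; rewrite (inv_mapE K K'). Qed.

Lemma diffeo_inv phi : diffeomorphism phi -> diffeomorphism (inv_map phi).
Proof.
by case=> psi [K K' s s']; rewrite (inv_mapE K K'); exists phi.
Qed.

Lemma contact_diffeo_comp phi psi (g h : M -> R) :
  contact_diffeo alpha phi g -> contact_diffeo alpha psi h ->
  contact_diffeo alpha (phi \o psi) (fun x => g (psi x) + h x).
Proof.
move=> [dp sg pg] [dq sh ph]; split.
- case: dp dq => [phi' [K1 K2 s1 s2]] [psi' [K3 K4 s3 s4]].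
  exists (psi' \o phi'); split; [exact: can_comp|exact: can_comp| |];
    exact: smooth_map_comp.
- move=> c ac; apply: smooth_on_add; last exact: sh.
  exact: (smooth_function_comp sg (diffeo_smooth dq)).
- by apply: pullback_comp => //; exact: diffeo_smooth.
Qed.

Lemma contact_diffeo_inv phi (g : M -> R) :
  contact_diffeo alpha phi g ->
  contact_diffeo alpha (inv_map phi) (fun x => - g (inv_map phi x)).
Proof.
move=> [dp sg pg]; have [K K'] := inv_mapK (diffeo_bij dp).
split; first exact: diffeo_inv.
- move=> c ac; apply: smooth_on_opp.
  exact: (smooth_function_comp sg (diffeo_smooth_inv dp)).
- by apply: (pullback_inv _ _ K K') => //;
    [exact: diffeo_smooth|exact: diffeo_smooth_inv].
Qed.

Lemma smooth_cds_flow s (t : R) : smooth_cds alpha s -> 0 <= t <= 1 ->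
  bijective (flow s t) /\ smooth_map (flow s t).
Proof.
move=> [_ H _] /H [dp _ _]; split; [exact: diffeo_bij|exact: diffeo_smooth].
Qed.

Lemma smooth_cds_inv_family s : smooth_cds alpha s ->
  smooth_family (fun t => inv_map (flow s t)).
Proof.
move=> [[_ [Psi [K sP sQ]]] _ _]; apply: smooth_family_eq sQ => t /K[K1 K2].
by rewrite (inv_mapE K1 K2).
Qed.

Lemma smooth_cds_family s : smooth_cds alpha s -> smooth_family (flow s).
Proof. by move=> [[_ [Psi []]]]. Qed.

Lemma smooth_cds_mul s s' : smooth_cds alpha s -> smooth_cds alpha s' ->
  smooth_cds alpha (sys_mul s s').
Proof.
move=> Cs Cs'; split.
- split; first by rewrite /= (proj1 (let: And3 a _ _ := Cs in a))
     (proj1 (let: And3 a _ _ := Cs' in a)).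
  exists (fun t => inv_map (flow s' t) \o inv_map (flow s t)); split.
  + move=> t t01; have [b _] := smooth_cds_flow Cs t01.
    have [b' _] := smooth_cds_flow Cs' t01.
    have [K1 K2] := inv_mapK b; have [K3 K4] := inv_mapK b'.
    by split => /=; exact: can_comp.
  + by apply: smooth_family_comp; exact: smooth_cds_family.
  + by apply: smooth_family_comp; exact: smooth_cds_inv_family.
- move=> t t01; case: Cs Cs' => [_ H _] [_ H' _].
  exact: contact_diffeo_comp (H t t01) (H' t t01).
- move=> t t01 x c' ac' /= d'.
  have [b _] := smooth_cds_flow Cs t01; have [K1 K2] := inv_mapK b.
  have [c'' ac'' d''] := @atlas_cover _ _ M (flow s' t x).
  rewrite (deriv01_comp ac'' ac' (smooth_cds_family Cs) (smooth_cds_family Cs'))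
    // pairingD K1.
  case: (Cs) (Cs') => [_ /(_ t t01) [_ _ pg] gs] [_ _ gs'].
  congr (_ + _); first exact: gs.
  rewrite -(in_charts_coord _ _ ac'' d'') pg //; last exact: in_charts_dom_coord.
  by rewrite coordK // (gs' _ t01 _ c'').
Qed.

Lemma smooth_cds_inv s : smooth_cds alpha s -> smooth_cds alpha (sys_inv s).
Proof.
move=> Cs; split.
- split; first by case: Cs => [[/= -> _] _ _]; exact: inv_map_id.
  exists (flow s); split.
  + move=> t t01; have [b _] := smooth_cds_flow Cs t01.
    by have [K1 K2] := inv_mapK b.
  + exact: smooth_cds_inv_family.
  + exact: smooth_cds_family.
- move=> t t01; case: Cs => [_ H _].
  exact: contact_diffeo_inv (H t t01).
- move=> t t01 z c' ac' /= d'.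
  have [b _] := smooth_cds_flow Cs t01; have [K1 K2] := inv_mapK b.
  pose x := inv_map (flow s t) z; have fx : flow s t x = z by rewrite K2.
  have [c'' ac'' d''] := @atlas_cover _ _ M z.
  have := @deriv01_comp _ _ _ c'' c' (fun t => inv_map (flow s t)) (flow s) t x
    ac'' ac' (smooth_cds_inv_family Cs) (smooth_cds_family Cs) t01.
  rewrite fx => /(_ d'' d') E.
  have E0 : deriv01 (fun r => coord c' (inv_map (flow s r) (flow s r x))) t = 0.
    rewrite (@deriv01_ext _ _ _ (fun=> coord c' x)) ?derive_cst //.
    apply: filterE => r r01; have [b' _] := smooth_cds_flow Cs r01.
      by have [-> _] := inv_mapK b'.
  rewrite E0 in E.
  have /(congr1 (pairing (alpha c' (coord c' x)))) := E.
  rewrite pairingD pairing0 => {}E.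
  case: (Cs) => [_ /(_ t t01) /contact_diffeo_inv [_ _ pg] gs].
  have := pg c'' c' ac'' ac' (coord c'' z) (in_charts_dom_coord ac'' d'' d')
    (deriv01 (fun s0 : R => coord c'' (flow s s0 x)) t).
  rewrite in_charts_coord // coordK // -/x => F; rewrite F in E.
  have := gs t t01 x c'' ac''; rewrite fx => /(_ d'') G; rewrite -G in E.
  by move: E => /eqP; rewrite eq_sym addr_eq0 => /eqP ->.
Qed.

Lemma smooth_cds_one : smooth_cds alpha sys_one.
Proof.
split.
- split => //; exists (fun=> id); split => //;
    exact: smooth_family_cst (smooth_map_id M).
- move=> t t01; split.
  + by exists id; split => //; exact: smooth_map_id.
  + by move=> c ac; exact: smooth_on_cst.
  + move=> c c' ac ac' x dx v; rewrite expR0 mul1r.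
    exact: (form_compat alpha).
- move=> t t01 x c ac dx /=.
  by rewrite deriv01_derive ?derive_cst ?pairing0 //; exact: derivable_cst.
Qed.

Lemma form_neq0 c y : atlas c -> cimg c y -> exists v, pairing (alpha c y) v != 0.
Proof.
move=> ac cy; have := contact_nondeg alpha ac cy.
apply: contraPP => H; apply/negP; rewrite negbK.
have a0 i : alpha c y 0 i = 0.
  apply/eqP; rewrite -pairing_delta; apply/negPn/negP => Hi; apply: H.
  by exists (delta_mx 0 i).
rewrite /contact_density big1 ?mulr0 // => s _.
by rewrite a0 mul0r mulr0.
Qed.

Lemma form_cvg T (F : set_system T) c (a : T -> 'rV[R]_(n.*2.+1))
    (y : 'rV[R]_(n.*2.+1)) : Filter F -> atlas c -> cimg c y ->
  a @ F --> y -> alpha c (a z) @[z --> F] --> alpha c y.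
Proof.
move=> FF ac cy ay; apply: (@cvg_comp _ _ _ a (alpha c) F (nbhs y)) => //.
apply: (smooth_on_continuous (form_smooth alpha ac)).
exact: cimg_nbhs.
Qed.

Lemma smooth_cds_jcont s : smooth_cds alpha s ->
  jcont (ham s) /\ jcont (conf s).
Proof.
move=> Cs; have sf := smooth_cds_family Cs; have /jcontP jf := sf.1.
have /jcontP ji := (smooth_cds_inv_family Cs).1.
have [_ Ht gs] := Cs.
suff [jK jc] : jcont (fun t x => ham s t (flow s t x)) /\ jcont (conf s).
  split => //; have := jcont_comp jK ji; apply: jcont_eq => t x t01.
  by have [b _] := smooth_cds_flow Cs t01; have [_ ->] := inv_mapK b.
suff H (t : R) x : 0 <= t <= 1 ->
    (ham s p.1 (flow s p.1 p.2) @[p --> near01 t x] --> ham s t (flow s t x)) /\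
    (conf s p.1 p.2 @[p --> near01 t x] --> conf s t x).
  by split => t x t01; case: (H t x t01).
move=> t01.
have [c ac dx] := @atlas_cover _ _ M x.
have [c' ac' dfx] := @atlas_cover _ _ M (flow s t x).
pose y := coord c x; have cy : cimg c y by exact: cimg_coord.
have yd : in_charts_dom c c' (flow s t) y by exact: in_charts_dom_coord.
have [g [U [oU Uy Cg Eg Dg]]] := fam_extension ac ac' sf t01 yd.
pose P (p : R * M) : R^o * 'rV[R]_(n.*2.+1) := (p.1, coord c p.2).
have Pc : P p @[p --> near01 t x] --> ((t, y) : R^o * 'rV[R]_(n.*2.+1)).
  apply: (@cvg_to_pair _ R^o 'rV[R]_(n.*2.+1)); first exact: near01_fst.
  apply: (@cvg_comp _ _ _ snd (coord c)); first exact: near01_snd.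
  exact: coord_cvg.
have NP : \forall p \near near01 t x, [/\ 0 <= p.1 <= 1, U (P p) & dom c p.2].
  near=> p; split; near: p; first exact: near01_01.
    exact: (Pc _ (open_nbhs_nbhs (conj oU Uy))).
  exact: (near01_snd t (dom_nbhs ac dx)).
have cg : {for ((t, y) : R^o * 'rV[R]_(n.*2.+1)), continuous g}.
  exact: Ck_continuous (Cg 0%N) Uy.
have cDg v : {for ((t, y) : R^o * 'rV[R]_(n.*2.+1)), continuous (fun p => 'D_v g p)}.
  exact: Ck_continuous (Ck_derive v (Cg 1%N)) Uy.
have gP : g (P p) @[p --> near01 t x] --> g (t, y).
  exact: (cvg_comp _ _ Pc cg).
have DgP v : 'D_v g (P p) @[p --> near01 t x] --> 'D_v g (t, y).
  exact: (cvg_comp _ _ Pc (cDg v)).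
have gE p : U (P p) -> 0 <= p.1 <= 1 -> dom c p.2 ->
    [/\ dom c' (flow s p.1 p.2), g (P p) = coord c' (flow s p.1 p.2),
     in_charts_dom c c' (flow s p.1) (coord c p.2) &
     param c (coord c p.2) = p.2].
  move=> UP p01 dp; have [[_ [d1 d2]] <-] := Eg _ UP p01.
  have pp := coordK ac dp; split => //; first by move: d2; rewrite /= pp.
  by rewrite /fam_expr /in_charts /= pp.
have [_ gty _ px] := gE (t, x) Uy t01 dx; rewrite /P /= in gty px.
have cgt : cimg c' (g (t, y)) by rewrite gty; exact: cimg_coord.
have FF := near01_filter t x.
have aP := form_cvg FF ac' cgt gP.
have NK p : [/\ 0 <= p.1 <= 1, U (P p) & dom c p.2] ->
    pairing (alpha c' (g (P p))) ('D_(1, 0) g (P p)) =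
    ham s p.1 (flow s p.1 p.2).
  move=> [p01 UP dp]; have [d' -> _ pp] := gE p UP p01 dp.
  rewrite (gs _ p01 _ c' ac' d'); have [_ <-] := Dg _ _ UP p01.
  by rewrite pp.
have NC v p : [/\ 0 <= p.1 <= 1, U (P p) & dom c p.2] ->
    pairing (alpha c' (g (P p))) ('D_(0, v) g (P p)) =
    expR (conf s p.1 p.2) * pairing (alpha c (coord c p.2)) v.
  move=> [p01 UP dp]; have [d' -> d'' pp] := gE p UP p01 dp.
  have [<- _] := Dg _ _ UP p01; have [_ _ /(_ c c' ac ac' _ d'' v)] := Ht _ p01.
  by rewrite pp in_charts_coord.
have b0 : [/\ 0 <= (t, x).1 <= 1, U (P (t, x)) & dom c (t, x).2] by [].
split.
  rewrite -(NK (t, x) b0).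
  have H := pairing_cvg FF aP (DgP (1, 0)).
  apply: cvg_trans H.
  by apply: near_eq_cvg; apply: filterS NP => p; exact: NK.
have [v v0] := form_neq0 ac cy.
pose A p := pairing (alpha c' (g (P p))) ('D_(0, v) g (P p)).
pose B (p : R * M) := pairing (alpha c (coord c p.2)) v.
have Ac : A p @[p --> near01 t x] --> A (t, x) := pairing_cvg FF aP (DgP (0, v)).
have Bc : B p @[p --> near01 t x] --> B (t, x).
  apply: pairing_cvg; last exact: cvg_cst.
  apply: form_cvg => //.
  apply: (@cvg_comp _ _ _ snd (coord c)); first exact: near01_snd.
  exact: coord_cvg.
have ABE p : [/\ 0 <= p.1 <= 1, U (P p) & dom c p.2] -> B p != 0 ->
    A p / B p = expR (conf s p.1 p.2).
  by move=> /(NC v) Np Bp; rewrite /A Np mulfK.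
have B0 : B (t, x) != 0 by [].
have ABc : A p / B p @[p --> near01 t x] --> A (t, x) / B (t, x).
  by apply: cvgM => //; exact: cvgV.
have NB : \forall p \near near01 t x, B p != 0.
  exact: (Bc _ (open_nbhs_nbhs (conj (@open_neq _ 0) B0))).
have E0 := ABE _ b0 B0.
rewrite -[conf s t x]expRK -E0.
have ABp : 0 < A (t, x) / B (t, x) by rewrite E0 expR_gt0.
have := cvg_comp _ _ ABc (continuous_ln ABp).
apply: cvg_trans; apply: near_eq_cvg; apply: filterS2 NP NB => p Np Bp.
by rewrite /= ABE // expRK.
Unshelve. all: by end_near. Qed.

End SmoothContactSystems.

(** * The Riemannian distance *)

Section RealEstimates.
Variable R : realType.

Lemma integral_growth (sigma F : R -> R) (K : R) :
  {within `[0, 1], continuous sigma} -> {within `[0, 1], continuous F} ->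
  (forall t, t \in `]0, 1[ -> derivable F t 1 /\ `|'D_1 F t| <= K * sigma t) ->
  `|F 1 - F 0| <= K * \int[lebesgue_measure]_(t in `[0, 1]) sigma t.
Proof.
move=> cs cF dF; pose I t := \int[lebesgue_measure]_(u in `[0, t]) sigma u.
have int1 : lebesgue_measure.-integrable `[0, 1] (EFin \o sigma).
  exact: continuous_compact_integrable (@segment_compact _ _ _) cs.
have cI : {within `[0, 1], continuous I}.
  exact: parameterized_integral_continuous ler01 int1.
have dI (t : R) : t \in `]0, 1[ -> derivable I t 1 /\ derive1 I t = sigma t.
  move=> t01; have /andP[t0 t1] : 0 < t < 1 by move: t01; rewrite in_itv.
  apply: (continuous_FTC1_closed t1 int1 t0).
  have : {within `]0, 1[, continuous sigma}.
    by apply: continuous_subspaceW cs; exact: subset_itv_oo_cc.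
  rewrite continuous_open_subspace; last exact: interval_open.
  by apply; rewrite inE.
have I0 : I 0 = 0 by rewrite /I set_itv1 Rintegral_set1.
rewrite -[X in K * X]/(I 1); clearbody I.
have mono (F' : R -> R) : {within `[0, 1], continuous F'} ->
    (forall t, t \in `]0, 1[ -> derivable F' t 1 /\ - (K * sigma t) <= 'D_1 F' t) ->
    F' 0 - F' 1 <= K * I 1.
  move=> cF' dF'; pose H t := K * I t + F' t.
  have cH : {within `[0, 1], continuous H}.
    move=> t; apply: cvgD; last exact: cF'.
    by apply: cvgMl_tmp; exact: cI.
  have dH (t : R) : t \in `]0, 1[ -> is_derive t 1 H (K * sigma t + 'D_1 F' t).
    move=> t01; have [d1 E1] := dI t t01; have [d2 _] := dF' t t01.
    have i1 : is_derive t 1 I (sigma t).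
      by have := derivableP d1; rewrite -derive1E E1.
    have i2 := derivableP d2.
    exact: is_deriveD (is_deriveZ K i1) i2.
  have dH1 (t : R) : t \in `]0, 1[ -> derivable H t 1 by move=> /dH [].
  have dH2 (t : R) : t \in `]0, 1[ -> 0 <= derive1 H t.
    move=> t01; have [_ E] := dH t t01; rewrite derive1E E -lerBlDl sub0r.
    exact: (dF' t t01).2.
  have := ger0_derive1_le_cc dH1 dH2 cH.
  move=> /(_ 0 1); rewrite !in_itv /= !lexx ler01 => /(_ isT isT isT).
  rewrite /H I0 mulr0 add0r.
  by rewrite lerBlDr.
rewrite ler_norml; apply/andP; split.
  rewrite lerNl opprB; apply: mono => // t /dF [d /ler_normlP [H _]].
  by split => //; rewrite lerNl.
have := mono (fun t => - F t); rewrite opprK addrC; apply.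
  by move=> t; apply: cvgN; exact: cF.
move=> t /dF [d /ler_normlP [_ H]].
have [d' ->] := is_deriveN (derivableP d).
by split => //; rewrite lerN2.
Qed.

Definition bump (a : R) : R := (Num.max 0 a) ^+ 2.

Lemma bump_derive (a : R) : is_derive a 1 bump (2 * Num.max 0 a).
Proof.
have [a0|a0|<-] := ltrgtP 0 a.
- have E : \near a, a ^+ 2 = bump a.
    near=> x; rewrite /bump max_r //; apply/ltW; near: x; exact: lt_nbhsr.
  apply: (@near_eq_is_derive _ _ _ (fun x : R => x ^+ 2)) => //.
  apply: DeriveDef; first exact: exprn_derivable.
  by rewrite exp_derive expr1 /GRing.scale /= mulr1.
- rewrite mulr0.
  have E : \near a, 0 = bump a.
    near=> x; rewrite /bump max_l ?expr0n //; apply/ltW; near: x; exact: lt_nbhsl.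
  apply: (@near_eq_is_derive _ _ _ (fun=> 0 : R)) => //; exact: is_derive_cst.
rewrite mulr0.
have E : (fun h : R => h^-1 *: (bump (h *: 1 + 0) - bump 0)) @ 0^' --> (0 : R).
  apply/cvgrPdist_le => e e0; rewrite /dnbhs near_withinE.
  apply/nbhs_ballP; exists e => //= h; rewrite /ball /= sub0r normrN => he h0.
  rewrite sub0r normrN addr0 /GRing.scale /= mulr1 /bump maxxx expr0n subr0.
  rewrite normrM normfV ler_pdivrMl ?normr_gt0 // normrX expr2.
  have mh : `|Num.max 0 h| <= `|h|.
    by case: (lerP 0 h) => h0'; rewrite ?normr0.
  by apply: ler_pM => //; apply: le_trans mh _; exact: ltW.
by apply: DeriveDef; [apply/cvg_ex; eexists; exact: E|exact/cvg_lim].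
Unshelve. all: by end_near. Qed.

Lemma bump_eq0 a : a <= 0 -> bump a = 0.
Proof. by move=> a0; rewrite /bump max_l // expr0n. Qed.

Lemma bump_continuous : continuous bump.
Proof.
move=> a; apply: differentiable_continuous; apply/derivable1_diffP.
by have [] := bump_derive a.
Qed.

Variable m : nat.
Implicit Types (y u v : 'rV[R]_m) (A : 'M[R]_m).

Definition sqd (y0 y : 'rV[R]_m) : R := \sum_i (y 0 i - y0 0 i) ^+ 2.

Lemma sqd_ge0 y0 y : 0 <= sqd y0 y.
Proof. by apply: sumr_ge0 => i _; exact: sqr_ge0. Qed.

Lemma sqd_coord y0 y i : (y 0 i - y0 0 i) ^+ 2 <= sqd y0 y.
Proof.
rewrite /sqd (bigD1 i) //= lerDl; apply: sumr_ge0 => j _; exact: sqr_ge0.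
Qed.

Lemma sqd_norm y0 y (r : R) : 0 <= r -> sqd y0 y <= r ^+ 2 -> `|y - y0| <= r.
Proof.
move=> r0 H; rewrite [leLHS]/Num.Def.normr/= mx_normrE.
rewrite (bigmax_le _ r0) // => -[i j] _; rewrite !mxE ord1 /=.
rewrite -(@ler_pXn2r _ 2) ?nnegrE // -normrX ger0_norm ?sqr_ge0 //.
exact: le_trans (sqd_coord y0 y j) H.
Qed.

Lemma coord_cvg_mx T (F : set_system T) p q (b : T -> 'M[R]_(p, q))
    (b0 : 'M[R]_(p, q)) i j : Filter F ->
  b @ F --> b0 -> b x i j @[x --> F] --> b0 i j.
Proof.
move=> FF bb.
exact: (cvg_comp _ _ bb (@coord_continuous R p q i j b0)).
Qed.

Lemma sqd_continuous y0 : continuous (sqd y0).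
Proof.
move=> y; apply: (@sum_cvg R _ (nbhs y) R^o) => i _.
have H : (fun z : 'rV[R]_m => z 0 i - y0 0 i) @ y --> y 0 i - y0 0 i.
  have H0 := @coord_continuous R 1 m 0 i y; rewrite /continuous_at in H0.
  exact: (cvgB H0 (cvg_cst _)).
by rewrite expr2; under eq_fun do rewrite expr2; apply: cvgM.
Qed.

Lemma sqd_self y0 : sqd y0 y0 = 0.
Proof. by rewrite /sqd big1 // => i _; rewrite subrr expr0n. Qed.

Lemma sqd_derive y0 (g : R^o -> 'rV[R]_m) (t : R^o) : derivable g t 1 ->
  is_derive t 1 (fun s => sqd y0 (g s) : R^o)
    (\sum_i 2 * (g t 0 i - y0 0 i) * ('D_1 g t) 0 i).
Proof.
move=> dg.
have di i : is_derive t 1 (fun s => g s 0 i - y0 0 i : R^o) (('D_1 g t) 0 i).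
  have := derive_linear_comp (L := @entry R 1 m (0, i))
    (@entry_continuous R 1 m (0, i)) dg.
  move=> H; have := is_deriveB H (is_derive_cst (y0 0 i : R^o) t 1).
  by rewrite subr0.
have := is_derive_sum (fun i => is_deriveX 2 (di i)).
rewrite (_ : \sum_(i < m) _ = fun s => sqd y0 (g s)); last first.
  by apply/funext => s; rewrite fct_sumE.
by rewrite (eq_bigr (fun i => 2 * (g t 0 i - y0 0 i) * ('D_1 g t) 0 i)).
Qed.

Lemma gramE A u v : gram A u v = \sum_j (\sum_i u 0 i * A i j) * v 0 j.
Proof. by rewrite /gram !mxE; apply: eq_bigr => j _; rewrite !mxE. Qed.

Lemma gram_cvg T (F : set_system T) (A : T -> 'M[R]_m) (A0 : 'M[R]_m)
    (u v : T -> 'rV[R]_m) (u0 v0 : 'rV[R]_m) : Filter F ->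
  A @ F --> A0 -> u @ F --> u0 -> v @ F --> v0 ->
  gram (A x) (u x) (v x) @[x --> F] --> gram A0 u0 v0.
Proof.
move=> FF AA uu vv; rewrite gramE; under eq_fun do rewrite gramE.
apply: (@sum_cvg R _ _ R^o) => j _; apply: cvgM; last exact: coord_cvg_mx.
apply: (@sum_cvg R _ _ R^o) => i _; apply: cvgM; exact: coord_cvg_mx.
Qed.

Lemma gramZ A (a : R) u v : gram A (a *: u) (a *: v) = a ^+ 2 * gram A u v.
Proof.
by rewrite /gram linearZ /= -!scalemxAl -scalemxAr scalerA mxE expr2.
Qed.

End RealEstimates.

Section GramBounds.
Variables (R : realType) (m : nat).
Implicit Types (A B : 'M[R]_m.+1) (v : 'rV[R]_m.+1).

Lemma mx_entry_norm p q (A : 'M[R]_(p, q)) i j : `|A i j| <= `|A|.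
Proof.
rewrite [leRHS]/Num.Def.normr/= mx_normrE.
exact: (le_bigmax _ (fun ij => `|A ij.1 ij.2|) (i, j)).
Qed.

Lemma gram_bound A v : `|gram A v v| <= (m.+1%:R ^+ 2 * `|A|) * `|v| ^+ 2.
Proof.
rewrite gramE; apply: le_trans (ler_norm_sum _ _ _) _.
apply: (@le_trans _ _ (\sum_(j < m.+1) \sum_(i < m.+1) `|A| * `|v| ^+ 2)).
  apply: ler_sum => j _; rewrite normrM.
  apply: (@le_trans _ _ ((\sum_(i < m.+1) `|A| * `|v|) * `|v|)).
    apply: ler_pM => //; last exact: mx_entry_norm.
    apply: le_trans (ler_norm_sum _ _ _) _; apply: ler_sum => i _.
    by rewrite normrM mulrC; apply: ler_pM => //; exact: mx_entry_norm.
  by rewrite mulr_suml; apply: ler_sum => i _; rewrite expr2 mulrA.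
by rewrite !sumr_const !card_ord -mulrnA -[leLHS]mulr_natl natrM expr2 !mulrA.
Qed.

Lemma gramB A B v : gram (A - B) v v = gram A v v - gram B v v.
Proof. by rewrite /gram mulmxBr mulmxBl !mxE. Qed.

Lemma gram_pos_bound A : (forall v, v != 0 -> 0 < gram A v v) ->
  exists2 a : R, 0 < a & forall v, a * `|v| ^+ 2 <= gram A v v.
Proof.
move=> Apos; pose S : set 'rV[R]_m.+1 := [set v | `|v| = 1].
have cS : compact S.
  apply: bounded_closed_compact.
    by exists 1; split => // e e1 v vS; rewrite /= vS ltW.
  rewrite (_ : S = (fun v : 'rV[R]_m.+1 => `|v|) @^-1` [set 1]) //.
  apply: closed_comp; last exact: closed_eq.
  by move=> v _; exact: norm_continuous.
have S0 : S !=set0.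
  have n0 : (const_mx 1 : 'rV[R]_m.+1) != 0.
    by apply/eqP => /matrixP/(_ 0 0); rewrite !mxE => /eqP; rewrite oner_eq0.
  exists (`|const_mx 1 : 'rV[R]_m.+1|^-1 *: const_mx 1).
  by rewrite /S /= normrZ normfV normr_id mulVf // normr_eq0.
have cg : {within S, continuous (fun v => gram A v v)}.
  apply: continuous_subspaceT => v.
  apply: (@gram_cvg R _ _ (nbhs v) (fun=> A) A id id v v); first exact: cvg_cst.
    exact: cvg_id.
  exact: cvg_id.
have [w /set_mem wS min] := EVT_min_rV S0 cS cg.
have w0 : w != 0 by rewrite -normr_eq0 wS oner_eq0.
exists (gram A w w); first exact: Apos.
move=> v; have [->|v0] := eqVneq v 0.
  by rewrite normr0 expr0n mulr0 /gram mul0mx mul0mx mxE.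
have nv : `|v| != 0 by rewrite normr_eq0.
have vS : `|v|^-1 *: v \in S.
  by rewrite inE /S /= normrZ normfV normr_id mulVf.
have := ler_wpM2r (sqr_ge0 `|v|) (min _ vS); rewrite gramZ.
by rewrite mulrAC -exprMn mulVf // expr1n mul1r.
Qed.

End GramBounds.

Lemma bump_comp_derive (R : realType) (W : R^o -> R^o) (t : R^o) (dw : R) :
  is_derive t 1 W dw ->
  is_derive t 1 (fun s => bump (W s) : R^o) (dw * (2 * Num.max 0 (W t))).
Proof.
move=> [dW EW]; pose b : R^o -> R^o := @bump R.
have [db Eb] : is_derive (W t : R^o) (1 : R^o) b (2 * Num.max 0 (W t)).
  exact: bump_derive.
have /derivable1_diffP dfb := db.
have E : 'D_dw b (W t) = dw * (2 * Num.max 0 (W t)).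
  rewrite -Eb -[RHS]/(dw *: 'D_1 b (W t)) -(@deriveZv R R^o R^o b _ _ _ dfb).
  by congr ('D__ b _); rewrite /GRing.scale /= mulr1.
by have := is_derive_comp dW dfb; rewrite EW E.
Qed.

Section RiemannianDistance.
Variables (R : realType) (m : nat) (M : closed_manifold R m.+1).
Variable G : riemannian_metric M.
Implicit Types (c : chart R m.+1 M) (gamma : R -> M).

Lemma metric_local_bounds c y0 (N : set 'rV[R]_m.+1) : atlas c -> cimg c y0 ->
  nbhs y0 N -> exists r K : R, [/\ 0 < r, 0 < K & forall y, `|y - y0| <= r ->
    [/\ cimg c y, N y & forall v, `|v| <= K * Num.sqrt (gram (G c y) v v) /\
                             Num.sqrt (gram (G c y) v v) <= K * `|v|]].
Proof.
move=> ac cy nN.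
have [a a0 Ha] := gram_pos_bound (metric_pos G ac cy).
pose C : R := m.+1%:R ^+ 2; have C0 : 0 < C by rewrite exprn_gt0 // ltr0n.
pose d := a / 2 / C; have d0 : 0 < d by rewrite !divr_gt0.
pose K := 1 + 2 / a + C * (`|G c y0| + d).
have aK : 0 < 2 / a by rewrite divr_gt0.
have CK : 0 < C * (`|G c y0| + d) by rewrite mulr_gt0 // ltr_wpDl.
have K1 : 1 <= K by rewrite /K; lra.
have K0 : 0 < K by lra.
have KK : K <= K ^+ 2 by rewrite expr2 ler_peMl // ltW.
have cG : {for y0, continuous (G c)}.
  exact: smooth_on_continuous (metric_smooth G ac) (cimg_nbhs ac cy).
have : \forall y \near y0, [/\ cimg c y, N y & `|G c y - G c y0| <= d].
  near=> y; split; near: y; first exact: cimg_nbhs.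
    exact: nN.
  have /cvgrPdist_le/(_ d d0) := cG.
  by apply: filterS => y; rewrite distrC.
move=> /nbhs_ballP[e /= e0 He]; exists (e / 2), K; split => //.
  by rewrite divr_gt0.
move=> y ye; have [] := He y.
  by rewrite -ball_normE /ball_ /= distrC (le_lt_trans ye) // ltr_pdivrMr // ltr_pMr // ltr1n.
move=> cy' Ny Gy; split => // v.
have v0 := sqr_ge0 `|v|.
have /ler_normlP[B1 B2] := gram_bound (G c y - G c y0) v.
rewrite gramB -/C in B1 B2.
have Cd : C * `|G c y - G c y0| <= a / 2.
  by rewrite -ler_pdivlMl // mulrC.
have Cd' := ler_wpM2r v0 Cd.
have low : a / 2 * `|v| ^+ 2 <= gram (G c y) v v.
  have := Ha v; rewrite [a in a * _]splitr mulrDl; lra.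
have /ler_normlP[_ B3] := gram_bound (G c y) v.
have Gyn : `|G c y| <= `|G c y0| + d.
  by rewrite -[G c y](subrK (G c y0)) addrC (le_trans (ler_normD _ _)) // lerD2l.
have g0 : 0 <= gram (G c y) v v.
  by apply: le_trans low; rewrite mulr_ge0 // divr_ge0 // ltW.
have up : gram (G c y) v v <= K ^+ 2 * `|v| ^+ 2.
  apply: le_trans B3 _; apply: ler_wpM2r => //; apply: le_trans KK.
  have : C * `|G c y| <= C * (`|G c y0| + d) by rewrite ler_pM2l.
  rewrite -/C /K; lra.
split.
  rewrite -(@ler_pXn2r _ 2) ?nnegrE ?mulr_ge0 ?sqrtr_ge0 ?(ltW K0) //.
  rewrite exprMn sqr_sqrtr //.
  have L : `|v| ^+ 2 <= 2 / a * gram (G c y) v v.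
    have := ler_wpM2l (ltW aK) low.
    by rewrite mulrA -[a / 2]invf_div mulfV ?gt_eqF // mul1r.
  apply: le_trans L _; apply: ler_wpM2r => //; apply: le_trans KK.
  by rewrite /K; lra.
rewrite -(@ler_pXn2r _ 2) ?nnegrE ?mulr_ge0 ?sqrtr_ge0 ?(ltW K0) //.
by rewrite exprMn sqr_sqrtr.
Unshelve. all: by end_near. Qed.

Lemma curve_extension gamma c (t : R) : smooth_curve gamma -> 0 <= t <= 1 ->
  atlas c -> dom c (gamma t) ->
  exists (g : R^o -> 'rV[R]_m.+1) (U : set R^o),
    [/\ open U, U t, forall k, Ck k U g & forall s, U s -> 0 <= (s : R) <= 1 ->
      [/\ dom c (gamma s), coord c (gamma s) = g s &
          deriv01 (fun r => coord c (gamma r)) s = 'D_1 g s]].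
Proof.
move=> [/subspace_continuousP cg sg] t01 ac dt.
have [U [g [oU Ut Cg Eg]]] := sg c ac t (conj t01 dt).
have tI : `[(0 : R), 1]%classic t by rewrite /= in_itv.
have nD : \forall s \near t, 0 <= s <= 1 -> dom c (gamma s).
  have : \forall s \near within `[0, 1] (nbhs t), dom c (gamma s).
    exact: (cg t tI _ (dom_nbhs ac dt)).
  rewrite near_withinE; by apply: filterS => s H s01; apply: H; rewrite /= in_itv.
pose N : set R^o := [set s | 0 <= (s : R) <= 1 -> dom c (gamma s)].
have oV : open (U `&` N^°) by apply: openI => //; exact: open_interior.
exists g, (U `&` N^°); split => //.
  by move=> k; apply: Ck_subset (Cg k) => s [].
move=> s Us s01; have ds : dom c (gamma s) by case: Us => _ /interior_subset; exact.
have Us1 := Us.1.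
split => //; first exact: Eg.
apply: deriv01_ext => //; last exact: (Ck_derivable (Cg 1%N) Us1).
apply: filterS (open_nbhs_nbhs (conj oV Us)) => r [Ur /interior_subset Nr] r01.
by apply: Eg => //; split => //; exact: Nr.
Qed.

Lemma speedE gamma c (t : R) : smooth_curve gamma -> 0 <= t <= 1 ->
  atlas c -> dom c (gamma t) ->
  speed G gamma t = (let v := deriv01 (fun r => coord c (gamma r)) t in
     Num.sqrt (gram (G c (coord c (gamma t))) v v)).
Proof.
move=> sg t01 ac dt; rewrite /speed; set S := [set s | _].
have Sc : S (let v := deriv01 (fun r => coord c (gamma r)) t in
     Num.sqrt (gram (G c (coord c (gamma t))) v v)) by exists c.
have [c' [ac' dt' ->]] := xgetPex 0 (ex_intro S _ Sc).
have [g [U [oU Ut Cg Eg]]] := curve_extension sg t01 ac dt.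
have [_ gt ->] := Eg t Ut t01; rewrite gt /=.
have D : in_charts_dom c c' id (g t).
  by rewrite -gt; exact: in_charts_dom_coord.
have ct : in_charts c c' id (g t) = coord c' (gamma t).
  by rewrite -gt in_charts_coord.
have idc : continuous (id : M -> M) by move=> x; exact: cvg_id.
have nD := in_charts_dom_nbhs ac ac' idc D.
have dc : differentiable (in_charts c c' id) (g t).
  apply: smooth_on_differentiable (atlas_compat ac ac') nD; exact: findim_mx.
have dg : derivable g t 1 := Ck_derivable (Cg 1%N) Ut.
have [dd Ed] := is_derive_comp dg dc.
have -> : deriv01 (fun r => coord c' (gamma r)) t = 'D_1 (in_charts c c' id \o g) t.
  apply: deriv01_ext => //.
  apply: filterS (open_nbhs_nbhs (conj oU Ut)) => s Us s01.
  by have [ds gs _] := Eg s Us s01; rewrite /= -gs in_charts_coord.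
by rewrite Ed -ct (metric_compat G ac ac' D).
Qed.

Lemma speed_ge0 gamma t : 0 <= speed G gamma t.
Proof.
rewrite /speed; case: xgetP => [_ -> [c [_ _ ->]]|_]; last by [].
exact: sqrtr_ge0.
Qed.

Lemma speed_continuous gamma : smooth_curve gamma ->
  {within `[0, 1], continuous (speed G gamma)}.
Proof.
move=> sg; apply/subspace_continuousP => t; rewrite /= in_itv /= => t01.
have [c ac dt] := @atlas_cover _ _ M (gamma t).
have [g [U [oU Ut Cg Eg]]] := curve_extension sg t01 ac dt.
pose f s := Num.sqrt (gram (G c (g s)) ('D_1 g s) ('D_1 g s)).
have fE s : U s -> 0 <= s <= 1 -> speed G gamma s = f s.
  move=> Us s01; have [ds gs vs] := Eg s Us s01.
  by rewrite (speedE sg s01 ac ds) /= gs vs.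
have cgt : cimg c (g t) by have [dt' <- _] := Eg t Ut t01; exact: cimg_coord.
have cg : g @ nbhs t --> g t := Ck_continuous (Cg 0%N) Ut.
have cDg : 'D_1 g @ nbhs t --> 'D_1 g t := Ck_continuous (Ck_derive (1 : R^o) (Cg 1%N)) Ut.
have cG : G c (g s) @[s --> nbhs t] --> G c (g t).
  apply: (cvg_comp _ _ cg).
  exact: smooth_on_continuous (metric_smooth G ac) (cimg_nbhs ac cgt).
have cf : f @ nbhs t --> f t.
  have H := gram_cvg _ cG cDg cDg.
  exact: (cvg_comp _ _ (H _) (@sqrt_continuous R _)).
suff : speed G gamma @ within `[0, 1] (nbhs t) --> speed G gamma t by [].
rewrite (fE t Ut t01).
apply: (@cvg_trans _ (f @ within `[0, 1] (nbhs t))); last exact: cvg_within_filter.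
apply: near_eq_cvg; rewrite near_withinE.
apply: filterS (open_nbhs_nbhs (conj oU Ut)) => s Us s01.
by rewrite fE //; move: s01; rewrite /= in_itv.
Qed.

Lemma curve_length_ge0 gamma : 0 <= curve_length G gamma.
Proof. by apply: Rintegral_ge0 => t _; exact: speed_ge0. Qed.

Lemma joined_ge0 x y l : joined G x y l -> 0 <= l.
Proof. by elim=> // {}gamma {}y {}l _ _ l0; rewrite addr_ge0 // curve_length_ge0. Qed.

Lemma joined_trans x y z l l' : joined G x y l -> joined G y z l' ->
  joined G x z (l + l').
Proof.
elim=> [{}x|gamma {}y {}l sg _ IH] H; first by rewrite add0r.
by rewrite -addrA; apply: joined_step => //; exact: IH.
Qed.

Lemma smooth_curve_continuous gamma (t : R) : smooth_curve gamma ->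
  t \in `]0, 1[ -> gamma @ nbhs t --> gamma t.
Proof.
move=> [/subspace_continuousP cg _] t01.
have tI : `[(0 : R), 1]%classic t.
  by rewrite /=; apply: subset_itv_oo_cc.
have H : gamma @ within `[0, 1] (nbhs t) --> gamma t := cg t tI.
rewrite within_interior in H => //.
by rewrite interior_itv.
Qed.

(* A nonnegative function supported in a small coordinate ball around [x0] that
   is Lipschitz along curves: a short curve starting near [x0] cannot leave the
   ball, where the function vanishes. *)
Lemma joined_stays_near (x0 : M) (U : set M) : nbhs x0 U -> exists2 e : R, 0 < e &
  \forall y \near x0, forall z l, joined G y z l -> l < e -> U z.
Proof.
move=> nU; have [c ac dx] := @atlas_cover _ _ M x0.
pose y0 := coord c x0; have cy : cimg c y0 by exact: cimg_coord.
have px0 : param c y0 = x0 by exact: coordK.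
have nN : nbhs y0 [set y | U (param c y)].
  by have := param_cvg ac cy; rewrite px0; apply.
have [r [K [r0 K0 HK]]] := metric_local_bounds ac cy nN.
have HB y : sqd y0 y <= r ^+ 2 -> `|y - y0| <= r.
  by apply: sqd_norm; exact: ltW.
pose D := [set y | sqd y0 y <= r ^+ 2].
have cD : compact D.
  apply: bounded_closed_compact.
    exists (`|y0| + r); split; first exact: num_real.
    move=> e e1 y /HB yr; rewrite /= ltW //.
    apply: le_lt_trans e1; rewrite -[y](subrK y0) addrC.
    by apply: le_trans (ler_normD _ _) _; rewrite lerD2l.
  rewrite (_ : D = sqd y0 @^-1` [set a | a <= r ^+ 2]) //.
  apply: closed_comp; last exact: closed_le.
  by move=> y _; exact: sqd_continuous.
pose Kc := param c @` D.
have KcE x : Kc x <-> dom c x /\ sqd y0 (coord c x) <= r ^+ 2.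
  split=> [[y Dy <-]|[d H]]; last by exists (coord c x) => //; rewrite coordK.
  have [cy' _ _] := HK y (HB y Dy).
  by rewrite paramK //; split => //; exact: dom_param.
have clK : closed Kc.
  apply: compact_closed; first exact: closed_manifold_hausdorff.
  apply: continuous_compact cD; apply: continuous_in_subspaceT => y /set_mem Dy.
  by have [cy' _ _] := HK y (HB y Dy); exact: (param_cvg ac cy').
pose u x := if `[< dom c x >] then bump (r ^+ 2 - sqd y0 (coord c x)) else 0.
have uD x : dom c x -> u x = bump (r ^+ 2 - sqd y0 (coord c x)).
  by move=> d; rewrite /u asboolT.
have uK x : ~ Kc x -> u x = 0.
  move=> nK; rewrite /u; case: asboolP => // d; apply: bump_eq0.
  by rewrite subr_le0 leNgt; apply/negP => /ltW H; apply: nK; apply/KcE.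
have nearK x : ~ Kc x -> \forall z \near x, u z = 0.
  move=> nK; have oK : open (~` Kc) by exact: closed_openC.
  by apply: filterS (open_nbhs_nbhs (conj oK nK)) => z; exact: uK.
have uc : continuous u.
  move=> x; have [d|nd] := pselect (dom c x).
    rewrite /continuous_at (uD x d).
    have cb : bump (r ^+ 2 - sqd y0 (coord c z)) @[z --> x] -->
        bump (r ^+ 2 - sqd y0 (coord c x)).
      have c1 : sqd y0 (coord c z) @[z --> x] --> sqd y0 (coord c x).
        exact: (cvg_comp _ _ (coord_cvg ac d) (@sqd_continuous _ _ y0 _)).
      exact: (cvg_comp _ _ (cvgB (cvg_cst _) c1) (@bump_continuous _ _)).
    apply: cvg_trans cb; apply: near_eq_cvg.
    by apply: filterS (dom_nbhs ac d) => z /uD.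
  have nK : ~ Kc x by move=> /KcE [].
  rewrite /continuous_at (uK x nK).
  apply: (@cvg_trans _ ((fun=> 0 : R) @ x)); last exact: cvg_cst.
  by apply: near_eq_cvg; apply: filterS (nearK x nK) => z.
pose C := m.+1%:R * (2 * r * K) * (2 * r ^+ 2).
have C0 : 0 < C by rewrite /C !mulr_gt0 // ?exprn_gt0 // ltr0n.
have ucurve gamma : smooth_curve gamma ->
    `|u (gamma 1) - u (gamma 0)| <= C * curve_length G gamma.
  move=> sg; apply: (@integral_growth _ (speed G gamma) (u \o gamma) C).
  - exact: speed_continuous.
  - apply/subspace_continuousP => t tI.
    have [/subspace_continuousP cg _] := sg.
    exact: (cvg_comp _ _ (cg t tI) (uc _)).
  move=> t t01; have gt := smooth_curve_continuous sg t01.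
  have t01' : 0 <= t <= 1.
    by have := subset_itv_oo_cc t01; rewrite in_itv.
  have sp0 : 0 <= C * speed G gamma t by rewrite mulr_ge0 ?speed_ge0 // ltW.
  have [d|nd] := pselect (dom c (gamma t)); last first.
    have nK : ~ Kc (gamma t) by move=> /KcE [].
    have E : \forall s \near t, 0 = (u \o gamma) s.
      have H : \forall s \near t, u (gamma s) = 0 := gt _ (nearK _ nK).
      by apply: filterS H => s /= ->.
    have [d ->] := near_eq_is_derive E (is_derive_cst (0 : R^o) (t : R^o) 1).
    by split => //; rewrite normr0.
  have [g [V [oV Vt Cg Eg]]] := curve_extension sg t01' ac d.
  pose W (s : R^o) : R^o := r ^+ 2 - sqd y0 (g s).
  have E : \forall s \near t, bump (W s) = u (gamma s).
    have n01 : \forall s \near t, 0 <= s <= 1.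
      have oI : open `](0 : R), 1[%classic by exact: interval_open.
      apply: filterS (open_nbhs_nbhs (conj oI t01)) => s /subset_itv_oo_cc.
      by rewrite /= in_itv.
    apply: filterS2 n01 (open_nbhs_nbhs (conj oV Vt)) => s s01 Vs.
    by have [ds gs _] := Eg s Vs s01; rewrite /W uD // gs.
  have dg : derivable g t 1 := Ck_derivable (Cg 1%N) Vt.
  pose S : R := \sum_i 2 * (g t 0 i - y0 0 i) * ('D_1 g t) 0 i.
  have dW : is_derive (t : R^o) 1 W (- S).
    have := is_deriveB (is_derive_cst (r ^+ 2 : R^o) (t : R^o) 1) (sqd_derive y0 dg).
    by rewrite sub0r.
  have [du ->] := @near_eq_is_derive R R^o R^o (fun s => bump (W s)) (u \o gamma)
    t 1 _ E (bump_comp_derive dW).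
  split => //; rewrite normrM normrN.
  have [W0|W0] := lerP (W t) 0.
    by rewrite mulr0 normr0 mulr0.
  have gB : `|g t - y0| <= r by apply: HB; apply/ltW; rewrite -subr_gt0.
  have [_ _ /(_ ('D_1 g t)) [vB _]] := HK _ gB.
  have [_ gs vs] := Eg t Vt t01'.
  have := speedE sg t01' ac d; rewrite /= gs vs => sE; rewrite -sE in vB.
  have SB : `|S| <= m.+1%:R * (2 * r * K) * speed G gamma t.
    apply: le_trans (ler_norm_sum _ _ _) _.
    apply: (@le_trans _ _ (\sum_(i < m.+1) 2 * r * (K * speed G gamma t))).
      apply: ler_sum => i _; rewrite normrM; apply: ler_pM => //.
        rewrite normrM ger0_norm // ler_wpM2l //.
        have := mx_entry_norm (g t - y0) 0 i; rewrite !mxE => H.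
        exact: le_trans H gB.
      exact: le_trans (mx_entry_norm _ _ _) vB.
    by rewrite sumr_const card_ord -[leLHS]mulr_natl !mulrA.
  rewrite /C [X in _ <= X]mulrAC; apply: ler_pM => //.
  rewrite ger0_norm ?mulr_ge0 // ?(ltW W0) // ler_wpM2l //.
  by rewrite /W lerBlDr lerDl sqd_ge0.
have ujoin y z l : joined G y z l -> `|u z - u y| <= C * l.
  elim=> [{}y|gamma {}z {}l sg _ IH]; first by rewrite subrr normr0 mulr0.
  apply: le_trans (ler_distD (u (gamma 1)) _ _) _.
  by rewrite mulrDr [leRHS]addrC; apply: lerD; [exact: IH|exact: ucurve].
have u0 : u x0 = r ^+ 2 ^+ 2.
  by rewrite uD // sqd_self subr0 /bump max_r // sqr_ge0.
have r4 : 0 < r ^+ 2 ^+ 2 by rewrite !exprn_gt0.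
exists (r ^+ 2 ^+ 2 / 2 / C); first by rewrite !divr_gt0.
have : \forall y \near x0, r ^+ 2 ^+ 2 / 2 < u y.
  have := uc x0; rewrite /continuous_at u0 => H.
  apply: (H [set a | r ^+ 2 ^+ 2 / 2 < a]).
  by apply: lt_nbhsr; rewrite ltr_pdivrMr // ltr_pMr // ltr1n.
apply: filterS => y uy z l jyz; rewrite ltr_pdivlMr // => lC.
have := ujoin y z l jyz; rewrite ler_distl => /andP[H _].
have uz : 0 < u z by move: uy lC H; rewrite [l * C]mulrC; lra.
have /KcE [dz sz] : Kc z.
  by apply: contrapT => /uK uz0; rewrite uz0 ltxx in uz.
have [_ + _] := HK _ (HB _ sz).
by rewrite /= coordK.
Qed.

Lemma smooth_on_scalel (W : normedModType R) (A : set R^o) (w : W) :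
  smooth_on A (fun t : R^o => t *: w).
Proof.
have slin : linear (fun a : R^o => a *: w).
  by move=> a u v; rewrite scalerDl scalerA.
pose sM := GRing.isLinear.Build _ _ _ _ _ slin.
pose sL : {linear R^o -> W} := HB.pack (fun a : R^o => a *: w) sM.
apply: (@smooth_on_linear _ _ _ _ sL); exact: scalel_continuous.
Qed.

Lemma line_derive (W : normedModType R) (a w : W) (t : R^o) :
  is_derive t 1 (fun s : R^o => a + s *: w) w.
Proof.
have [d E] := @is_diff_scalel R W t w.
have H : is_derive (t : R^o) 1 (fun s : R^o => s *: w) w.
  by apply: DeriveDef; [exact: diff_derivable|rewrite deriveE // E scale1r].
by have := is_deriveD (is_derive_cst a t 1) H; rewrite add0r.
Qed.

Lemma segment_joined c y0 (r K d : R) (a b : 'rV[R]_m.+1) : atlas c ->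
  (forall y, `|y - y0| <= r -> cimg c y /\ forall v,
     Num.sqrt (gram (G c y) v v) <= K * `|v|) ->
  `|a - y0| <= r -> `|b - y0| <= r -> K * `|b - a| <= d ->
  exists2 l, joined G (param c a) (param c b) l & l <= d.
Proof.
move=> ac H ar br Kd.
pose line (t : R^o) : 'rV[R]_m.+1 := a + t *: (b - a).
have lB t : 0 <= t <= 1 -> `|line t - y0| <= r.
  move=> /andP[t0 t1].
  have -> : line t - y0 = (1 - t) *: (a - y0) + t *: (b - y0).
    by apply/matrixP => i j; rewrite /line !mxE; ring.
  apply: le_trans (ler_normD _ _) _; rewrite !normrZ.
  rewrite (ger0_norm t0) ger0_norm ?subr_ge0 //.
  have := ler_wpM2l t0 br; have t1' : 0 <= 1 - t by rewrite subr_ge0.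
  have := ler_wpM2l t1' ar; lra.
have lc t : 0 <= t <= 1 -> cimg c (line t) by move=> /lB /H [].
pose gamma t := param c (line t).
have cl : continuous line.
  move=> t; apply: cvgD; first exact: cvg_cst.
  by apply: cvgZr_tmp; exact: cvg_id.
have sl (A : set R^o) : smooth_on A line.
  apply: smooth_on_add; first exact: smooth_on_cst.
  exact: smooth_on_scalel.
have sg : smooth_curve gamma.
  split.
    apply: continuous_in_subspaceT => t /set_mem; rewrite /= in_itv /= => t01.
    exact: (cvg_comp _ _ (cl t) (param_cvg ac (lc t t01))).
  move=> c' ac'.
  apply: (@smooth_on_comp _ _ _ _ _ (in_charts_dom c c' id) line
    (in_charts c c' id)).
  - exact: findim_mx.
  - exact: findim_mx.
  - by move=> t [t01 dt]; split => //; exact: lc.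
  - exact: sl.
  - exact: atlas_compat.
exists (curve_length G gamma + 0).
  have -> : param c a = gamma 0 by rewrite /gamma /line scale0r addr0.
  have -> : param c b = gamma 1 by rewrite /gamma /line scale1r addrC subrK.
  exact: joined_step sg (joined_refl _ _).
rewrite addr0.
have sp t : 0 <= t <= 1 -> speed G gamma t <= d.
  move=> t01; have dg : dom c (gamma t) by apply: dom_param => //; exact: lc.
  rewrite (speedE sg t01 ac dg) /=.
  have -> : deriv01 (fun r0 : R => coord c (gamma r0)) t = b - a.
    have [dl El] := line_derive a (b - a) t.
    rewrite (@deriv01_ext _ _ _ line) //.
    by apply: filterE => s s01; exact: paramK (lc s s01).
  rewrite /gamma paramK //; last exact: lc.
  have [_ /(_ (b - a)) Hs] := H _ (lB t t01).
  exact: le_trans Hs Kd.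
rewrite /curve_length.
apply: (@le_trans _ _ (\int[lebesgue_measure]_(t in `[(0 : R), 1]) d)).
  apply: le_Rintegral => //.
  - exact: (continuous_compact_integrable (@segment_compact _ _ _)
      (speed_continuous sg)).
  - apply: (continuous_compact_integrable (@segment_compact _ _ _)).
    exact: continuous_subspaceT (fun=> cvg_cst _).
rewrite Rintegral_cst.
  rewrite [X in fine X](lebesgue_measure_itv `[(0 : R), 1]).
  by rewrite /= lte_fin ltr01 oppr0 adde0 mulr1.
exact: measurable_itv.
Qed.

Lemma joined_near (x0 : M) (e : R) : 0 < e ->
  \forall p \near (x0, x0), exists2 l, joined G p.1 p.2 l & l < e.
Proof.
move=> e0; have [c ac dx] := @atlas_cover _ _ M x0.
pose y0 := coord c x0; have cy : cimg c y0 by exact: cimg_coord.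
have [r [K [r0 K0 HK]]] := metric_local_bounds ac cy (@filterT _ (nbhs y0) _).
pose d := Num.min r (e / (4 * K)).
have d0 : 0 < d by rewrite lt_min r0 divr_gt0 // mulr_gt0.
have N : \forall x \near x0, dom c x /\ `|coord c x - y0| <= d.
  near=> x; split; near: x; first exact: dom_nbhs.
  have /cvgrPdist_le/(_ d d0) := coord_cvg ac dx.
  by apply: filterS => x; rewrite distrC.
exists ([set x | dom c x /\ `|coord c x - y0| <= d],
        [set x | dom c x /\ `|coord c x - y0| <= d]) => //.
move=> [x y] [/= [dx' xd] [dy' yd]].
have H y1 : `|y1 - y0| <= r -> cimg c y1 /\ forall v,
     Num.sqrt (gram (G c y1) v v) <= K * `|v|.
  by move=> /HK [? _ HH]; split => // v; have [] := HH v.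
have dr : d <= r by rewrite ge_min lexx.
have de : d <= e / (4 * K) by rewrite ge_min lexx orbT.
have [|||l jl le] := @segment_joined c y0 r K (e / 2) (coord c x) (coord c y) ac H.
- exact: le_trans xd dr.
- exact: le_trans yd dr.
- have B : `|coord c y - coord c x| <= e / (2 * K).
    apply: le_trans (ler_distD y0 _ _) _; rewrite (distrC y0).
    apply: le_trans (lerD (le_trans yd de) (le_trans xd de)) _.
    by rewrite !invfM -!mulrDr; apply: ler_wpM2l; [exact: ltW|lra].
  apply: le_trans (ler_wpM2l (ltW K0) B) _.
  rewrite (_ : K * _ = e / 2) //; field; by rewrite gt_eqF.
exists l; first by move: jl; rewrite !coordK.
by rewrite (le_lt_trans le) // ltr_pdivrMr // ltr_pMr // ltr1n.
Unshelve. all: by end_near. Qed.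

Lemma joined_exists x y : exists l, joined G x y l.
Proof.
pose S := [set y | exists l, joined G x y l].
suff : S = [set: M] by move=> E; have : S y by rewrite E.
have oS : open S.
  rewrite openE => z [l jl].
  have [[A B] /= [nA nB] AB] := joined_near z ltr01.
  apply: filterS nB => z' Bz'.
  have [l' jl' _] := AB (z, z') (conj (nbhs_singleton nA) Bz').
  by exists (l + l'); exact: joined_trans jl jl'.
have cS : closed S.
  rewrite -[S]setCK; apply: open_closedC; rewrite openE => z nz.
  have [[A B] /= [nA nB] AB] := joined_near z ltr01.
  apply: filterS nA => z' Az' [l jl]; apply: nz.
  have [l' jl' _] := AB (z', z) (conj Az' (nbhs_singleton nB)).
  by exists (l + l'); exact: joined_trans jl jl'.
apply: closed_manifold_connected.
- by exists x, 0; exact: joined_refl.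
- by exists S => //; rewrite setTI.
- by exists S => //; rewrite setTI.
Qed.

Lemma riem_dist_lt x y e : riem_dist G x y < e ->
  exists2 l, joined G x y l & l < e.
Proof. by apply: inf_lt; have [l] := joined_exists x y; exists l. Qed.

Lemma riem_dist_le x y l : joined G x y l -> riem_dist G x y <= l.
Proof.
move=> j; apply: ge_inf => //.
by exists 0 => a; exact: joined_ge0.
Qed.

Lemma riem_dist_ge0 x y : 0 <= riem_dist G x y.
Proof.
apply: lb_le_inf; first by have [l] := joined_exists x y; exists l.
by move=> a; exact: joined_ge0.
Qed.

Lemma riem_dist_refl x : riem_dist G x x = 0.
Proof.
apply/eqP; rewrite eq_le riem_dist_ge0 andbT; apply: riem_dist_le.
exact: joined_refl.
Qed.

Lemma riem_dist_triangle x y z :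
  riem_dist G x z <= riem_dist G x y + riem_dist G y z.
Proof.
apply/ler_addgt0Pr => e e0; have e2 : 0 < e / 2 by rewrite divr_gt0.
have [l jl le] : exists2 l, joined G x y l & l < riem_dist G x y + e / 2.
  by apply: riem_dist_lt; rewrite ltrDl.
have [l' jl' le'] : exists2 l, joined G y z l & l < riem_dist G y z + e / 2.
  by apply: riem_dist_lt; rewrite ltrDl.
apply: le_trans (riem_dist_le (joined_trans jl jl')) _.
by rewrite [e]splitr; lra.
Qed.

Lemma riem_dist_near (x0 : M) (e : R) : 0 < e ->
  \forall p \near (x0, x0), riem_dist G p.1 p.2 < e.
Proof.
move=> e0; apply: filterS (joined_near x0 e0) => p [l jl le].
exact: le_lt_trans (riem_dist_le jl) le.
Qed.

Lemma riem_dist_stays_near (x0 : M) (U : set M) : nbhs x0 U ->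
  exists2 e : R, 0 < e &
    \forall y \near x0, forall z, riem_dist G y z < e -> U z.
Proof.
move=> nU; have [e e0 H] := joined_stays_near nU; exists e => //.
by apply: filterS H => y H z /riem_dist_lt [l jl le]; exact: (H z l).
Qed.

Lemma jcont_unif (Y : topologicalType) (f : R -> M -> Y) (P : set (Y * Y)) :
  jcont f -> (forall y : Y, nbhs (y, y) P) ->
  exists2 d : R, 0 < d & forall (t s : R) x y, 0 <= t <= 1 -> 0 <= s <= 1 ->
    `|t - s| < d -> riem_dist G x y < d -> P (f t x, f s y).
Proof.
move=> jf nP.
pose Q (d : R) (p : R * M) := forall s y, 0 <= p.1 <= 1 -> 0 <= s <= 1 ->
  `|p.1 - s| < d -> riem_dist G p.2 y < d -> P (f p.1 p.2, f s y).
have : \forall d \near (0 : R)^'+, `[(0 : R), 1]%classic `*` [set: M] `<=` Q d.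
  have cK := compact_setX (@segment_compact R 0 1)
    (@closed_manifold_compact _ _ M).
  apply: ((compact_near_coveringP _).1 cK) => -[t x] [/=].
  rewrite in_itv /= => t01 _.
  have [[A B] /= [nA nB] AB] := nP (f t x).
  have : \forall p \near near01 t x, (A `&` B) (f p.1 p.2).
    exact: (jf t x t01 (A `&` B) (filterI nA nB)).
  rewrite /near01 near_withinE => -[[V U] /= [nV nU] VU].
  have [e e0 He] := riem_dist_stays_near nU.
  move/nbhs_ballP : nV => [r /= r0 Vr].
  exists ([set p | `|t - p.1| < r / 2 /\ U p.2 /\ forall z, riem_dist G p.2 z < e -> U z],
    [set d | d < r / 2 /\ d < e]).
    split.
      exists (ball t (r / 2), [set y | U y /\ forall z, riem_dist G y z < e -> U z]).
        by split; [apply: nbhsx_ballx; rewrite divr_gt0|exact: filterI].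
      by move=> [s y] [/= ts [Uy H]].
    apply: filterI; first by apply: nbhs_right_lt; rewrite divr_gt0.
    exact: nbhs_right_lt.
  move=> [[t' x'] d] [/= [tt [Ux H]] [dr de]] s y /= t'01 s01 ts xy.
  have rr : r / 2 < r by rewrite ltr_pdivrMr // ltr_pMr // ltr1n.
  have [A1 _] : (A `&` B) (f t' x').
    apply: (VU (t', x')) => //; split => //; apply: Vr.
    exact: lt_trans tt rr.
  have [_ B2] : (A `&` B) (f s y).
    apply: (VU (s, y)) => //; split => /=.
      apply: Vr; rewrite /ball /=; apply: le_lt_trans (ler_distD t' _ _) _.
      by rewrite [r]splitr ltrD // (lt_trans ts).
    by apply: H; exact: lt_trans xy de.
  exact: (AB (f t' x', f s y)).
move=> H; have [d [d0 Hd]] : exists d, 0 < d /\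
    `[(0 : R), 1]%classic `*` [set: M] `<=` Q d.
  apply: (@filter_ex _ (0 : R)^'+); apply: filterI => //; exact: nbhs_right_gt.
exists d => // t s x y t01 s01 ts xy.
by apply: (Hd (t, x)) => //; split => //=; rewrite in_itv.
Qed.

Lemma riem_dist_sym (e : R) : 0 < e -> exists2 d : R, 0 < d &
  forall x y, riem_dist G x y < d -> riem_dist G y x < e.
Proof.
move=> e0.
have [|y|d d0 H] := @jcont_unif M (fun=> id) [set p | riem_dist G p.2 p.1 < e].
- by apply: jcont_cst => x; exact: cvg_id.
- have [[A B] /= [nA nB] AB] := riem_dist_near y e0.
  by exists (B, A) => // -[a b] [/= Ba Ab]; apply: (AB (b, a)).
- exists d => // x y xy; apply: (H 0 0 x y) => //; rewrite ?lexx ?ler01 //.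
  by rewrite subrr normr0.
Qed.

Lemma jcont_unif_M (Phi : R -> M -> M) (e : R) : jcont Phi -> 0 < e ->
  exists2 d : R, 0 < d & forall (t s : R) x y, 0 <= t <= 1 -> 0 <= s <= 1 ->
    `|t - s| < d -> riem_dist G x y < d -> riem_dist G (Phi t x) (Phi s y) < e.
Proof.
move=> jP e0.
by apply: (@jcont_unif M Phi [set p | riem_dist G p.1 p.2 < e] jP) => y;
  exact: riem_dist_near.
Qed.

Lemma jcont_unif_R (h : R -> M -> R) (e : R) : jcont h -> 0 < e ->
  exists2 d : R, 0 < d & forall (t s : R) x y, 0 <= t <= 1 -> 0 <= s <= 1 ->
    `|t - s| < d -> riem_dist G x y < d -> `|h t x - h s y| < e.
Proof.
move=> jh e0.
apply: (@jcont_unif R h [set p | `|p.1 - p.2| < e] jh) => y.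
exists (ball y (e / 2), ball y (e / 2)).
  by split; apply: nbhsx_ballx; rewrite divr_gt0.
move=> [a b] [/= ya yb]; apply: le_lt_trans (ler_distD y _ _) _.
by rewrite [e]splitr ltrD // distrC.
Qed.

End RiemannianDistance.

(** * Contact volume and the norm of Hamiltonians *)

Lemma continuous_bounded_M (R : realType) (m : nat) (M : closed_manifold R m)
    (f : M -> R) : continuous f ->
  exists B : R, forall x, `|f x| <= B.
Proof.
move=> cf; have ne : [set: M] !=set0 by exists point.
have cn : {within [set: M], continuous (fun x => `|f x|)}.
  by apply: continuous_subspaceT => x; apply: cvg_norm; exact: cf.
have [c _ Hc] := compact_EVT_max ne (@closed_manifold_compact _ _ M) cn.
by exists `|f c| => x; apply: Hc; rewrite inE.
Qed.

Section BoxIntegral.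
Variable R : realType.

(* No measurability is needed: the integral of a nonnegative function is a
   supremum over the simple functions below it. *)
Lemma ge0_le_integral_any d (T : measurableType d) (mu : {measure set T -> \bar R})
    (D : set T) (f g : T -> \bar R) :
  (forall x, D x -> (0 <= f x)%E) -> (forall x, D x -> (f x <= g x)%E) ->
  (\int[mu]_(x in D) f x <= \int[mu]_(x in D) g x)%E.
Proof.
move=> f0 fg; rewrite !ge0_integralE //; last first.
  by move=> x Dx; exact: le_trans (f0 x Dx) (fg x Dx).
apply: ge_ereal_sup => _ [h /= hf <-]; apply: ereal_sup_ubound; exists h => //= x.
apply: le_trans (hf x) _; rewrite /patch; case: ifPn => // /set_mem; exact: fg.
Qed.

Lemma dist_continuous (V : normedModType R) (y0 : V) :
  continuous (fun y => `|y - y0|).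
Proof.
by move=> y; apply: cvg_norm; apply: cvgB; [exact: cvg_id|exact: cvg_cst].
Qed.

Lemma Rintegral_bounds (a b : R) (f : R -> R) (r B : R) : a <= b -> 0 <= r ->
  (forall t, a <= t <= b -> r <= f t <= B) ->
  r * (b - a) <= \int[lebesgue_measure]_(t in `[a, b]) f t <= B * (b - a).
Proof.
move=> ab r0 H.
have I t : `[a, b]%classic t -> r <= f t <= B.
  by rewrite /= in_itv /=; exact: H.
have L : lebesgue_measure `[a, b]%classic = (b - a)%:E.
  rewrite [LHS](lebesgue_measure_itv `[a, b]) /= lte_fin.
  move: ab; rewrite le_eqVlt => /predU1P[->|->]; last by rewrite EFinB.
  by rewrite ltxx subrr.
have mI : measurable (`[a, b]%classic : set (measurableTypeR R)) by exact: measurable_itv.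
have cI (k : R) : (\int[lebesgue_measure]_(t in `[a, b]) k%:E)%E = (k * (b - a))%:E.
  by rewrite (integral_cst _ mI) EFinM; congr (_ * _)%E; exact: L.
have lo : ((r * (b - a))%:E <= \int[lebesgue_measure]_(t in `[a, b]) (f t)%:E)%E.
  rewrite -cI; apply: ge0_le_integral_any => t It; rewrite lee_fin //.
  by have /andP[] := I t It.
have up : (\int[lebesgue_measure]_(t in `[a, b]) (f t)%:E <= (B * (b - a))%:E)%E.
  rewrite -cI; apply: ge0_le_integral_any => t It; rewrite lee_fin.
    by have /andP[/(le_trans r0)] := I t It.
  by have /andP[] := I t It.
rewrite /Rintegral.
move: lo up; case: (integral _ _ _) => [x| |] //=.
by rewrite !lee_fin => -> ->.
Qed.

Lemma box_integral_bounds m (f : 'rV[R]_m -> R) (a b : 'rV[R]_m) (r B : R) :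
  (forall i, a 0 i <= b 0 i) -> 0 <= r ->
  (forall x, box a b x -> r <= f x <= B) ->
  r * \prod_i (b 0 i - a 0 i) <= box_integral f a b <= B * \prod_i (b 0 i - a 0 i).
Proof.
elim: m f a b => [|m IH] f a b ab r0 H.
  by rewrite big_ord0 !mulr1 /=; apply: H => -[].
have sh i : rshift 1 i = lift ord0 i :> 'I_(1 + m) by exact: val_inj.
pose a' := rsubmx (a : 'rV[R]_(1 + m)); pose b' := rsubmx (b : 'rV[R]_(1 + m)).
have aE i : a' 0 i = a 0 (lift ord0 i) by rewrite /a' mxE sh.
have bE i : b' 0 i = b 0 (lift ord0 i) by rewrite /b' mxE sh.
have ab' i : a' 0 i <= b' 0 i by rewrite aE bE.
have P0 : 0 <= \prod_i (b' 0 i - a' 0 i).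
  by apply: prodr_ge0 => i _; rewrite subr_ge0.
have -> : \prod_i (b 0 i - a 0 i) = \prod_i (b' 0 i - a' 0 i) * (b 0 ord0 - a 0 ord0).
  rewrite big_ord_recl mulrC; congr (_ * _); apply: eq_bigr => i _.
  by rewrite aE bE.
rewrite !mulrA.
apply: Rintegral_bounds => //; first by rewrite mulr_ge0.
move=> t tab; apply: IH => // y yab; apply: H => i.
have E0 : (row_mx (t%:M : 'rV[R]_1) y : 'rV[R]_m.+1) 0 ord0 = t.
  have -> : ord0 = lshift m (ord0 : 'I_1) by exact: val_inj.
  by rewrite (row_mxEl (t%:M : 'rV[R]_1) y 0 ord0) mxE eqxx mulr1n.
have E1 j : (row_mx (t%:M : 'rV[R]_1) y : 'rV[R]_m.+1) 0 (lift ord0 j) = y 0 j.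
  by rewrite -sh (row_mxEr (t%:M : 'rV[R]_1) y 0 j).
case: (unliftP ord0 i) => [j ->|->]; last by rewrite E0.
by rewrite E1 -aE -bE; exact: yab.
Qed.

End BoxIntegral.

Section ContactDensity.
Variables (R : realType) (n : nat) (M : closed_manifold R n.*2.+1).
Variable alpha : contact_form M.
Implicit Types (c : chart R n.*2.+1 M).

Lemma form_extension c y0 : atlas c -> cimg c y0 ->
  exists (g : 'rV[R]_n.*2.+1 -> 'rV[R]_n.*2.+1) (U : set 'rV[R]_n.*2.+1),
  [/\ open U, U y0, forall k, Ck k U g & forall y, U y -> alpha c y = g y].
Proof.
move=> ac cy; have [U [g [oU Uy Cg Eg]]] := form_smooth alpha ac cy.
have oV : open (U `&` (cimg c)^°) by apply: openI => //; exact: open_interior.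
exists g, (U `&` (cimg c)^°); split => //.
- by split => //; exact: cimg_nbhs.
- by move=> k; apply: Ck_subset (Cg k) => y [].
- by move=> y [Uy' /interior_subset]; exact: Eg.
Qed.

Lemma contact_density_continuous c y0 : atlas c -> cimg c y0 ->
  {for y0, continuous (contact_density (alpha c))}.
Proof.
move=> ac cy; have [g [U [oU Uy Cg Eg]]] := form_extension ac cy.
have nU : nbhs y0 U by exact: open_nbhs_nbhs.
pose gi i (y : 'rV[R]_n.*2.+1) : R^o := g y 0 i.
have Cgi k i : Ck k U (gi i).
  by apply: (Ck_linear_comp (L := @entry R 1 n.*2.+1 (0, i)) oU
    (@entry_continuous R 1 n.*2.+1 (0, i)) (Cg k)).
have cD v i : {for y0, continuous (fun y => 'D_v (fun y => alpha c y 0 i : R^o) y)}.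
  have H := Ck_continuous (Ck_derive v (Cgi 1%N i)) Uy.
  have E y : U y -> 'D_v (gi i) y = 'D_v (fun y => alpha c y 0 i : R^o) y.
    move=> Uy'; apply: near_eq_derive.
    by apply: filterS (open_nbhs_nbhs (conj oU Uy')) => z Uz; rewrite /gi Eg.
  rewrite /prop_for /continuous_at -(E _ Uy).
  have N : {near y0, (fun y => 'D_v (gi i) y) =1
      (fun y => 'D_v (fun y => alpha c y 0 i : R^o) y)}.
    by apply: filterS nU => y; exact: E.
  exact: cvg_trans (near_eq_cvg N) H.
have cE i j : {for y0, continuous (fun y => ext_deriv (alpha c) y i j)}.
  exact: (cvgB (cD (delta_mx 0 i) j) (cD (delta_mx 0 j) i)).
have cA i : {for y0, continuous (fun y => alpha c y 0 i)}.
  have H := Ck_continuous (Cgi 0%N i) Uy.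
  rewrite /prop_for /continuous_at Eg //.
  have N : {near y0, gi i =1 (fun y => alpha c y 0 i)}.
    by apply: filterS nU => y /Eg ->.
  exact: cvg_trans (near_eq_cvg N) H.
rewrite /prop_for /continuous_at /contact_density.
pose F (s : 'S_(n.*2.+1)) (y : 'rV[R]_n.*2.+1) : R^o := (-1) ^+ s *
  (alpha c y 0 (s ord0) * \prod_(k < n)
    ext_deriv (alpha c) y (s (inord k.*2.+1)) (s (inord k.*2.+2))).
have HF s : F s y @[y --> nbhs y0] --> F s y0.
  apply: cvgMl_tmp; apply: cvgM; first exact: cA.
  apply: (cvg_big (@mul_continuous R)) => k _; exact: cE.
have H : \sum_s F s y @[y --> nbhs y0] --> \sum_s F s y0.
  by apply: sum_cvg => s _; exact: HF.
have H2 : (2 ^+ n)^-1 * (\sum_s F s y : R) @[y --> nbhs y0] -->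
  (2 ^+ n)^-1 * (\sum_s F s y0 : R) by apply: cvgMl_tmp; exact: H.
exact: H2.
Qed.

End ContactDensity.

Section ContactVolume.
Variables (R : realType) (n : nat) (M : closed_manifold R n.*2.+1).
Variables (alpha : contact_form M) (mu : {measure set (borel M) -> \bar R}).
Hypothesis hmu : is_contact_volume alpha mu.
Implicit Types (c : chart R n.*2.+1 M).

Lemma open_borel (A : set M) : open A -> measurable (A : set (borel M)).
Proof. by move=> oA; exact: sub_sigma_algebra. Qed.

Lemma closed_borel (A : set M) : closed A -> measurable (A : set (borel M)).
Proof.
move=> cA; rewrite -[A]setCK; apply: (@measurableC _ (borel M)).
by apply: open_borel; exact: closed_openC.
Qed.

Lemma contact_volume_local (x0 : M) : exists A : set M,
  [/\ nbhs x0 A, measurable (A : set (borel M)), (0 < mu A)%E & (mu A < +oo)%E].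
Proof.
have [c ac dx] := @atlas_cover _ _ M x0.
pose y0 := coord c x0; have cy : cimg c y0 by exact: cimg_coord.
pose d0 := `|contact_density (alpha c) y0|.
have d00 : 0 < d0 by rewrite normr_gt0; exact: contact_nondeg.
have : \forall y \near y0, cimg c y /\ d0 / 2 <= `|contact_density (alpha c) y| <= d0 * 2.
  near=> y; split; near: y; first exact: cimg_nbhs.
  have H : (fun y => `|contact_density (alpha c) y|) @ nbhs y0 --> d0.
    by apply: cvg_norm; exact: contact_density_continuous.
  have d02 : 0 < d0 / 2 by rewrite divr_gt0.
  have /cvgrPdist_le/(_ _ d02) := H; apply: filterS => y.
  by rewrite -/d0 ler_distlC => /andP[H1 H2]; apply/andP; split; lra.
move=> /nbhs_ballP[e /= e0 He].
pose r := e / 2; have r0 : 0 < r by rewrite divr_gt0.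
pose a : 'rV[R]_n.*2.+1 := \row_i (y0 0 i - r).
pose b : 'rV[R]_n.*2.+1 := \row_i (y0 0 i + r).
have boxE y : box a b y <-> `|y - y0| <= r.
  split=> [B|yr i].
    rewrite [leLHS]/Num.Def.normr/= mx_normrE.
    rewrite (bigmax_le _ (ltW r0)) // => -[i j] _; rewrite !mxE ord1 /=.
    by have := B j; rewrite !mxE ler_distl.
  rewrite !mxE -ler_distl; apply: le_trans yr.
  by have := mx_entry_norm (y - y0) 0 i; rewrite !mxE.
have good y : box a b y -> cimg c y /\
    d0 / 2 <= `|contact_density (alpha c) y| <= d0 * 2.
  move=> /boxE yr; apply: He; rewrite -ball_normE /ball_ /= distrC.
  by rewrite (le_lt_trans yr) // ltr_pdivrMr // ltr_pMr // ltr1n.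
have cbox : box a b `<=` cimg c by move=> y /good [].
have ab i : a 0 i <= b 0 i by rewrite !mxE; lra.
have d02 : 0 <= d0 / 2 by rewrite divr_ge0 // ltW.
have [lo up] := andP (box_integral_bounds (f := fun x =>
  `|contact_density (alpha c) x|) ab d02 (fun y By => (good y By).2)).
have P0 : 0 < \prod_i (b 0 i - a 0 i).
  by apply: prodr_gt0 => i _; rewrite !mxE; lra.
exists (param c @` box a b); split.
- have : \forall x \near x0, dom c x /\ `|coord c x - y0| <= r.
    near=> x; split; near: x; first exact: dom_nbhs.
    have /cvgrPdist_le/(_ r r0) := coord_cvg ac dx.
    by apply: filterS => x; rewrite distrC.
  apply: filterS => x [d xr]; exists (coord c x); first exact/boxE.
  exact: coordK.
- apply: closed_borel; apply: compact_closed; first exact: closed_manifold_hausdorff.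
  apply: continuous_compact; last first.
    apply: bounded_closed_compact.
      exists (`|y0| + r); split; first exact: num_real.
      move=> e1 re1 y /boxE yr; rewrite /= ltW //; apply: le_lt_trans re1.
      rewrite -[y](subrK y0) addrC.
      by apply: le_trans (ler_normD _ _) _; rewrite lerD2l.
    rewrite (_ : box a b = (fun y : 'rV[R]_n.*2.+1 => `|y - y0|) @^-1` [set s | s <= r]).
      apply: closed_comp; last exact: closed_le.
      by move=> y _; exact: dist_continuous.
    by apply/seteqP; split => y /boxE.
  apply: continuous_in_subspaceT => y /set_mem /cbox cy'.
  exact: (param_cvg ac cy').
- rewrite hmu // lte_fin; apply: lt_le_trans lo.
  by rewrite mulr_gt0 // divr_gt0.
- by rewrite hmu // ltry.
Unshelve. all: by end_near. Qed.

Lemma contact_volume_gt0 : (0 < mu setT)%E.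
Proof.
have [A [_ mA A0 _]] := contact_volume_local point.
by apply: lt_le_trans A0 _; apply: le_measure => //; rewrite ?inE.
Qed.

Lemma contact_volume_lty : (mu setT < +oo)%E.
Proof.
have /choice [f Hf] : forall x : M, exists A : set M,
    [/\ open A, A x & (mu A < +oo)%E].
  move=> x; have [A [nA mA _ Afin]] := contact_volume_local x.
  have oA : open A^° by exact: open_interior.
  exists A^°; split => //.
  apply: le_lt_trans Afin; apply: le_measure; rewrite ?inE //.
    exact: open_borel.
  exact: interior_subset.
have := @closed_manifold_compact _ _ M; rewrite compact_cover.
move=> /(_ M setT f) [].
- by move=> x _; case: (Hf x).
- by move=> x _; exists x => //; case: (Hf x).
move=> D _ cD.
have fin (s : seq M) : measurable (\big[setU/set0]_(x <- s) f x : set (borel M)) /\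
    (mu (\big[setU/set0]_(x <- s) f x) < +oo)%E.
  elim: s => [|x s [mS IH]]; first by rewrite big_nil measure0; split.
  have [oA _ fA] := Hf x; have mA := open_borel oA.
  rewrite big_cons; split; first exact: measurableU.
  apply: (@le_lt_trans _ _ (mu (f x) + mu (\big[setU/set0]_(x <- s) f x))%E).
    exact: measureU2.
  exact: lte_add_pinfty.
have [mS] := fin (finmap.enum_fset D); apply: le_lt_trans.
apply: le_measure; rewrite ?inE // => x _.
by have [i iD fx] := cD x I; rewrite -bigcup_seq; exists i.
Qed.

Lemma continuous_measurable_borel (f : M -> R) : continuous f ->
  measurable_fun setT (f : borel M -> R).
Proof.
move=> /continuousP cf; apply: (measurability _ (RGenOpens.measurableE R)).
move=> _ [_ [a [b ->] <-]]; rewrite setTI; apply: open_borel.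
by apply: cf; exact: interval_open.
Qed.

Lemma continuous_integrable_M (f : M -> R) : continuous f ->
  mu.-integrable setT (EFin \o f).
Proof.
move=> cf; apply: measurable_bounded_integrable => //.
- exact: contact_volume_lty.
- exact: continuous_measurable_borel.
- have [B HB] := continuous_bounded_M cf.
  exists B; split; first exact: num_real.
  by move=> b Bb x _; apply: le_trans (HB x) (ltW Bb).
Qed.

Definition mean (f : M -> R) : R := (fine (mu setT))^-1 * \int[mu]_(x in setT) f x.

Lemma vol_gt0 : 0 < fine (mu setT).
Proof. by rewrite fine_gt0 // contact_volume_gt0 contact_volume_lty. Qed.

Lemma meanD (f g : M -> R) : continuous f -> continuous g ->
  mean (fun x => f x + g x) = mean f + mean g.
Proof.
move=> cf cg; rewrite /mean -mulrDr; congr (_ * _).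
by rewrite RintegralD //; exact: continuous_integrable_M.
Qed.

Lemma meanZ (f : M -> R) (k : R) : continuous f ->
  mean (fun x => k * f x) = k * mean f.
Proof.
move=> cf; rewrite /mean mulrCA; congr (_ * _).
by rewrite RintegralZl //; exact: continuous_integrable_M.
Qed.

Lemma mean_bounds (f : M -> R) (a b : R) : continuous f ->
  (forall x, a <= f x <= b) -> a <= mean f <= b.
Proof.
move=> cf H; have v0 := vol_gt0.
have ic k : mu.-integrable setT (EFin \o (fun=> k)).
  by apply: continuous_integrable_M => x; exact: cvg_cst.
have I k : \int[mu]_(x in setT) k = k * fine (mu setT) by rewrite Rintegral_cst.
rewrite /mean mulrC ler_pdivlMr // ler_pdivrMr //; apply/andP; split.
  rewrite -I; apply: le_Rintegral => //; first exact: continuous_integrable_M.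
  by move=> x _; have /andP[] := H x.
rewrite -I; apply: le_Rintegral => //; first exact: continuous_integrable_M.
by move=> x _; have /andP[] := H x.
Qed.

Lemma range_bounds (f : M -> R) x : continuous f -> inf (range f) <= f x <= sup (range f).
Proof.
move=> cf; have [B HB] := continuous_bounded_M cf.
apply/andP; split.
  apply: ge_inf; last by exists x.
  by exists (- B) => _ [z _ <-]; have := HB z; rewrite ler_norml => /andP[].
apply: ub_le_sup; last by exists x.
by exists B => _ [z _ <-]; have := HB z; rewrite ler_norml => /andP[].
Qed.

Lemma range_le (f : M -> R) a b : (forall x, a <= f x <= b) ->
  a <= inf (range f) /\ sup (range f) <= b.
Proof.
move=> H; have ne : range f !=set0 by exists (f point), point.
split.
  by apply: lb_le_inf => // _ [z _ <-]; have /andP[] := H z.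
by apply: ge_sup => // _ [z _ <-]; have /andP[] := H z.
Qed.

Lemma ham_normE (f : M -> R) :
  ham_norm mu f = sup (range f) - inf (range f) + `|mean f|.
Proof. by []. Qed.

Lemma le_ham_norm (f : M -> R) x : continuous f -> `|f x| <= ham_norm mu f.
Proof.
move=> cf; rewrite ham_normE.
have H y := range_bounds y cf.
have /andP[m1 m2] := mean_bounds cf H; have /andP[f1 f2] := H x.
have := ler_norm (mean f); have := ler_norm (- mean f); rewrite normrN => n1 n2.
by rewrite ler_norml; apply/andP; split; lra.
Qed.

Lemma ham_norm_ge0 (f : M -> R) : continuous f -> 0 <= ham_norm mu f.
Proof. by move=> cf; apply: le_trans (le_ham_norm point cf). Qed.

Lemma ham_norm_le (f : M -> R) (B : R) : continuous f ->
  (forall x, `|f x| <= B) -> ham_norm mu f <= 3 * B.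
Proof.
move=> cf H; have H' x : - B <= f x <= B by rewrite -ler_norml.
have /andP[m1 m2] := mean_bounds cf H'.
have [l u] := range_le H'.
have : `|mean f| <= B by rewrite ler_norml m1.
rewrite ham_normE; lra.
Qed.

Lemma ham_normD (f g : M -> R) : continuous f -> continuous g ->
  ham_norm mu (fun x => f x + g x) <= ham_norm mu f + ham_norm mu g.
Proof.
move=> cf cg; rewrite !ham_normE meanD //.
have [|l u] := @range_le (fun x => f x + g x) (inf (range f) + inf (range g))
    (sup (range f) + sup (range g)).
  move=> x; have /andP[f1 f2] := range_bounds x cf.
  by have /andP[g1 g2] := range_bounds x cg; rewrite !lerD.
have := ler_normD (mean f) (mean g); lra.
Qed.

Lemma ham_normN (f : M -> R) : continuous f ->
  ham_norm mu (fun x => - f x) = ham_norm mu f.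
Proof.
move=> cf.
have le (g : M -> R) : continuous g ->
    ham_norm mu (fun x => - g x) <= ham_norm mu g.
  move=> cg; rewrite !ham_normE.
  have -> : mean (fun x => - g x) = - mean g.
    rewrite -[RHS]mulN1r -meanZ //; congr mean; apply/funext => x.
    by rewrite mulN1r.
  have [|l u] := @range_le (fun x => - g x) (- sup (range g)) (- inf (range g)).
    by move=> x; have /andP[g1 g2] := range_bounds x cg; rewrite !lerN2 g1 g2.
  rewrite normrN; lra.
apply/eqP; rewrite eq_le le //=.
have cNf : continuous (fun x => - f x) by move=> x; apply: cvgN; exact: cf.
have := le _ cNf; rewrite (_ : (fun x => - - f x) = f) //.
by apply/funext => x; rewrite opprK.
Qed.

End ContactVolume.

(** * Paths of Hamiltonians *)

Section SimpleMaps.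
Variable R : realType.

Definition simple (X : Type) (s : R -> X) : Prop :=
  finite_set (s @` `[0, 1]) /\
  forall u : X, measurable [set t : R | 0 <= t <= 1 /\ s t = u].

Lemma simple_pair X Y (s : R -> X) (s' : R -> Y) :
  simple s -> simple s' -> simple (fun t => (s t, s' t)).
Proof.
move=> [f m] [f' m']; split.
  apply: sub_finite_set (finite_setX f f') => _ [t t01 <-].
  by split; exists t.
move=> [u u'].
rewrite (_ : [set t | _] = [set t | 0 <= t <= 1 /\ s t = u] `&`
                           [set t | 0 <= t <= 1 /\ s' t = u']).
  exact: measurableI.
apply/seteqP; split => t /=; first by case=> t01 [<- <-].
by case=> -[t01 ->] [_ ->].
Qed.

Lemma simple_preimage X (s : R -> X) (A : set X) : simple s ->
  measurable [set t : R | 0 <= t <= 1 /\ A (s t)].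
Proof.
move=> [f m].
rewrite (_ : [set t | _] = \bigcup_(v in s @` `[0, 1] `&` A)
   [set t : R | 0 <= t <= 1 /\ s t = v]).
  by apply: fin_bigcup_measurable => //; exact: finite_setIl.
apply/seteqP; split => t /=.
  by move=> [t01 At]; exists (s t) => //; split => //; exists t => //; rewrite /= in_itv.
by move=> [v [_ Av] /= [t01 ->]].
Qed.

Lemma simple_comp X Y (s : R -> X) (f : X -> Y) :
  simple s -> simple (fun t => f (s t)).
Proof.
move=> ss; split; last by move=> u; exact: (@simple_preimage _ s [set x | f x = u]).
rewrite (_ : _ @` _ = f @` (s @` `[0, 1])); first exact: finite_image ss.1.
by rewrite -image_comp.
Qed.

Lemma simple_measurable (s : R -> R) : simple s -> measurable_fun (`[0, 1]%classic : set R) s.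
Proof.
move=> ss _ B mB; rewrite (_ : _ `&` _ = [set t | 0 <= t <= 1 /\ B (s t)]).
  exact: simple_preimage.
by apply/seteqP; split => t /=; rewrite in_itv.
Qed.

Definition step (k : nat) (t : R) : R := (Num.Def.trunc (k.+1%:R * t))%:R / k.+1%:R.

Lemma simple_step k : simple (step k).
Proof.
have k0 : 0 < k.+1%:R :> R by rewrite ltr0n.
apply: (@simple_comp _ _ (fun t => Num.Def.trunc (k.+1%:R * t))
  (fun i => i%:R / k.+1%:R)); split.
  apply: (@sub_finite_set _ _ `I_k.+2); last exact: finite_II.
  move=> _ [t /= t01 <-]; move: t01; rewrite in_itv /= => /andP[t0 t1].
  rewrite ltnS truncn_le_nat -[ltLHS]mulr1.
  apply: (@le_lt_trans _ _ (k.+1%:R * 1)); last by rewrite !mulr1 ltr_nat.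
  by rewrite mulr1 ler_pM2l.
move=> i; rewrite (_ : [set t | _] =
  `[(0 : R), 1]%classic `&` `[i%:R / k.+1%:R, i.+1%:R / k.+1%:R[%classic).
  by apply: measurableI; exact: measurable_itv.
apply/seteqP; split => t /=.
  move=> [/andP[t0 t1] <-]; rewrite !in_itv /= t0 t1; split => //.
  have := @truncn_itv _ (k.+1%:R * t); rewrite mulr_ge0 // => /(_ isT).
  by rewrite ler_pdivrMr // ltr_pdivlMr // mulrC.
rewrite !in_itv /= => -[-> H]; split => //; apply: truncn_def.
by move: H; rewrite ler_pdivrMr // ltr_pdivlMr // mulrC.
Qed.

Lemma step_itv k (t : R) : 0 <= t <= 1 -> 0 <= step k t <= 1.
Proof.
have k0 : 0 < k.+1%:R :> R by rewrite ltr0n.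
move=> /andP[t0 t1]; rewrite /step divr_ge0 //= ler_pdivrMr // mul1r.
have /andP[H _] := @truncn_itv _ (k.+1%:R * t) (mulr_ge0 (ltW k0) t0).
by apply: le_trans H _; rewrite -[leRHS]mulr1 ler_pM2l.
Qed.

Lemma step_dist k (t : R) : 0 <= t -> `|t - step k t| <= k.+1%:R^-1.
Proof.
have k0 : 0 < k.+1%:R :> R by rewrite ltr0n.
move=> t0; have /andP[H1 H2] := @truncn_itv _ (k.+1%:R * t) (mulr_ge0 (ltW k0) t0).
have H3 : step k t <= t by rewrite /step ler_pdivrMr // [t * _]mulrC.
rewrite ger0_norm ?subr_ge0 // -(ler_pM2l k0) mulrBr mulfV ?gt_eqF //.
by rewrite /step [X in _ - X]mulrC divfK ?gt_eqF // lerBlDl natr1 ltW.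
Qed.

Lemma step_cvg (t d : R) : 0 <= t -> 0 < d ->
  \forall k \near \oo, `|t - step k t| < d.
Proof.
move=> t0 d0; near=> k; apply: le_lt_trans (step_dist k t0) _.
by near: k; exact: near_infty_natSinv_lt (PosNum d0).
Unshelve. all: by end_near. Qed.

End SimpleMaps.

Section SmallSequences.
Variable R : realType.

Definition small (u : nat -> \bar R) : Prop :=
  forall e : R, 0 < e -> \forall k \near \oo, (u k < e%:E)%E.

Lemma cvg0_small (u : nat -> \bar R) : u @ \oo --> 0%E -> small u.
Proof.
move=> u0 e e0; apply: (u0 [set x | (x < e%:E)%E]).
rewrite /= ; apply: filterS (nbhsx_ballx (0 : R) e e0) => r.
by rewrite /ball /= sub0r normrN lte_fin => /ltr_normlP[].
Qed.

Lemma small_cvg0 (u : nat -> \bar R) : (forall k, (0 <= u k)%E) -> small u ->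
  u @ \oo --> 0%E.
Proof.
move=> u0 su A nA; have {nA} : nbhs (0 : R) (fun r => A r%:E) := nA.
move=> /nbhs_ballP[e /= e0 He].
have H := su e e0; apply: filterS H => k uk.
move: (u0 k) uk; rewrite /=; case: (u k) => [r| |] //; rewrite lee_fin lte_fin.
move=> r0 re; apply: He; by rewrite /ball /= sub0r normrN ger0_norm.
Qed.

Lemma smallD (u v : nat -> \bar R) : small u -> small v ->
  small (fun k => (u k + v k)%E).
Proof.
move=> su sv e e0; have e2 : 0 < e / 2 by rewrite divr_gt0.
apply: filterS2 (su _ e2) (sv _ e2) => k uk vk.
by rewrite [e]splitr EFinD lteD.
Qed.

Lemma small_le (u v : nat -> \bar R) : (\forall k \near \oo, (u k <= v k)%E) ->
  small v -> small u.
Proof.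
move=> uv sv e e0; apply: filterS2 uv (sv _ e0) => k; exact: le_lt_trans.
Qed.

Lemma smallZ (u : nat -> \bar R) (C : R) : 0 < C -> small u ->
  small (fun k => (C%:E * u k)%E).
Proof.
move=> C0 su e e0; have eC : 0 < e / C by rewrite divr_gt0.
apply: filterS (su _ eC) => k uk.
by rewrite -lte_pdivlMl // -EFinM mulrC.
Qed.

End SmallSequences.

Section UniformConvergence.
Variables (R : realType) (m : nat) (M : closed_manifold R m.+1).
Variable G : riemannian_metric M.
Implicit Types (f g : M -> R) (u v : nat -> M -> R) (phi : nat -> M -> M).

Definition ucv u f : Prop :=
  forall e : R, 0 < e -> \forall k \near \oo, forall x, `|f x - u k x| < e.

Definition mcv phi (psi : M -> M) : Prop :=
  forall e : R, 0 < e -> \forall k \near \oo, forall x,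
    riem_dist G (psi x) (phi k x) < e.

Lemma ucvP u f : {uniform, u @ \oo --> f} <-> ucv u f.
Proof.
split=> [H e e0|H P /uniform_nbhs [E [eE EP]]].
  have nE : nbhs (f : {uniform M -> R}) [set h | forall y, [set: M] y ->
      [set xy : R * R | ball xy.1 e xy.2] (f y, h y)].
    apply/uniform_nbhs; exists [set xy : R * R | ball xy.1 e xy.2]; split => //.
    exact: entourage_ball (PosNum e0).
  have {}H : \forall k \near \oo, forall y, [set: M] y ->
      [set xy : R * R | ball xy.1 e xy.2] (f y, u k y) := H _ nE.
  by apply: filterS H => k /= Hk x; exact: Hk.
move: eE; rewrite -entourage_ballE => -[e /= e0 eE].
apply: filterS (H e e0) => k Hk; apply: EP => y _; apply: eE; exact: Hk.
Qed.

Lemma ucv_cst f : ucv (fun=> f) f.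
Proof. by move=> e e0; near=> k => x; rewrite subrr normr0. Unshelve. all: by end_near. Qed.

Lemma ucv_add u v f g : ucv u f -> ucv v g ->
  ucv (fun k x => u k x + v k x) (fun x => f x + g x).
Proof.
move=> uf vg e e0; have e2 : 0 < e / 2 by rewrite divr_gt0.
apply: filterS2 (uf _ e2) (vg _ e2) => k H1 H2 x.
rewrite opprD addrACA [e]splitr; apply: le_lt_trans (ler_normD _ _) _.
exact: ltrD.
Qed.

Lemma ucv_opp u f : ucv u f -> ucv (fun k x => - u k x) (fun x => - f x).
Proof.
by move=> uf e e0; apply: filterS (uf _ e0) => k H x; rewrite -opprD normrN.
Qed.

Lemma ucv_mul u v f g : continuous f -> continuous g -> ucv u f -> ucv v g ->
  ucv (fun k x => u k x * v k x) (fun x => f x * g x).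
Proof.
move=> cf cg uf vg e e0.
have [A HA] := continuous_bounded_M cf; have [B HB] := continuous_bounded_M cg.
pose C := A + B + 1.
have A0 : 0 <= A := le_trans (normr_ge0 _) (HA point).
have B0 : 0 <= B := le_trans (normr_ge0 _) (HB point).
have C0 : 0 < C by rewrite /C; lra.
have eC : 0 < e / 2 / C by rewrite !divr_gt0.
apply: filterS3 (uf _ eC) (vg _ eC) (vg _ ltr01) => k H1 H2 H3 x.
have -> : f x * g x - u k x * v k x = (f x - u k x) * v k x + f x * (g x - v k x).
  by ring.
apply: le_lt_trans (ler_normD _ _) _; rewrite !normrM [e]splitr.
have vC : `|v k x| <= C.
  have : `|v k x| <= `|g x| + `|g x - v k x|.
    by rewrite -{1}[v k x](subrK (g x)) addrC -normrN -(distrC (v k x)) normrN ler_normD.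
  have := H3 x; have := HB x; rewrite /C; lra.
apply: ler_ltD.
  apply: (@le_trans _ _ (e / 2 / C * C)); last by rewrite divfK ?gt_eqF.
  by apply: ler_pM => //; exact/ltW/H1.
apply: (@le_lt_trans _ _ (C * `|g x - v k x|)).
  by apply: ler_wpM2r => //; apply: le_trans (HA x) _; rewrite /C; lra.
by rewrite mulrC -ltr_pdivlMr // H2.
Qed.

Lemma ucv_comp u f phi psi : continuous f -> ucv u f -> mcv phi psi ->
  ucv (fun k x => u k (phi k x)) (fun x => f (psi x)).
Proof.
move=> cf uf pp e e0; have e2 : 0 < e / 2 by rewrite divr_gt0.
have [d d0 Hd] := jcont_unif_R G (jcont_cst cf) e2.
apply: filterS2 (uf _ e2) (pp _ d0) => k H1 H2 x.
apply: le_lt_trans (ler_distD (f (phi k x)) _ _) _; rewrite [e]splitr ltrD //.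
by apply: (Hd 0 0); rewrite ?lexx ?ler01 // subrr normr0.
Qed.

Lemma jcont_ucv_step (h : R -> M -> R) (t : R) : jcont h -> 0 <= t <= 1 ->
  ucv (fun k => h (step k t)) (h t).
Proof.
move=> jh t01 e e0; have [d d0 Hd] := jcont_unif_R G jh e0.
have /andP[t0 _] := t01.
apply: filterS (step_cvg t0 d0) => k Hk x; apply: Hd => //.
  exact: step_itv.
by rewrite riem_dist_refl.
Qed.

Lemma jcont_mcv_step (Phi : R -> M -> M) (t : R) : jcont Phi -> 0 <= t <= 1 ->
  mcv (fun k => Phi (step k t)) (Phi t).
Proof.
move=> jP t01 e e0; have [d d0 Hd] := jcont_unif_M G jP e0.
have /andP[t0 _] := t01.
apply: filterS (step_cvg t0 d0) => k Hk x; apply: Hd => //.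
  exact: step_itv.
by rewrite riem_dist_refl.
Qed.

Lemma jcont_bounded (h : R -> M -> R) : jcont h ->
  exists2 B : R, 0 < B & forall (t : R) x, 0 <= t <= 1 -> `|h t x| <= B.
Proof.
move=> /jcontP ch.
have cK := compact_setX (@segment_compact R 0 1) (@closed_manifold_compact _ _ M).
have ne : `[(0 : R), 1]%classic `*` [set: M] !=set0.
  by exists (0, point); split => //=; rewrite in_itv /= lexx ler01.
have cn : {within `[(0 : R), 1] `*` [set: M], continuous (fun p : R * M => `|h p.1 p.2|)}.
  apply/subspace_continuousP => p pK; apply: cvg_norm.
  by move/subspace_continuousP : ch; apply.
have [c _ Hc] := compact_EVT_max ne cK cn.
exists (`|h c.1 c.2| + 1); first by rewrite ltr_wpDl.
move=> t x t01; apply: le_trans (_ : _ <= `|h c.1 c.2|) _; last by rewrite lerDl.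
by apply: (Hc (t, x)); rewrite inE; split => //=; rewrite in_itv.
Qed.

End UniformConvergence.

Section StronglyMeasurable.
Variables (R : realType) (n : nat) (M : closed_manifold R n.*2.+1).
Variables (alpha : contact_form M) (mu : {measure set (borel M) -> \bar R}).
Hypothesis hmu : is_contact_volume alpha mu.
Variable G : riemannian_metric M.
Implicit Types (H F : R -> M -> R).

Definition smeas H : Prop :=
  (forall t : R, 0 <= t <= 1 -> continuous (H t)) /\
  exists s : nat -> R -> M -> R, (forall k, simple_path (s k)) /\
    forall t : R, 0 <= t <= 1 -> ucv (fun k => s k t) (H t).

Lemma L1C0P H : L1C0 mu H <-> smeas H /\ (norm1oo mu H < +oo)%E.
Proof.
split=> [[cH [s [ss sH]] fH]|[[cH [s [ss sH]]] fH]].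
  by split => //; split => //; exists s; split => // t t01; apply/ucvP; exact: sH.
by split => //; exists s; split => // t t01; apply/ucvP; exact: sH.
Qed.

Lemma simple_pathP (s : R -> M -> R) : simple_path s <->
  simple s /\ forall t : R, 0 <= t <= 1 -> continuous (s t).
Proof. by split=> [[f ms cs]|[[f ms] cs]]. Qed.

Lemma smeas_jcont (h : R -> M -> R) : jcont h -> smeas h.
Proof.
move=> jh; split=> [t t01|]; first exact: jcont_slice jh t01.
exists (fun k t => h (step k t)); split=> [k|t t01].
  apply/simple_pathP; split; first exact: (simple_comp h (simple_step R k)).
  by move=> t t01; apply: jcont_slice jh _; exact: step_itv.
exact: (jcont_ucv_step G).
Qed.

Lemma smeas_add H F : smeas H -> smeas F -> smeas (fun t x => H t x + F t x).
Proof.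
move=> [cH [s [ss sH]]] [cF [s' [ss' sF]]]; split=> [t t01 x|].
  by apply: cvgD; [exact: cH|exact: cF].
exists (fun k t x => s k t x + s' k t x); split=> [k|t t01].
  have /simple_pathP[s1 c1] := ss k; have /simple_pathP[s2 c2] := ss' k.
  apply/simple_pathP; split.
    exact: (simple_comp (fun p x => p.1 x + p.2 x) (simple_pair s1 s2)).
  by move=> t t01 x; apply: cvgD; [exact: c1|exact: c2].
by apply: ucv_add; [exact: sH|exact: sF].
Qed.

Lemma smeas_opp H : smeas H -> smeas (fun t x => - H t x).
Proof.
move=> [cH [s [ss sH]]]; split=> [t t01 x|]; first by apply: cvgN; exact: cH.
exists (fun k t x => - s k t x); split=> [k|t t01].
  have /simple_pathP[s1 c1] := ss k; apply/simple_pathP; split.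
    exact: (simple_comp (fun p x => - p x) s1).
  by move=> t t01 x; apply: cvgN; exact: c1.
by apply: ucv_opp; exact: sH.
Qed.

Lemma smeas_twist (a : R -> M -> R) (Phi : R -> M -> M) H :
  jcont a -> jcont Phi -> smeas H -> smeas (fun t x => a t x * H t (Phi t x)).
Proof.
move=> ja jP [cH [s [ss sH]]].
have cHP t : 0 <= t <= 1 -> continuous (fun x => H t (Phi t x)).
  move=> t01 x; apply: continuous_comp; first exact: jcont_slice jP t01 x.
  exact: cH.
split=> [t t01 x|].
  by apply: cvgM; [exact: jcont_slice ja t01 x|exact: cHP].
exists (fun k t x => a (step k t) x * s k t (Phi (step k t) x)); split=> [k|t t01].
  have /simple_pathP[s1 c1] := ss k; apply/simple_pathP; split.
    exact: (simple_comp (fun p x => a p.1 x * p.2 (Phi p.1 x))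
              (simple_pair (simple_step R k) s1)).
  move=> t t01 x; have k01 := step_itv k t01.
  apply: cvgM; first exact: jcont_slice ja k01 x.
  apply: continuous_comp; first exact: jcont_slice jP k01 x.
  exact: c1.
apply: ucv_mul; [exact: jcont_slice ja t01|exact: cHP|exact: (jcont_ucv_step G)|].
apply: (@ucv_comp _ _ _ G _ _ _ _ (cH t t01) (sH t t01)); exact: jcont_mcv_step.
Qed.

Lemma ham_norm_dist (f g : M -> R) : continuous f -> continuous g ->
  `|ham_norm mu f - ham_norm mu g| <= ham_norm mu (fun x => f x - g x).
Proof.
have le (f1 g1 : M -> R) : continuous f1 -> continuous g1 ->
    ham_norm mu f1 - ham_norm mu g1 <= ham_norm mu (fun x => f1 x - g1 x).
  move=> cf cg; rewrite lerBlDr.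
  have cfg : continuous (fun x => f1 x - g1 x).
    by move=> x; apply: cvgB; [exact: cf|exact: cg].
  have := ham_normD hmu cfg cg.
  by rewrite (_ : (fun x => f1 x - g1 x + g1 x) = f1) //; apply/funext => x; rewrite subrK.
move=> cf cg; rewrite ler_norml; apply/andP; split; last exact: le.
rewrite lerNl opprB; apply: le_trans (le _ _ cg cf) _.
rewrite -(ham_normN hmu); last by move=> x; apply: cvgB; [exact: cg|exact: cf].
rewrite (_ : (fun x => - (g x - f x)) = (fun x => f x - g x)) //.
by apply/funext => x; rewrite opprB.
Qed.

Lemma ucv_ham_norm (u : nat -> M -> R) (f : M -> R) : continuous f ->
  (forall k, continuous (u k)) -> ucv u f ->
  ham_norm mu (u k) @[k --> \oo] --> ham_norm mu f.
Proof.
move=> cf cu uf; apply/cvgrPdist_lt => e e0.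
have e4 : 0 < e / 4 by rewrite divr_gt0.
apply: filterS (uf _ e4) => k Hk; apply: le_lt_trans (ham_norm_dist cf (cu k)) _.
have cfu : continuous (fun x => f x - u k x).
  by move=> x; apply: cvgB; [exact: cf|exact: cu].
apply: le_lt_trans (ham_norm_le hmu cfu (fun x => ltW (Hk x))) _.
lra.
Qed.

Lemma smeas_measurable H : smeas H ->
  measurable_fun (`[0, 1]%classic : set R) (fun t => ham_norm mu (H t)).
Proof.
move=> [cH [s [ss sH]]].
apply: (@measurable_fun_cvg _ _ _ _ (fun k t => ham_norm mu (s k t))).
  move=> k; have /simple_pathP[s1 c1] := ss k.
  exact: simple_measurable (simple_comp (ham_norm mu) s1).
move=> t; rewrite /= in_itv /= => t01.
apply: ucv_ham_norm; [exact: cH| |exact: sH].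
by move=> k; have /simple_pathP[s1 c1] := ss k; exact: c1.
Qed.

Lemma smeas_emeasurable H : smeas H ->
  measurable_fun (`[0, 1]%classic : set R) (fun t => (ham_norm mu (H t))%:E).
Proof. by move=> sH; apply/measurable_EFinP; exact: smeas_measurable. Qed.

Lemma smeas_norm_ge0 H (t : R) : smeas H -> `[0, 1]%classic t ->
  (0 <= (ham_norm mu (H t))%:E)%E.
Proof.
move=> [cH _]; rewrite /= in_itv /= => t01; rewrite lee_fin.
by apply: (ham_norm_ge0 hmu); exact: cH.
Qed.

Lemma norm1oo_ge0 H : smeas H -> (0 <= norm1oo mu H)%E.
Proof. by move=> sH; apply: integral_ge0 => t t01; exact: smeas_norm_ge0. Qed.

Lemma norm1oo_eq H F : (forall t : R, 0 <= t <= 1 -> H t = F t) ->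
  norm1oo mu H = norm1oo mu F.
Proof.
move=> E; apply: eq_integral => t; rewrite inE /= in_itv /= => t01.
by rewrite E.
Qed.

Lemma norm1oo_le H F (C : R) : smeas H -> smeas F -> 0 < C ->
  (forall (t : R) x, 0 <= t <= 1 -> `|H t x| <= C * ham_norm mu (F t)) ->
  (norm1oo mu H <= (3 * C)%:E * norm1oo mu F)%E.
Proof.
move=> sH sF C0 HF; have C3 : (0 <= (3 * C)%:E)%E by rewrite lee_fin mulr_ge0 // ltW.
rewrite /norm1oo -ge0_integralZl //; last first.
- by move=> t t01; exact: smeas_norm_ge0.
- exact: smeas_emeasurable.
apply: ge0_le_integral_any => t t01; first exact: smeas_norm_ge0.
have t01' : 0 <= t <= 1 by move: t01; rewrite /= in_itv.
rewrite -EFinM lee_fin -mulrA; apply: (ham_norm_le hmu); first exact: sH.1.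
by move=> x; exact: HF.
Qed.

Lemma norm1ooD H F : smeas H -> smeas F ->
  (norm1oo mu (fun t x => (H t x + F t x)%R) <= norm1oo mu H + norm1oo mu F)%E.
Proof.
move=> sH sF; rewrite /norm1oo -ge0_integralD //; first last.
- exact: smeas_emeasurable.
- by move=> t t01; exact: smeas_norm_ge0.
- exact: smeas_emeasurable.
- by move=> t t01; exact: smeas_norm_ge0.
apply: ge0_le_integral_any => t t01.
  exact: (smeas_norm_ge0 (smeas_add sH sF) t01).
have t01' : 0 <= t <= 1 by move: t01; rewrite /= in_itv.
by rewrite -EFinD lee_fin; apply: (ham_normD hmu); [exact: sH.1|exact: sF.1].
Qed.

Lemma norm1ooN H : smeas H -> norm1oo mu (fun t x => - H t x) = norm1oo mu H.
Proof.
move=> sH; apply: eq_integral => t; rewrite inE /= in_itv /= => t01.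
by rewrite (ham_normN hmu) //; exact: sH.1.
Qed.

Lemma smeas_sub H F : smeas H -> smeas F -> smeas (fun t x => H t x - F t x).
Proof. by move=> sH sF; apply: smeas_add => //; exact: smeas_opp. Qed.

(* Dominated convergence in the time variable. *)
Lemma small_twist_fixed (a : R -> M -> R) (ai : nat -> R -> M -> R)
    (Psi : R -> M -> M) (Psii : nat -> R -> M -> M) F (B : R) :
  jcont a -> (forall i, jcont (ai i)) -> jcont Psi -> (forall i, jcont (Psii i)) ->
  smeas F -> (norm1oo mu F < +oo)%E -> 0 < B ->
  (forall (t : R) x, 0 <= t <= 1 -> `|a t x| <= B) ->
  (forall i (t : R) x, 0 <= t <= 1 -> `|ai i t x| <= B) ->
  (forall t : R, 0 <= t <= 1 -> ucv (fun i => ai i t) (a t)) ->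
  (forall t : R, 0 <= t <= 1 -> mcv G (fun i => Psii i t) (Psi t)) ->
  small (fun i => norm1oo mu (fun t x => a t x * F t (Psi t x)
                                   - ai i t x * F t (Psii i t x))).
Proof.
move=> ja jai jP jPi sF fF B0 aB aiB ucva mcvP.
pose D i t x := a t x * F t (Psi t x) - ai i t x * F t (Psii i t x).
have sD i : smeas (D i) by apply: smeas_sub; exact: smeas_twist.
pose g (t : R) : \bar R := ((6 * B)%:E * (ham_norm mu (F t))%:E)%E.
have mI : measurable (`[0, 1]%classic : set (measurableTypeR R)) by exact: measurable_itv.
have gF (t : R) x : 0 <= t <= 1 -> `|F t x| <= ham_norm mu (F t).
  by move=> t01; apply: (le_ham_norm hmu); exact: sF.1.
have gi i (t : R) : 0 <= t <= 1 -> ham_norm mu (D i t) <= 6 * B * ham_norm mu (F t).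
  move=> t01; rewrite (_ : 6 * B * _ = 3 * (2 * B * ham_norm mu (F t))); last by ring.
  apply: (ham_norm_le hmu); first exact: (sD i).1.
  move=> x; rewrite /D; apply: le_trans (ler_normB _ _) _.
  rewrite !normrM (_ : 2 * B * _ = B * ham_norm mu (F t) + B * ham_norm mu (F t)); last by ring.
  by apply: lerD; apply: ler_pM => //; [exact: aB|exact: gF|exact: aiB|exact: gF].
have ig : lebesgue_measure.-integrable `[0, 1] g.
  apply: integrableZl => //; apply/integrableP; split.
    exact: smeas_emeasurable.
  apply: le_lt_trans fF; apply: ge0_le_integral_any => // t t01.
  by rewrite gee0_abs //; exact: smeas_norm_ge0.
have cv (t : R) : 0 <= t <= 1 -> ham_norm mu (D i t) @[i --> \oo] --> (0 : R).
  move=> t01.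
  have cD i : continuous (D i t) by exact: (sD i).1.
  have c0 : continuous (fun _ : M => 0 : R) by move=> x; exact: cvg_cst.
  have h0 : ham_norm mu (fun _ : M => 0) = 0.
    apply/eqP; rewrite eq_le (ham_norm_ge0 hmu) // andbT -[leRHS](mulr0 3).
    by apply: (ham_norm_le hmu) => // x; rewrite normr0.
  rewrite -h0; apply: ucv_ham_norm => //.
  have ct : continuous (fun x => F t (Psi t x)).
    move=> x; apply: continuous_comp; first exact: jcont_slice jP t01 x.
    exact: sF.1.
  have u1 : ucv (fun i x => ai i t x * F t (Psii i t x)) (fun x => a t x * F t (Psi t x)).
    apply: ucv_mul => //; [exact: jcont_slice ja t01|exact: ucva|].
    apply: (ucv_comp (sF.1 t t01) (ucv_cst _)); exact: mcvP.
  move=> e e0; apply: filterS (u1 _ e0) => i Hi x.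
  by rewrite sub0r normrN; exact: Hi.
have [] := @dominated_convergence _ _ _ lebesgue_measure _ mI
  (fun i t => (ham_norm mu (D i t))%:E) (fun=> 0%E) g
  (fun i => smeas_emeasurable (sD i)) (measurable_cst _) _ ig _.
- apply: aeW => t; rewrite /= in_itv /= => t01.
  by apply: cvg_EFin; [exact: filterE|exact: cv].
- apply: aeW => t i; rewrite /= in_itv /= => t01.
  rewrite ger0_norm; last first.
    by apply: (ham_norm_ge0 hmu); exact: (sD i).1.
  by rewrite /g -EFinM lee_fin; exact: gi.
by move=> _ _; rewrite integral0 => H; exact: cvg0_small.
Qed.

Lemma small_twist (a : R -> M -> R) (ai : nat -> R -> M -> R)
    (Psi : R -> M -> M) (Psii : nat -> R -> M -> M) F (Fi : nat -> R -> M -> R) (B : R) :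
  jcont a -> (forall i, jcont (ai i)) -> jcont Psi -> (forall i, jcont (Psii i)) ->
  smeas F -> (norm1oo mu F < +oo)%E -> (forall i, smeas (Fi i)) -> 0 < B ->
  (forall (t : R) x, 0 <= t <= 1 -> `|a t x| <= B) ->
  (forall i (t : R) x, 0 <= t <= 1 -> `|ai i t x| <= B) ->
  (forall t : R, 0 <= t <= 1 -> ucv (fun i => ai i t) (a t)) ->
  (forall t : R, 0 <= t <= 1 -> mcv G (fun i => Psii i t) (Psi t)) ->
  small (fun i => norm1oo mu (fun t x => F t x - Fi i t x)) ->
  small (fun i => norm1oo mu (fun t x => a t x * F t (Psi t x)
                                   - ai i t x * Fi i t (Psii i t x))).
Proof.
move=> ja jai jP jPi sF fF sFi B0 aB aiB ucva mcvP sm.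
have S1 := small_twist_fixed ja jai jP jPi sF fF B0 aB aiB ucva mcvP.
have S2 := smallZ (mulr_gt0 (ltr0n _ 3 : 0 < 3%:R) B0) sm.
apply: small_le (smallD S1 S2); apply: filterE => i.
have sFFi : smeas (fun t x => F t x - Fi i t x) by exact: smeas_sub.
have sD1 : smeas (fun t x => a t x * F t (Psi t x) - ai i t x * F t (Psii i t x)).
  by apply: smeas_sub; exact: smeas_twist.
have sD2 : smeas (fun t x => ai i t x * (F t (Psii i t x) - Fi i t (Psii i t x))).
  exact: (smeas_twist (jai i) (jPi i) sFFi).
rewrite (@norm1oo_eq _ (fun t x => (a t x * F t (Psi t x) - ai i t x * F t (Psii i t x))
  + ai i t x * (F t (Psii i t x) - Fi i t (Psii i t x)))); last first.
  by move=> t _; apply/funext => x; ring.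
apply: le_trans (norm1ooD sD1 sD2) _; apply: leeD => //.
apply: norm1oo_le => // t x t01; rewrite normrM; apply: ler_pM => //.
  exact: aiB.
apply: (@le_ham_norm _ _ _ _ _ hmu (fun x => F t x - Fi i t x)).
exact: sFFi.1.
Qed.

End StronglyMeasurable.

(** * Uniform convergence *)

Section ConvergenceUniformInTime.
Variables (R : realType) (m : nat) (M : closed_manifold R m.+1).
Variable G : riemannian_metric M.
Implicit Types (h f : R -> M -> R) (hi fi : nat -> R -> M -> R).
Implicit Types (Phi Psi : R -> M -> M) (Phii Psii : nat -> R -> M -> M).

Definition maps_cvg Phii Phi : Prop := forall e : R, 0 < e ->
  \forall k \near \oo, forall (t : R) x, 0 <= t <= 1 ->
    riem_dist G (Phi t x) (Phii k t x) < e.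

Definition funs_cvg hi h : Prop := forall e : R, 0 < e ->
  \forall k \near \oo, forall (t : R) x, 0 <= t <= 1 -> `|h t x - hi k t x| < e.

Lemma maps_cvg_sym Phii Phi : maps_cvg Phii Phi -> forall e : R, 0 < e ->
  \forall k \near \oo, forall (t : R) x, 0 <= t <= 1 ->
    riem_dist G (Phii k t x) (Phi t x) < e.
Proof.
move=> H e e0; have [d d0 Hd] := riem_dist_sym G e0.
by apply: filterS (H d d0) => k Hk t x t01; apply: Hd; exact: Hk.
Qed.

Lemma maps_cvg_jcont Phii Phi : (forall k, jcont (Phii k)) ->
  maps_cvg Phii Phi -> jcont Phi.
Proof.
move=> j H t x t01 U nU.
have [e e0 He] := riem_dist_stays_near G nU.
have {}He : forall z, riem_dist G (Phi t x) z < e -> U z := nbhs_singleton He.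
have e3 : 0 < e / 3 by rewrite divr_gt0.
have [k [H1 H2]] := filter_ex (filterI (H _ e3) (maps_cvg_sym H e3)).
have nk : \forall p \near near01 t x,
    riem_dist G (Phii k t x) (Phii k p.1 p.2) < e / 3.
  have cp : (Phii k t x, Phii k p.1 p.2) @[p --> near01 t x] -->
      (Phii k t x, Phii k t x).
    by apply: cvg_to_pair; [exact: cvg_cst|exact: j].
  exact: cp (riem_dist_near G (Phii k t x) e3).
apply: filterS2 nk (near01_01 t x) => p Hp p01; apply: He.
apply: le_lt_trans (riem_dist_triangle G _ (Phii k t x) _) _.
apply: (@lt_le_trans _ _ (e / 3 + (e / 3 + e / 3))); last by lra.
apply: ltrD; first exact: H1.
apply: le_lt_trans (riem_dist_triangle G _ (Phii k p.1 p.2) _) _.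
by apply: ltrD => //; exact: H2.
Qed.

Lemma funs_cvg_jcont hi h : (forall k, jcont (hi k)) -> funs_cvg hi h -> jcont h.
Proof.
move=> j H t x t01; apply/cvgrPdist_lt => e e0.
have e3 : 0 < e / 3 by rewrite divr_gt0.
have [k Hk] := filter_ex (H _ e3).
have nk : \forall p \near near01 t x, `|hi k t x - hi k p.1 p.2| < e / 3.
  by move/cvgrPdist_lt : (j k t x t01); exact.
apply: filterS2 nk (near01_01 t x) => p Hp p01.
apply: le_lt_trans (ler_distD (hi k t x) _ _) _.
apply: (@lt_le_trans _ _ (e / 3 + (e / 3 + e / 3))); last by lra.
apply: ltrD; first exact: Hk.
apply: le_lt_trans (ler_distD (hi k p.1 p.2) _ _) _.
by apply: ltrD => //; rewrite distrC; exact: Hk.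
Qed.

Lemma maps_cvg_comp Phii Phi Psii Psi : jcont Phi -> maps_cvg Phii Phi ->
  maps_cvg Psii Psi ->
  maps_cvg (fun k t x => Phii k t (Psii k t x)) (fun t x => Phi t (Psi t x)).
Proof.
move=> jP H1 H2 e e0; have e2 : 0 < e / 2 by rewrite divr_gt0.
have [d d0 Hd] := jcont_unif_M G jP e2.
apply: filterS2 (H1 _ e2) (H2 _ d0) => k Hk1 Hk2 t x t01.
apply: le_lt_trans (riem_dist_triangle G _ (Phi t (Psii k t x)) _) _.
rewrite [e]splitr; apply: ltrD; last exact: Hk1.
by apply: Hd => //; [rewrite subrr normr0|exact: Hk2].
Qed.

Lemma funs_cvg_comp hi h Psii Psi : jcont h -> funs_cvg hi h ->
  maps_cvg Psii Psi ->
  funs_cvg (fun k t x => hi k t (Psii k t x)) (fun t x => h t (Psi t x)).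
Proof.
move=> jP H1 H2 e e0; have e2 : 0 < e / 2 by rewrite divr_gt0.
have [d d0 Hd] := jcont_unif_R G jP e2.
apply: filterS2 (H1 _ e2) (H2 _ d0) => k Hk1 Hk2 t x t01.
apply: le_lt_trans (ler_distD (h t (Psii k t x)) _ _) _.
rewrite [e]splitr; apply: ltrD; last exact: Hk1.
by apply: Hd => //; [rewrite subrr normr0|exact: Hk2].
Qed.

Lemma funs_cvg_add hi h fi f : funs_cvg hi h -> funs_cvg fi f ->
  funs_cvg (fun k t x => hi k t x + fi k t x) (fun t x => h t x + f t x).
Proof.
move=> H1 H2 e e0; have e2 : 0 < e / 2 by rewrite divr_gt0.
apply: filterS2 (H1 _ e2) (H2 _ e2) => k Hk1 Hk2 t x t01.
rewrite opprD addrACA [e]splitr; apply: le_lt_trans (ler_normD _ _) _.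
by apply: ltrD; [exact: Hk1|exact: Hk2].
Qed.

Lemma funs_cvg_opp hi h : funs_cvg hi h ->
  funs_cvg (fun k t x => - hi k t x) (fun t x => - h t x).
Proof.
move=> H1 e e0; apply: filterS (H1 _ e0) => k Hk t x t01.
by rewrite -opprD normrN; exact: Hk.
Qed.

Lemma maps_cvg_mcv Phii Phi (t : R) : maps_cvg Phii Phi -> 0 <= t <= 1 ->
  mcv G (fun k => Phii k t) (Phi t).
Proof. by move=> H t01 e e0; apply: filterS (H e e0) => k Hk x; exact: Hk. Qed.

Lemma funs_cvg_ucv hi h (t : R) : funs_cvg hi h -> 0 <= t <= 1 ->
  ucv (fun k => hi k t) (h t).
Proof. by move=> H t01 e e0; apply: filterS (H e e0) => k Hk x; exact: Hk. Qed.

Lemma funs_cvg_bounded hi h : jcont h -> funs_cvg hi h -> exists B : R,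
  (forall (t : R) x, 0 <= t <= 1 -> `|h t x| <= B) /\
  \forall k \near \oo, forall (t : R) x, 0 <= t <= 1 -> `|hi k t x| <= B.
Proof.
move=> jh H; have [B B0 HB] := jcont_bounded jh.
exists (B + 1); split=> [t x t01|]; first by apply: le_trans (HB t x t01) _; rewrite lerDl.
apply: filterS (H 1 ltr01) => k Hk t x t01.
have -> : hi k t x = h t x - (h t x - hi k t x) by ring.
apply: le_trans (ler_normB _ _) _; apply: lerD; first exact: HB.
by apply: ltW; exact: Hk.
Qed.

Lemma funs_cvg_expR hi h : jcont h -> funs_cvg hi h ->
  funs_cvg (fun k t x => expR (hi k t x)) (fun t x => expR (h t x)).
Proof.
move=> jh H e e0; have [B B0 HB] := jcont_bounded jh.
have eB : 0 < e / expR B by rewrite divr_gt0 // expR_gt0.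
have c0 : expR (- r) @[r --> (0 : R)] --> (1 : R).
  rewrite -[X in _ --> X]expR0 -{2}oppr0; apply: continuous_comp.
    exact: cvgN cvg_id.
  exact: continuous_expR.
move/cvgrPdist_lt : c0 => /(_ _ eB) /nbhs_ballP[d /= d0 Hd].
apply: filterS (H d d0) => k Hk t x t01.
have -> : expR (h t x) - expR (hi k t x) =
    expR (h t x) * (1 - expR (- (h t x - hi k t x))).
  by rewrite mulrBr mulr1 -expRD opprB addrCA subrr addr0.
rewrite normrM ger0_norm ?expR_ge0 //.
apply: (@le_lt_trans _ _ (expR B * `|1 - expR (- (h t x - hi k t x))|)).
  by apply: ler_wpM2r => //; rewrite ler_expR; apply: le_trans (HB t x t01); exact: ler_norm.
rewrite mulrC -ltr_pdivlMr ?expR_gt0 //; apply: Hd.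
by rewrite /ball /= sub0r normrN; exact: Hk.
Qed.

End ConvergenceUniformInTime.

Section SupDistances.
Variables (R : realType) (m : nat) (M : closed_manifold R m.+1).
Variable G : riemannian_metric M.
Implicit Types (phi psi : M -> M) (Phi Psi : R -> M -> M) (h f : R -> M -> R).
Local Open Scope ereal_scope.

Let d := riem_dist G.

Lemma sup_riem_ge0 phi psi :
  0 <= ereal_sup [set (d (phi x) (psi x))%:E | x in [set: M]].
Proof.
apply: le_trans (ereal_sup_ubound _); last by exists point.
by rewrite lee_fin; exact: riem_dist_ge0.
Qed.

Lemma dbar_map_ge0 phi psi : 0 <= dbar_map G phi psi.
Proof. by apply: adde_ge0; exact: sup_riem_ge0. Qed.

Lemma dbar_ge0 Phi Psi : 0 <= dbar G Phi Psi.
Proof.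
apply: le_trans (dbar_map_ge0 (Phi 0%R) (Psi 0%R)) _; apply: ereal_sup_ubound.
by exists 0%R => //=; rewrite in_itv /= lexx ler01.
Qed.

Lemma dbar_ge Phi Psi (t : R) x : (0 <= t <= 1)%R ->
  (d (Phi t x) (Psi t x))%:E <= dbar G Phi Psi /\
  (d (inv_map (Phi t) x) (inv_map (Psi t) x))%:E <= dbar G Phi Psi.
Proof.
move=> t01; have le : dbar_map G (Phi t) (Psi t) <= dbar G Phi Psi.
  by apply: ereal_sup_ubound; exists t => //=; rewrite in_itv.
split; apply: le_trans le.
  apply: le_trans (leeDl _ (sup_riem_ge0 (inv_map (Phi t)) (inv_map (Psi t)))).
  by apply: ereal_sup_ubound; exists x.
apply: le_trans (leeDr _ (sup_riem_ge0 (Phi t) (Psi t))).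
by apply: ereal_sup_ubound; exists x.
Qed.

Lemma dbar_le Phi Psi (a b : \bar R) :
  (forall (t : R) x, (0 <= t <= 1)%R -> (d (Phi t x) (Psi t x))%:E <= a /\
    (d (inv_map (Phi t) x) (inv_map (Psi t) x))%:E <= b) ->
  dbar G Phi Psi <= a + b.
Proof.
move=> H; apply: ub_ereal_sup => _ [t + <-]; rewrite /= in_itv /= => t01.
by apply: leeD; apply: ub_ereal_sup => _ [x _ <-]; have [] := H t x t01.
Qed.

Lemma unif_dist_ge h f (t : R) x : (0 <= t <= 1)%R ->
  (`|h t x - f t x|)%:E <= unif_dist h f.
Proof.
by move=> t01; apply: ereal_sup_ubound; exists (t, x) => //; split => //=; rewrite in_itv.
Qed.

Lemma unif_dist_le h f (a : \bar R) :
  (forall (t : R) x, (0 <= t <= 1)%R -> (`|h t x - f t x|)%:E <= a) ->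
  unif_dist h f <= a.
Proof.
move=> H; apply: ub_ereal_sup => _ [[t x] [/= + _] <-]; rewrite in_itv /=; exact: H.
Qed.

Lemma unif_dist_ge0 h f : 0 <= unif_dist h f.
Proof.
apply: le_trans (unif_dist_ge h f point (_ : 0 <= (0 : R) <= 1)%R); first by rewrite lee_fin.
by rewrite lexx ler01.
Qed.

Lemma unif_dist_sym h f : unif_dist h f = unif_dist f h.
Proof. by congr ereal_sup; apply: eq_imagel => p _; rewrite distrC. Qed.

Lemma unif_dist_triangle h f g : unif_dist h g <= unif_dist h f + unif_dist f g.
Proof.
apply: unif_dist_le => t x t01.
apply: (@le_trans _ _ ((`|h t x - f t x|)%:E + (`|f t x - g t x|)%:E)).
  by rewrite -EFinD lee_fin; exact: ler_distD.
by apply: leeD; exact: unif_dist_ge.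
Qed.

Lemma dbar_triangle Phi Psi Xi : dbar G Phi Xi <= dbar G Phi Psi + dbar G Psi Xi.
Proof.
apply: ub_ereal_sup => _ [t t01 <-].
apply: (@le_trans _ _ (dbar_map G (Phi t) (Psi t) + dbar_map G (Psi t) (Xi t))).
  have sup_triangle (a b c : M -> M) : 
      ereal_sup [set (d (a x) (c x))%:E | x in [set: M]] <=
      ereal_sup [set (d (a x) (b x))%:E | x in [set: M]] +
      ereal_sup [set (d (b x) (c x))%:E | x in [set: M]].
    apply: ub_ereal_sup => _ [x _ <-].
    apply: (@le_trans _ _ ((d (a x) (b x))%:E + (d (b x) (c x))%:E)).
      by rewrite -EFinD lee_fin; exact: riem_dist_triangle.
    by apply: leeD; apply: ereal_sup_ubound; exists x.
  by rewrite /dbar_map addeACA; apply: leeD; exact: sup_triangle.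
by apply: leeD; apply: ereal_sup_ubound; exists t.
Qed.

Lemma dbar_cvg (Phii : nat -> R -> M -> M) Phi :
  small (fun k => dbar G Phi (Phii k)) <->
  maps_cvg G Phii Phi /\
  maps_cvg G (fun k t => inv_map (Phii k t)) (fun t => inv_map (Phi t)).
Proof.
split=> [H|[H1 H2] e e0].
  split=> e e0; apply: filterS (H e e0) => k Hk t x t01.
    by rewrite -lte_fin; apply: le_lt_trans Hk; have [] := dbar_ge Phi (Phii k) x t01.
  by rewrite -lte_fin; apply: le_lt_trans Hk; have [] := dbar_ge Phi (Phii k) x t01.
have e3 : (0 < e / 3)%R by rewrite divr_gt0.
apply: filterS2 (H1 _ e3) (H2 _ e3) => k Hk1 Hk2.
apply: (@le_lt_trans _ _ ((e / 3)%:E + (e / 3)%:E)); last by rewrite -EFinD lte_fin; lra.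
by apply: dbar_le => t x t01; split; rewrite lee_fin; apply: ltW; [exact: Hk1|exact: Hk2].
Qed.

Lemma dbar_small_sym (Phii : nat -> R -> M -> M) Phi :
  small (fun k => dbar G Phi (Phii k)) <-> small (fun k => dbar G (Phii k) Phi).
Proof.
split=> [/dbar_cvg[H1 H2] e e0|H].
  have e3 : (0 < e / 3)%R by rewrite divr_gt0.
  apply: filterS2 (maps_cvg_sym H1 e3) (maps_cvg_sym H2 e3) => k Hk1 Hk2.
  apply: (@le_lt_trans _ _ ((e / 3)%:E + (e / 3)%:E)); last by rewrite -EFinD lte_fin; lra.
  by apply: dbar_le => t x t01; split; rewrite lee_fin; apply: ltW; [exact: Hk1|exact: Hk2].
apply/dbar_cvg; split=> e e0; have [r r0 Hr] := riem_dist_sym G e0;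
  apply: filterS (H r r0) => k Hk t x t01; apply: Hr; rewrite -lte_fin;
  by apply: le_lt_trans Hk; have [] := dbar_ge (Phii k) Phi x t01.
Qed.

Lemma unif_dist_cvg (hi : nat -> R -> M -> R) h :
  small (fun k => unif_dist h (hi k)) <-> funs_cvg hi h.
Proof.
split=> H e e0.
  apply: filterS (H e e0) => k Hk t x t01.
  by rewrite -lte_fin; apply: le_lt_trans Hk; exact: unif_dist_ge.
have e2 : (0 < e / 2)%R by rewrite divr_gt0.
apply: filterS (H _ e2) => k Hk; apply: (@le_lt_trans _ _ (e / 2)%:E).
  by apply: unif_dist_le => t x t01; rewrite lee_fin; apply: ltW; exact: Hk.
by rewrite lte_fin; lra.
Qed.

End SupDistances.

(** * Products and inverses of topological contact systems *)

Lemma small_shift (R : realType) (u : nat -> \bar R) (N : nat) :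
  small (fun k => u (k + N)%N) -> small u.
Proof.
move=> H e e0; have [m _ Hm] := H e e0; exists (m + N)%N => // k /= mk.
have Nk : (N <= k)%N by apply: leq_trans mk; exact: leq_addl.
by rewrite -(subnK Nk); apply: Hm => /=; rewrite leq_subRL // addnC.
Qed.

Lemma near_shift (N : nat) (P : nat -> Prop) :
  (\forall k \near \oo, P k) -> \forall k \near \oo, P (k + N)%N.
Proof.
move=> [m _ Hm]; exists m => // k /= mk; apply: Hm => /=.
by apply: leq_trans mk _; exact: leq_addr.
Qed.

Section AdmissibleSystems.
Variables (R : realType) (n : nat) (M : closed_manifold R n.*2.+1).
Variables (alpha : contact_form M) (mu : {measure set (borel M) -> \bar R}).
Hypothesis hmu : is_contact_volume alpha mu.
Variable G : riemannian_metric M.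
Implicit Types (s : system R M) (si : nat -> system R M).

(* A class containing the smooth systems, closed under products, inverses and
   limits, on which the three parts of [contact_dist] behave. *)
Record admissible s : Prop := Admissible {
  adm_flow : jcont (flow s);
  adm_inv : jcont (fun t => inv_map (flow s t));
  adm_bij : forall t : R, 0 <= t <= 1 -> bijective (flow s t);
  adm_conf : jcont (conf s);
  adm_ham : smeas (ham s);
  adm_fin : (norm1oo mu (ham s) < +oo)%E }.

Lemma norm1oo_bounded (H : R -> M -> R) (B : R) : smeas H ->
  (forall (t : R) x, 0 <= t <= 1 -> `|H t x| <= B) -> (norm1oo mu H < +oo)%E.
Proof.
move=> sH HB; apply: (@le_lt_trans _ _ (3 * B)%:E); last exact: ltry.
have B0 : 0 <= B.
  by apply: le_trans (HB 0 point _); rewrite ?lexx ?ler01 // normr_ge0.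
apply: (@le_trans _ _ (\int[lebesgue_measure]_(t in `[0%R, 1%R]) (3 * B)%:E)%E).
  apply: ge0_le_integral_any => t t01; first exact: (smeas_norm_ge0 hmu sH).
  have t01' : 0 <= t <= 1 by move: t01; rewrite /= in_itv.
  rewrite lee_fin; apply: (ham_norm_le hmu); first exact: sH.1.
  by move=> x; exact: HB.
rewrite integral_cst //= lebesgue_measure_itv /= lte_fin ltr01.
by rewrite oppr0 adde0 mule1.
Qed.

Lemma norm1oo_self s : norm1oo mu (fun t x => ham s t x - ham s t x) = 0%E.
Proof.
have c0 : continuous (fun _ : M => 0 : R) by move=> x; exact: cvg_cst.
have h0 : ham_norm mu (fun _ : M => 0) = 0.
  apply/eqP; rewrite eq_le (ham_norm_ge0 hmu) // andbT -[leRHS](mulr0 3).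
  by apply: (ham_norm_le hmu) => // x; rewrite normr0.
rewrite /norm1oo -[RHS](integral0 lebesgue_measure `[(0 : R), 1]%classic).
apply: eq_integral => t _.
have -> : (fun x => ham s t x - ham s t x) = (fun=> 0) by apply/funext => x; rewrite subrr.
by rewrite h0.
Qed.


Local Opaque norm1oo dbar unif_dist.

Lemma smooth_cds_admissible s : smooth_cds alpha s -> admissible s.
Proof.
move=> Cs; have [jh jc] := smooth_cds_jcont Cs; have [B B0 HB] := jcont_bounded jh.
have sh := smeas_jcont G jh.
split => //.
- by apply/jcontP; have [] := smooth_cds_family Cs.
- by apply/jcontP; have [] := smooth_cds_inv_family Cs.
- by move=> t t01; have [] := smooth_cds_flow Cs t01.
- exact: (norm1oo_bounded sh HB).
Qed.

Definition sys_cvg si s : Prop :=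
  [/\ maps_cvg G (fun k => flow (si k)) (flow s),
      maps_cvg G (fun k t => inv_map (flow (si k) t)) (fun t => inv_map (flow s t)),
      funs_cvg (fun k => conf (si k)) (conf s)
    & small (fun k => norm1oo mu (fun t x => ham s t x - ham (si k) t x))].

Lemma admissible_tcds s : admissible s ->
  (exists si, (forall k, smooth_cds alpha (si k)) /\ sys_cvg si s) ->
  is_tcds alpha G mu s.
Proof.
move=> [jf ji bf jc sh fh] [si [Cs [c1 c2 c3 c4]]]; split.
- split; first exact/jcontP.
  move=> t t01; have [K1 K2] := inv_mapK (bf t t01).
  exists (inv_map (flow s t)); split => //; first exact: jcont_slice jf t01.
  exact: jcont_slice ji t01.
- exact/L1C0P.
- exists si; split => //.
  + apply: small_cvg0; first by move=> k; exact: dbar_ge0.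
    have [H _] := dbar_small_sym G (fun k => flow (si k)) (flow s).
    by apply: H; have [_] := dbar_cvg G (fun k => flow (si k)) (flow s); apply.
  + apply: small_cvg0; first by move=> k; exact: unif_dist_ge0.
    under eq_fun do rewrite unif_dist_sym.
    exact/unif_dist_cvg.
  + apply: small_cvg0 => // k; apply: (norm1oo_ge0 hmu).
    by apply: smeas_sub => //; exact: adm_ham (smooth_cds_admissible (Cs k)).
Qed.

Lemma tcds_admissible s : is_tcds alpha G mu s -> admissible s /\
  exists si, (forall k, smooth_cds alpha (si k)) /\ sys_cvg si s.
Proof.
move=> [[jf hf] Lh [si [Cs c1 c2 c3]]].
have [m1 m2] : maps_cvg G (fun k => flow (si k)) (flow s) /\
    maps_cvg G (fun k t => inv_map (flow (si k) t)) (fun t => inv_map (flow s t)).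
  have [H _] := dbar_cvg G (fun k => flow (si k)) (flow s); apply: H.
  have [_ H] := dbar_small_sym G (fun k => flow (si k)) (flow s); apply: H.
  exact: cvg0_small.
have m3 : funs_cvg (fun k => conf (si k)) (conf s).
  apply/unif_dist_cvg; under eq_fun do rewrite unif_dist_sym.
  exact: cvg0_small.
have ad k := smooth_cds_admissible (Cs k).
split; last by exists si; split => //; split => //; exact: cvg0_small.
have [sh fh] : smeas (ham s) /\ (norm1oo mu (ham s) < +oo)%E by exact/L1C0P.
split => //; first exact/jcontP.
- by apply: maps_cvg_jcont m2 => k; exact: adm_inv.
- move=> t t01; have [psi [K1 K2 _ _]] := hf t t01.
  by exists psi.
- by apply: funs_cvg_jcont m3 => k; exact: adm_conf.
Qed.

Lemma flow_mul_inv s s' : admissible s -> admissible s' ->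
  forall t : R, 0 <= t <= 1 -> inv_map (flow (sys_mul s s') t) =
    (fun x => inv_map (flow s' t) (inv_map (flow s t) x)).
Proof.
by move=> a a' t t01; rewrite inv_map_comp //; exact: adm_bij.
Qed.

Lemma jcont_expR (h : R -> M -> R) : jcont h -> jcont (fun t x => expR (h t x)).
Proof.
move=> jh; apply: (@jcont_comp _ M R R (fun=> expR) h) => //.
by apply: jcont_cst; exact: continuous_expR.
Qed.

Lemma jcont_opp (h : R -> M -> R) : jcont h -> jcont (fun t x => - h t x).
Proof. by move=> jh t x t01; apply: cvgN; exact: jh. Qed.

Lemma norm1oo_twist (a H : R -> M -> R) (Phi : R -> M -> M) :
  jcont a -> jcont Phi -> smeas H -> (norm1oo mu H < +oo)%E ->
  (norm1oo mu (fun t x => (a t x * H t (Phi t x))%R) < +oo)%E.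
Proof.
move=> ja jP sH fH; have [B B0 HB] := jcont_bounded ja.
apply: (@le_lt_trans _ _ ((3 * B)%:E * norm1oo mu H)%E).
  apply: (norm1oo_le hmu (smeas_twist G ja jP sH) sH B0) => t x t01.
  rewrite normrM; apply: ler_pM => //; first exact: HB.
  by apply: (le_ham_norm hmu); exact: sH.1.
by rewrite lte_mul_pinfty // ?lee_fin ?mulr_ge0 // ltW.
Qed.

Lemma admissible_mul s s' : admissible s -> admissible s' ->
  admissible (sys_mul s s').
Proof.
move=> a a'; have [jf ji bf jc sh fh] := a; have [jf' ji' bf' jc' sh' fh'] := a'.
have je := jcont_expR (jcont_comp jc ji).
have st := smeas_twist G je ji sh'.
split => /=.
- exact: (jcont_comp jf jf').
- apply: jcont_eq (jcont_comp ji' ji) => t x t01.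
  by have /= -> := flow_mul_inv a a' t01.
- by move=> t t01; apply: bij_comp; [exact: bf|exact: bf'].
- by move=> t x t01; apply: cvgD; [exact: (jcont_comp jc jf')|exact: jc'].
- exact: smeas_add.
- apply: le_lt_trans (norm1ooD hmu sh st) _.
  exact: (lte_add_pinfty fh (norm1oo_twist je ji sh' fh')).
Qed.

Lemma admissible_inv s : admissible s -> admissible (sys_inv s).
Proof.
move=> [jf ji bf jc sh fh].
have je := jcont_expR (jcont_opp jc).
have st := smeas_twist G je jf sh.
split.
- exact: ji.
- by apply: jcont_eq jf => t x t01; rewrite inv_mapV //; exact: bf.
- by move=> t t01; apply: inv_map_bij; exact: bf.
- exact: (jcont_opp (jcont_comp jc ji)).
- exact: smeas_opp.
- by rewrite (norm1ooN hmu st); exact: (norm1oo_twist je jf sh fh).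
Qed.

Lemma small_ham_twist (a : R -> M -> R) (ai : nat -> R -> M -> R)
    (Psi : R -> M -> M) (Psii : nat -> R -> M -> M) s si :
  jcont a -> (forall k, jcont (ai k)) -> jcont Psi -> (forall k, jcont (Psii k)) ->
  admissible s -> (forall k, admissible (si k)) ->
  funs_cvg ai a -> maps_cvg G Psii Psi -> sys_cvg si s ->
  small (fun k => norm1oo mu (fun t x => a t x * ham s t (Psi t x)
                                   - ai k t x * ham (si k) t (Psii k t x))).
Proof.
move=> ja jai jP jPi ad adi ca cP [_ _ _ ch].
have [B [aB [N _ aiB]]] := funs_cvg_bounded ja ca.
apply: (@small_shift _ _ N).
have B0 : 0 < Num.max B 1 by rewrite lt_max ltr01 orbT.
have le b : b <= B -> b <= Num.max B 1 by move=> bB; rewrite le_max bB.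
apply: (@small_twist _ _ _ _ _ hmu G a (fun k => ai (k + N)%N) Psi
  (fun k => Psii (k + N)%N) (ham s) (fun k => ham (si (k + N)%N)) (Num.max B 1)
  ja (fun k => jai (k + N)%N) jP (fun k => jPi (k + N)%N) (adm_ham ad) (adm_fin ad)
  (fun k => adm_ham (adi (k + N)%N)) B0).
- by move=> t x t01; apply/le/aB.
- by move=> k t x t01; apply/le/aiB => //=; exact: leq_addl.
- move=> t t01 e e0; apply: (@near_shift N (fun k => forall x, `|a t x - ai k t x| < e)).
  exact: funs_cvg_ucv ca t01 e e0.
- move=> t t01 e e0; apply: (@near_shift N
    (fun k => forall x, riem_dist G (Psi t x) (Psii k t x) < e)).
  exact: maps_cvg_mcv cP t01 e e0.
- move=> e e0; apply: (@near_shift N (fun k =>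
    (norm1oo mu (fun t x => ham s t x - ham (si k) t x)%R < e%:E)%E)).
  exact: ch.
Qed.

Lemma sys_cvg_mul s s' si si' : admissible s -> admissible s' ->
  (forall k, admissible (si k)) -> (forall k, admissible (si' k)) ->
  sys_cvg si s -> sys_cvg si' s' ->
  sys_cvg (fun k => sys_mul (si k) (si' k)) (sys_mul s s').
Proof.
move=> a a' ai ai' cs cs'; have [c1 c2 c3 c4] := cs; have [c1' c2' c3' c4'] := cs'.
have cc : funs_cvg (fun k t x => conf (si k) t (inv_map (flow (si k) t) x))
    (fun t x => conf s t (inv_map (flow s t) x)).
  by apply: funs_cvg_comp c3 c2; exact: adm_conf.
have jc : jcont (fun t x => conf s t (inv_map (flow s t) x)).
  by apply: jcont_comp; [exact: adm_conf|exact: adm_inv].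
split => /=.
- by apply: maps_cvg_comp c1 c1'; exact: adm_flow.
- move=> e e0; apply: filterS (maps_cvg_comp (adm_inv a') c2' c2 e0) => k Hk t x t01.
  have /= -> := flow_mul_inv a a' t01.
  by have /= -> := flow_mul_inv (ai k) (ai' k) t01; exact: Hk.
- apply: funs_cvg_add => //; apply: funs_cvg_comp c3 c1'; exact: adm_conf.
- have je := jcont_expR jc.
  have jei k : jcont (fun t x => expR (conf (si k) t (inv_map (flow (si k) t) x))).
    by apply/jcont_expR/jcont_comp; [exact: adm_conf|exact: adm_inv].
  have := small_ham_twist je jei (adm_inv a) (fun k => adm_inv (ai k)) a' ai'
    (funs_cvg_expR jc cc) c2 cs'.
  move=> /(smallD c4); apply: small_le; apply: filterE => k.
  have sa := smeas_sub (adm_ham a) (adm_ham (ai k)).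
  have sb := smeas_sub (smeas_twist G je (adm_inv a) (adm_ham a'))
    (smeas_twist G (jei k) (adm_inv (ai k)) (adm_ham (ai' k))).
  apply: le_trans (norm1ooD hmu sa sb).
  rewrite le_eqVlt; apply/orP; left; apply/eqP; apply: norm1oo_eq => t _.
  by apply/funext => x; rewrite opprD addrACA.
Qed.

Lemma sys_cvg_inv s si : admissible s -> (forall k, admissible (si k)) ->
  sys_cvg si s -> sys_cvg (fun k => sys_inv (si k)) (sys_inv s).
Proof.
move=> a ai cs; have [c1 c2 c3 c4] := cs.
have je := jcont_expR (jcont_opp (adm_conf a)).
have jei k := jcont_expR (jcont_opp (adm_conf (ai k))).
split; first exact: c2.
- move=> e e0; apply: filterS (c1 e e0) => k Hk t x t01.
  by rewrite !inv_mapV; [exact: Hk|exact: adm_bij|exact: adm_bij].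
- by apply: funs_cvg_opp; apply: funs_cvg_comp c3 c2; exact: adm_conf.
- have := small_ham_twist je jei (adm_flow a) (fun k => adm_flow (ai k)) a ai
    (funs_cvg_expR (jcont_opp (adm_conf a)) (funs_cvg_opp c3)) c1 cs.
  apply: small_le; apply: filterE => k.
  have sb := smeas_sub (smeas_twist G je (adm_flow a) (adm_ham a))
    (smeas_twist G (jei k) (adm_flow (ai k)) (adm_ham (ai k))).
  rewrite -(norm1ooN hmu sb) le_eqVlt; apply/orP; left; apply/eqP.
  by apply: norm1oo_eq => t _; apply/funext => x; rewrite opprD.
Qed.

Lemma tcds_mul s s' : is_tcds alpha G mu s -> is_tcds alpha G mu s' ->
  is_tcds alpha G mu (sys_mul s s').
Proof.
move=> /tcds_admissible[a [si [Cs cs]]] /tcds_admissible[a' [si' [Cs' cs']]].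
apply: admissible_tcds; first exact: admissible_mul.
exists (fun k => sys_mul (si k) (si' k)); split=> [k|]; first exact: smooth_cds_mul.
by apply: sys_cvg_mul => // k; exact: smooth_cds_admissible.
Qed.

Lemma tcds_inv s : is_tcds alpha G mu s -> is_tcds alpha G mu (sys_inv s).
Proof.
move=> /tcds_admissible[a [si [Cs cs]]].
apply: admissible_tcds; first exact: admissible_inv.
exists (fun k => sys_inv (si k)); split=> [k|]; first exact: smooth_cds_inv.
by apply: sys_cvg_inv => // k; exact: smooth_cds_admissible.
Qed.

Lemma sys_cvg_cst s : sys_cvg (fun=> s) s.
Proof.
split=> e e0; apply: filterE => k; rewrite ?norm1oo_self ?lte_fin // => t x _;
  by rewrite ?riem_dist_refl // subrr normr0.
Qed.

Lemma tcds_one : is_tcds alpha G mu (sys_one M).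
Proof.
have C1 := smooth_cds_one alpha.
apply: admissible_tcds; first exact: smooth_cds_admissible.
by exists (fun=> sys_one M); split => //; exact: sys_cvg_cst.
Qed.

Local Notation dist := (contact_dist G mu).

Lemma contact_dist_cvg s si : admissible s -> (forall k, admissible (si k)) ->
  small (fun k => dist s (si k)) <-> sys_cvg si s.
Proof.
move=> a ai.
have n0 k : (0 <= norm1oo mu (fun t x => ham s t x - ham (si k) t x)%R)%E.
  by apply: (norm1oo_ge0 hmu); apply: smeas_sub; exact: adm_ham.
split=> [H|[c1 c2 c3 c4]].
  have [c1 c2] : maps_cvg G (fun k => flow (si k)) (flow s) /\
    maps_cvg G (fun k t => inv_map (flow (si k) t)) (fun t => inv_map (flow s t)).
    apply/dbar_cvg; apply: small_le H; apply: filterE => k.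
    by rewrite /contact_dist -addeA leeDl // adde_ge0 // unif_dist_ge0.
  split => //.
    apply/unif_dist_cvg; apply: small_le H; apply: filterE => k.
    by rewrite /contact_dist addeAC leeDr // adde_ge0 // dbar_ge0.
  apply: small_le H; apply: filterE => k.
  by rewrite /contact_dist leeDr // adde_ge0 ?dbar_ge0 ?unif_dist_ge0.
apply: smallD => //; apply: smallD; first exact/dbar_cvg.
exact/unif_dist_cvg.
Qed.

Lemma contact_dist_refl s : dist s s = 0%E.
Proof.
apply/eqP; rewrite eq_le; apply/andP; split.
  rewrite /contact_dist norm1oo_self adde0 -[leRHS]adde0; apply: leeD.
    rewrite -[leRHS]adde0; apply: dbar_le => t x _.
    by rewrite !riem_dist_refl.
  by apply: unif_dist_le => t x _; rewrite subrr normr0.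
by rewrite /contact_dist norm1oo_self adde0 adde_ge0 ?dbar_ge0 ?unif_dist_ge0.
Qed.

Lemma contact_dist_ge0 s s' : admissible s -> admissible s' -> (0 <= dist s s')%E.
Proof.
move=> a a'; apply: adde_ge0; first by apply: adde_ge0; [exact: dbar_ge0|exact: unif_dist_ge0].
by apply: (norm1oo_ge0 hmu); apply: smeas_sub; exact: adm_ham.
Qed.

Lemma contact_dist_triangle s u v : admissible s -> admissible u -> admissible v ->
  (dist s v <= dist s u + dist u v)%E.
Proof.
move=> a b c; rewrite /contact_dist [leRHS]addeACA; apply: leeD.
  by rewrite [leRHS]addeACA; apply: leeD; [exact: dbar_triangle|exact: unif_dist_triangle].
have sa := smeas_sub (adm_ham a) (adm_ham b).
have sb := smeas_sub (adm_ham b) (adm_ham c).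
apply: le_trans (norm1ooD hmu sa sb).
rewrite le_eqVlt; apply/orP; left; apply/eqP; apply: norm1oo_eq => t _.
by apply/funext => x; rewrite addrA subrK.
Qed.

Lemma contact_dist_mul s s' (e : R) : admissible s -> admissible s' -> 0 < e ->
  exists2 d : R, 0 < d & forall u u', admissible u -> admissible u' ->
    (dist s u < d%:E)%E -> (dist s' u' < d%:E)%E ->
    (dist (sys_mul s s') (sys_mul u u') < e%:E)%E.
Proof.
move=> a a' e0; apply: contrapT => N.
have /choice[u Hu] k : exists p : system R M * system R M,
    [/\ admissible p.1, admissible p.2, (dist s p.1 < (k.+1%:R^-1)%:E)%E,
      (dist s' p.2 < (k.+1%:R^-1)%:E)%E
    & ~ (dist (sys_mul s s') (sys_mul p.1 p.2) < e%:E)%E].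
  apply: contrapT => N'; apply: N; exists k.+1%:R^-1; first by rewrite invr_gt0 ltr0n.
  move=> v v' av av' dv dv'; apply: contrapT => N.
  exact: N' (ex_intro _ (v, v') (And5 av av' dv dv' N)).
have sm (f : nat -> \bar R) : (forall k, f k < (k.+1%:R^-1)%:E)%E -> small f.
  move=> Hf d d0; near=> k; apply: lt_trans (Hf k) _; rewrite lte_fin.
  by near: k; exact: near_infty_natSinv_lt (PosNum d0).
have a1 k : admissible (u k).1 by have [] := Hu k.
have a2 k : admissible (u k).2 by have [] := Hu k.
have c1 : sys_cvg (fun k => (u k).1) s.
  by apply/contact_dist_cvg => //; apply: sm => k; have [] := Hu k.
have c2 : sys_cvg (fun k => (u k).2) s'.
  by apply/contact_dist_cvg => //; apply: sm => k; have [] := Hu k.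
have am k := admissible_mul (a1 k) (a2 k).
have /(contact_dist_cvg (admissible_mul a a') am) /(_ _ e0) /filter_ex[k] :=
  sys_cvg_mul a a' a1 a2 c1 c2.
by have [] := Hu k.
Unshelve. all: by end_near. Qed.

Lemma contact_dist_inv s (e : R) : admissible s -> 0 < e ->
  exists2 d : R, 0 < d & forall u, admissible u ->
    (dist s u < d%:E)%E -> (dist (sys_inv s) (sys_inv u) < e%:E)%E.
Proof.
move=> a e0; apply: contrapT => N.
have /choice[u Hu] k : exists p : system R M,
    [/\ admissible p, (dist s p < (k.+1%:R^-1)%:E)%E
    & ~ (dist (sys_inv s) (sys_inv p) < e%:E)%E].
  apply: contrapT => N'; apply: N; exists k.+1%:R^-1; first by rewrite invr_gt0 ltr0n.
  move=> v av dv; apply: contrapT => N.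
  exact: N' (ex_intro _ v (And3 av dv N)).
have a1 k : admissible (u k) by have [] := Hu k.
have c1 : sys_cvg u s.
  apply/contact_dist_cvg => // d d0; near=> k.
  have [_ Hk _] := Hu k; apply: lt_trans Hk _; rewrite lte_fin.
  by near: k; exact: near_infty_natSinv_lt (PosNum d0).
have am k := admissible_inv (a1 k).
have /(contact_dist_cvg (admissible_inv a) am) /(_ _ e0) /filter_ex[k] :=
  sys_cvg_inv a a1 c1.
by have [] := Hu k.
Unshelve. all: by end_near. Qed.

End AdmissibleSystems.

(** * The quotient topology *)

Section ContactTopology.
Variables (R : realType) (n : nat) (M : closed_manifold R n.*2.+1).
Variables (alpha : contact_form M) (G : riemannian_metric M).
Variable mu : {measure set (borel M) -> \bar R}.
Hypothesis hmu : is_contact_volume alpha mu.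

Local Notation T := (TCDS alpha G mu).
Local Notation H := (contact_homeo alpha G mu).
Local Notation dist := (contact_dist G mu).
Local Notation ev := (@ev1 R n M alpha G mu).

Implicit Types (s u v : T) (phi psi : H).

Lemma tcds_adm s : admissible mu (sval s).
Proof. by have [] := tcds_admissible hmu (svalP s). Qed.

Definition mulT s u : T :=
  exist _ (sys_mul (sval s) (sval u)) (tcds_mul hmu (svalP s) (svalP u)).

Definition invT s : T := exist _ (sys_inv (sval s)) (tcds_inv hmu (svalP s)).

Definition oneT : T := exist _ (sys_one M) (tcds_one hmu G).

Definition tball s (e : R) : set T := [set u | (dist (sval s) (sval u) < e%:E)%E].

Lemma tball_center s (e : R) : 0 < e -> tball s e s.
Proof. by move=> e0; rewrite /tball /= (contact_dist_refl hmu) lte_fin. Qed.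

Lemma tball_open s (e : R) : open (tball s e).
Proof.
move=> u; rewrite /tball /=; have := contact_dist_ge0 hmu G (tcds_adm s) (tcds_adm u).
case E : (dist (sval s) (sval u)) => [r| |] // _; rewrite lte_fin => re.
exists (e - r); first by rewrite subr_gt0.
move=> v uv; apply: le_lt_trans
  (contact_dist_triangle hmu G (tcds_adm s) (tcds_adm u) (tcds_adm v)) _.
by rewrite E -[e](subrKC r) EFinD lteD2lE.
Qed.

Lemma homeo_inj phi psi : sval phi = sval psi -> phi = psi.
Proof. by case: phi psi => [f Hf] [g Hg] /= E; exact: eq_exist. Qed.

Lemma ev_surj phi : exists s, ev s = phi.
Proof. by have [s E] := svalP phi; exists s; exact: homeo_inj. Qed.

Lemma homeo_bij phi : bijective (sval phi).
Proof.
have [s <-] := ev_surj phi; apply: (adm_bij (tcds_adm s)).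
by rewrite ler01 lexx.
Qed.

Lemma contact_dist_eq01 (s s' u : system R M) :
  (forall t : R, 0 <= t <= 1 -> [/\ flow s t = flow s' t, ham s t = ham s' t &
     conf s t = conf s' t]) ->
  dist s u = dist s' u.
Proof.
move=> E; rewrite /contact_dist.
apply: (congr2 adde); first apply: (congr2 adde).
- congr ereal_sup; apply: eq_imagel => t; rewrite /= in_itv /= => t01.
  by have [-> _ _] := E t t01.
- congr ereal_sup; apply: eq_imagel => -[t x] [/= + _]; rewrite in_itv /= => t01.
  by have [_ _ ->] := E t t01.
- by apply: norm1oo_eq => t t01; apply/funext => x; have [_ -> _] := E t t01.
Qed.

Lemma mulT_invK s s' (t : R) : 0 <= t <= 1 ->
  let r := sval (mulT (mulT s (invT s)) s') in
  [/\ flow r t = flow (sval s') t, ham r t = ham (sval s') t &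
      conf r t = conf (sval s') t].
Proof.
move=> t01 /=; have [K1 K2] := inv_mapK (adm_bij (tcds_adm s) t01).
have fK : flow (sval s) t \o inv_map (flow (sval s) t) = id.
  by apply/funext => x; exact: K2.
split; apply/funext => x /=.
- by rewrite K2.
- rewrite fK inv_map_id /= K2 subrr expR0 mul1r.
  by rewrite mulrN mulrA -expRD subrr expR0 mul1r subrr add0r.
- by rewrite subrr add0r.
Qed.

(* Right translation by s^-1 * s' moves s to s' without changing time-one maps. *)
Lemma ev_open (O : set T) : open O -> open (ev @` O).
Proof.
move=> oO; suff H0 : TCDS_open (ev @^-1` (ev @` O)) by exact: H0.
move=> s [s' Os' E]; have [e e0 He] := (oO : TCDS_open O) s' Os'.
have [d1 d10 H1] := contact_dist_mul hmu G (tcds_adm (mulT s (invT s))) (tcds_adm s') e0.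
have [d d0 H2] := contact_dist_mul hmu G (tcds_adm s) (tcds_adm (invT s)) d10.
exists d => // u su; exists (mulT (mulT u (invT s)) s'); last first.
  apply: homeo_inj; have /= -> := congr1 (fun phi : H => sval phi) E.
  have [K1 _] := inv_mapK (homeo_bij (ev s)).
  by apply/funext => x /=; rewrite K1.
apply: He; rewrite -(contact_dist_eq01 _ (mulT_invK s s')).
apply: H1; [exact: (tcds_adm (mulT u (invT s)))|exact: tcds_adm| |].
- apply: H2; [exact: tcds_adm|exact: (tcds_adm (invT s))|exact: su|].
  by rewrite (contact_dist_refl hmu) lte_fin.
- by rewrite (contact_dist_refl hmu) lte_fin.
Qed.

Lemma nbhs_evP s (U : set H) : nbhs (ev s) U <->
  exists2 e : R, 0 < e & forall u, (dist (sval s) (sval u) < e%:E)%E -> U (ev u).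
Proof.
rewrite nbhsE; split=> [[V [oV Vs] VU]|[e e0 He]].
  have [e e0 He] := (oV : homeo_open V) s Vs.
  by exists e => // u /He; exact: VU.
exists (ev @` tball s e); last by move=> _ [u su <-]; exact: He.
split; first exact: (ev_open (@tball_open s e)).
by exists s => //; exact: tball_center.
Qed.

Lemma nbhs_ev_ball s (e : R) : 0 < e -> nbhs (ev s) (ev @` tball s e).
Proof. by move=> e0; apply/nbhs_evP; exists e => // u su; exists u. Qed.

Definition rep phi : T := sval (cid (ev_surj phi)).

Lemma ev_rep phi : ev (rep phi) = phi.
Proof. exact: svalP (cid (ev_surj phi)). Qed.

Definition hmul phi psi : H := ev (mulT (rep phi) (rep psi)).
Definition hone : H := ev oneT.
Definition hinv phi : H := ev (invT (rep phi)).

Lemma sval_hmul phi psi : sval (hmul phi psi) = sval phi \o sval psi.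
Proof. by rewrite -{2}(ev_rep phi) -{2}(ev_rep psi). Qed.

Lemma sval_hinv phi : sval (hinv phi) = inv_map (sval phi).
Proof. by rewrite -{2}(ev_rep phi). Qed.

Lemma hmul_ev s u : hmul (ev s) (ev u) = ev (mulT s u).
Proof. by apply: homeo_inj; rewrite sval_hmul. Qed.

Lemma hinv_ev s : hinv (ev s) = ev (invT s).
Proof. by apply: homeo_inj; rewrite sval_hinv. Qed.

Lemma hmul_continuous : continuous (fun p : H * H => hmul p.1 p.2).
Proof.
move=> [phi psi] U /=; have [s <-] := ev_surj phi; have [s' <-] := ev_surj psi.
rewrite hmul_ev => /nbhs_evP[e e0 He].
have [d d0 Hd] := contact_dist_mul hmu G (tcds_adm s) (tcds_adm s') e0.
exists (ev @` tball s d, ev @` tball s' d); first by split; exact: nbhs_ev_ball.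
move=> [_ _] [/= [u su <-] [u' su' <-]]; rewrite hmul_ev; apply: He.
exact: (Hd _ _ (tcds_adm u) (tcds_adm u') su su').
Qed.

Lemma hinv_continuous : continuous hinv.
Proof.
move=> phi U; have [s <-] := ev_surj phi; rewrite hinv_ev => /nbhs_evP[e e0 He].
have [d d0 Hd] := contact_dist_inv hmu G (tcds_adm s) e0.
apply/nbhs_evP; exists d => // u su; rewrite /= hinv_ev; apply: He.
exact: (Hd _ (tcds_adm u) su).
Qed.

Lemma homeo_hausdorff : hausdorff_space H.
Proof.
have nb phi x (U : set M) : nbhs (sval phi x) U -> nbhs phi [set chi : H | U (sval chi x)].
  have [s <-] := ev_surj phi => nU; have [e e0 He] := riem_dist_stays_near G nU.
  apply/nbhs_evP; exists e => // u su /=; apply: (nbhs_singleton He).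
  have t01 : 0 <= (1 : R) <= 1 by rewrite ler01 lexx.
  rewrite -lte_fin; apply: le_lt_trans su.
  have [le _] := dbar_ge G (flow (sval s)) (flow (sval u)) x t01.
  apply: le_trans le _; rewrite /contact_dist -addeA; apply: leeDl.
  apply: adde_ge0; first exact: unif_dist_ge0.
  by apply: (norm1oo_ge0 hmu); apply: smeas_sub; apply: (adm_ham (tcds_adm _)).
move=> phi psi clp; apply: homeo_inj; apply/funext => x.
apply: (@closed_manifold_hausdorff _ _ M) => A B nA nB.
by have [chi [Ac Bc]] := clp _ _ (nb phi x A nA) (nb psi x B nB); exists (sval chi x).
Qed.

Lemma homeo_first_countable : first_countable H.
Proof.
move=> phi; have [s <-] := ev_surj phi.
have r0 k : 0 < (k.+1%:R : R)^-1 by rewrite invr_gt0 ltr0n.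
exists (range (fun k => ev @` tball s k.+1%:R^-1)).
  exact: (card_image_le _ _).
split=> [_ [k _ <-]|U /nbhs_evP[e e0 He]]; first exact: nbhs_ev_ball.
have [k Hk] := filter_ex (near_infty_natSinv_lt (PosNum e0)).
exists (ev @` tball s k.+1%:R^-1); first by exists k.
move=> _ [u su <-]; apply: He; apply: lt_trans su _; rewrite lte_fin; exact: Hk.
Qed.

End ContactTopology.

Theorem theorem6p2 (R : realType) (n : nat) (M : closed_manifold R n.*2.+1)
    (alpha : contact_form M) (G : riemannian_metric M)
    (mu : {measure set (borel M) -> \bar R})
    (hmu : is_contact_volume alpha mu) :
  exists (mul : contact_homeo alpha G mu -> contact_homeo alpha G mu ->
                contact_homeo alpha G mu)
         (one : contact_homeo alpha G mu)
         (inv : contact_homeo alpha G mu -> contact_homeo alpha G mu),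
    [/\ forall phi psi, sval (mul phi psi) = sval phi \o sval psi,
        topological_group mul one inv
      & first_countable (contact_homeo alpha G mu)].
Proof.
exists (hmul hmu), (hone G hmu), (hinv hmu); split.
- exact: sval_hmul.
- split; [|exact: hmul_continuous|exact: hinv_continuous|exact: homeo_hausdorff].
  have K (phi : contact_homeo alpha G mu) := inv_mapK (homeo_bij hmu phi).
  split=> [phi psi chi|phi|phi|phi|phi]; apply: homeo_inj;
    rewrite !sval_hmul ?sval_hinv //; apply/funext => x /=; first exact: (K phi).1.
  exact: (K phi).2.
- exact: homeo_first_countable.
Qed.
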